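(* Let $p(\cdot)\in\mathcal{P}(\mathbb{R}^n)$, $\omega\in\mathcal{W}_{p(\cdot)}(\mathbb{R}^n)$, and let $s\in(1,\infty)$ be an exponent such that $\mathcal{M}$ is bounded on $L^{(sp(\cdot))'/\kappa}_{\omega^{-\kappa/s}}(\mathbb{R}^n)$ for some $\kappa\in(1,\infty)$. Let $\theta\in(0,\frac1s)$, $h:=\frac1s$, and $q_0\in(\max\{(\kappa_\omega^s)'/s,1\},\infty)$. Then: (a) there exists a positive constant $C$ such that, for any sequence $\{f_j\}_{j=1}^\infty$ of measurable functions on $\mathbb{R}^n$, $$\left\|\left\{\sum_{j=1}^\infty\left[\mathcal{M}^{(\theta)}(f_j)\right]^h\right\}^{1/h}\right\|_{L^{p(\cdot)}_\omega(\mathbb{R}^n)}\le C\left\|\left\{\sum_{j=1}^\infty|f_j|^h\right\}^{1/h}\right\|_{L^{p(\cdot)}_\omega(\mathbb{R}^n)};$$ (b) $(L^{p(\cdot)}_\omega(\mathbb{R}^n))^{1/h}$ is a ball Banach function space, and there exists a positive constant $C$ such that, for any $f\in((L^{p(\cdot)}_\omega(\mathbb{R}^n))^{1/h})'$, $$\left\|\mathcal{M}^{((q_0/h)')}(f)\right\|_{((L^{p(\cdot)}_\omega(\mathbb{R}^n))^{1/h})'}\le C\|f\|_{((L^{p(\cdot)}_\omega(\mathbb{R}^n))^{1/h})'}.$$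
   Context: $\mathcal{P}(\mathbb{R}^n)$ is the set of all measurable $p(\cdot):\mathbb{R}^n\to(0,\infty)$ with $0<p_-:=\operatorname{ess\,inf}p\le p_+:=\operatorname{ess\,sup}p<\infty$; $p_*:=\min\{p_-,1\}$. Variable Lebesgue spaces: for measurable $q(\cdot):\mathbb{R}^n\to(0,\infty]$ let $\varrho_{q(\cdot)}(f):=\int_{\{q<\infty\}}|f(x)|^{q(x)}\,dx+\|f\mathbf{1}_{\{q=\infty\}}\|_{L^\infty}$ and $\|f\|_{L^{q(\cdot)}(\mathbb{R}^n)}:=\inf\{\lambda\in(0,\infty):\varrho_{q(\cdot)}(f/\lambda)\le1\}$. For a measurable $v$ with $v\in(0,\infty)$ a.e., $L^{q(\cdot)}_v(\mathbb{R}^n)$ is the set of measurable $f$ with $\|f\|_{L^{q(\cdot)}_v}:=\|fv\|_{L^{q(\cdot)}}<\infty$. For $q(\cdot)\ge1$ a.e., $q'(\cdot)$ is given by $1/q(x)+1/q'(x)=1$ (with $1'=\infty$, and $\infty/\kappa:=\infty$). Maximal operators: $\mathcal{M}(f)(x):=\sup_{B\ni x}|B|^{-1}\int_B|f|$ (supremum over balls containing $x$), and $\mathcal{M}^{(\theta)}(f):=\{\mathcal{M}(|f|^\theta)\}^{1/\theta}$ for $\theta\in(0,\infty)$. $\mathcal{W}_{p(\cdot)}(\mathbb{R}^n)$: all measurable $\omega$ with $\omega\in(0,\infty)$ a.e. such that (i) for every ball $B$, $\|\mathbf{1}_B\|_{L^{p(\cdot)/p_*}_{\omega^{p_*}}}<\infty$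 and $\|\mathbf{1}_B\|_{L^{(p(\cdot)/p_* )'}_{\omega^{-p_*}}}<\infty$; (ii) there exist $\kappa,s\in(1,\infty)$ such that $\mathcal{M}$ is bounded on $L^{(sp(\cdot))'/\kappa}_{\omega^{-\kappa/s}}(\mathbb{R}^n)$ (this includes the requirement $sp(\cdot)\ge1$ a.e.). For $s$ as in (ii), $\kappa_\omega^s:=\sup\{\kappa>1:\mathcal{M}\text{ is bounded on }L^{(sp(\cdot))'/\kappa}_{\omega^{-\kappa/s}}(\mathbb{R}^n)\}\in(1,\infty]$, and $(\kappa_\omega^s)'$ is its conjugate index (equal to $1$ if $\kappa_\omega^s=\infty$). Ball quasi-Banach function space: a quasi-normed linear space $X$ of measurable functions on $\mathbb{R}^n$, whose quasi-norm makes sense (possibly infinite) for all measurable functions, with (i) $\|f\|_X=0\Rightarrow f=0$ a.e.; (ii) $|g|\le|f|$ a.e. $\Rightarrow\|g\|_X\le\|f\|_X$; (iii) $0\le f_m\uparrow f$ a.e. $\Rightarrow\|f_m\|_X\uparrow\|f\|_X$; (iv) $\mathbf{1}_B\in X$ for every ball $B$. It is a ball Banach function space if moreover (v) $\|f+g\|_X\le\|f\|_X+\|g\|_X$ for $f,g\in X$; (vi) for every ball $B$ there is $C_{(B)}>0$ with $\int_B|f|\le C_{(B)}\|f\|_X$ for all $f\in X$. For $r\in(0,\infty)$, the $r$-convexification is $X^r:=\{f:|f|^r\in X\}$ with $\|f\|_{X^r}:=\||f|^r\|_X^{1/r}$. For a ball Banach function space $X$, its associate space $X'$ consists of all measurable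 $f$ with $\|f\|_{X'}:=\sup\{\|fg\|_{L^1(\mathbb{R}^n)}:g\in X,\|g\|_X=1\}<\infty$. *)

(* Defs.v *)
From HB Require Import structures.
From mathcomp Require Import all_boot all_order all_algebra.
From mathcomp Require Import all_classical all_reals all_analysis.
From mathcomp Require Import measurable_realfun ess_sup_inf.

Set Implicit Arguments.
Unset Strict Implicit.
Unset Printing Implicit Defensive.

Import Order.TTheory GRing.Theory Num.Theory.
Import numFieldNormedType.Exports.

Local Open Scope classical_set_scope.
Local Open Scope ring_scope.
Local Open Scope ereal_scope.

(* One inductive step of the construction of the Borel-Lebesgue measure on R^n:
   the image of (lebesgue_measure \x m) under (a, t) |-> a :: t. *)
Section lebesgue_step.
Context (R : realType).
Local Notation T := (measurableTypeR R).
Context (n : nat) (m : {sigma_finite_measure set (n.-tuple T) -> \bar R}).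

Definition tuple_consT (x : T * n.-tuple T) : n.+1.-tuple T :=
  [tuple of x.1 :: x.2].

Lemma measurable_tuple_consT : measurable_fun setT tuple_consT.
Proof. exact: measurable_cons. Qed.

Definition tuple_unconsT (t : n.+1.-tuple T) : T * n.-tuple T :=
  (thead t, [tuple of behead t]).

Lemma measurable_tuple_unconsT : measurable_fun setT tuple_unconsT.
Proof.
by apply: measurable_fun_pair; [exact: measurable_tnth|exact: measurable_behead].
Qed.

Lemma tuple_consTK : cancel tuple_consT tuple_unconsT.
Proof. by move=> [a t]; congr (_, _); exact: val_inj. Qed.

Definition lebesgue_step : set (n.+1.-tuple T) -> \bar R :=
  pushforward (lebesgue_measure \x m) tuple_consT.

Let step0 : lebesgue_step set0 = 0.
Proof. by rewrite /lebesgue_step /pushforward preimage_set0 measure0. Qed.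

Let step_ge0 A : 0 <= lebesgue_step A.
Proof. exact: (measure_ge0 (lebesgue_measure \x m)). Qed.

Let step_sigma_additive : semi_sigma_additive lebesgue_step.
Proof.
apply: (@measure_semi_sigma_additive _ _ _
  (pushforward (lebesgue_measure \x m) tuple_consT)).
exact: measurable_tuple_consT.
Qed.

HB.instance Definition _ := isMeasure.Build _ _ _ lebesgue_step
  step0 step_ge0 step_sigma_additive.

Let step_sigma_finite : sigma_finite setT lebesgue_step.
Proof.
have /sigma_finiteP[F [TF ndF Foo]] := sigma_finiteT (@lebesgue_measure R).
have /sigma_finiteP[G [TG ndG Goo]] := sigma_finiteT m.
exists (fun k => tuple_unconsT @^-1` (F k `*` G k)).
  apply/esym; rewrite -subTset => t _.
  have [i _ Fi] : (\bigcup_k F k) (tuple_unconsT t).1 by rewrite -TF.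
  have [j _ Gj] : (\bigcup_k G k) (tuple_unconsT t).2 by rewrite -TG.
  exists (maxn i j) => //; split.
    by move: Fi; exact/subsetPset/ndF/leq_maxl.
  by move: Gj; exact/subsetPset/ndG/leq_maxr.
move=> k; have [mF Fk] := Foo k; have [mG Gk] := Goo k; split.
  rewrite -[X in measurable X]setTI; apply: measurable_tuple_unconsT => //.
  exact: measurableX.
rewrite /lebesgue_step /pushforward -comp_preimage.
rewrite (_ : _ \o _ = id); last by apply/funext => x; exact: tuple_consTK.
by rewrite preimage_id product_measure1E// lte_mul_pinfty// ge0_fin_numE.
Qed.

HB.instance Definition _ := Measure_isSigmaFinite.Build _ _ _ lebesgue_step
  step_sigma_finite.

End lebesgue_step.

Fixpoint lebesgue_borel (R : realType) (n : nat) :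
    {sigma_finite_measure set (n.-tuple (measurableTypeR R)) -> \bar R} :=
  match n with
  | 0 => \d_ [tuple]
  | n'.+1 => lebesgue_step (lebesgue_borel R n')
  end.

(* R^n equipped with the sigma-algebra of Lebesgue measurable sets, i.e. the
   Caratheodory completion of the Borel-Lebesgue measure. *)
Definition Rn (R : realType) (n : nat) :=
  caratheodory_type ((lebesgue_borel R n)^*)%mu.
HB.instance Definition _ (R : realType) (n : nat) := Measurable.on (Rn R n).

Definition lebesgue (R : realType) (n : nat) : {measure set (Rn R n) -> \bar R} :=
  @completed_measure_extension _ _ _ (lebesgue_borel R n).

Section definitions.
Context {R : realType} {n : nat}.
Local Notation Rn := (Rn R n).
Local Notation mu := (lebesgue R n).
Implicit Types (f g v w : Rn -> \bar R) (p : Rn -> R) (q : Rn -> \bar R).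

Definition eball (c : Rn) (r : R) : set Rn :=
  [set y | (Num.sqrt (\sum_(i < n) (tnth c i - tnth y i) ^+ 2) < r)%R].

(* A space of measurable functions is given by its (quasi-)norm, which is
   defined, possibly infinite, on all functions; functions are extended
   real-valued because maximal functions and infinite sums may be infinite. *)
Definition norm_space := (Rn -> \bar R) -> \bar R.
Implicit Types X : norm_space.

Definition in_space X f := measurable_fun setT f /\ X f < +oo.

Definition modular q f : \bar R :=
  \int[mu]_(x in [set x | q x < +oo]) (`|f x| `^ fine (q x))
  + Lnorm mu +oo (fun x => f x * (\1_[set x | q x = +oo%E] x)%:E).

Definition var_norm q : norm_space := fun f =>
  ereal_inf [set l%:E | l in
    [set l : R | (0 < l)%R /\ modular q (fun x => f x * (l^-1)%:E) <= 1]].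

Definition weighted_norm q v : norm_space := fun f =>
  var_norm q (fun x => f x * v x).

Definition maximal f : Rn -> \bar R := fun x =>
  ereal_sup [set a | exists c (r : R), [/\ (0 < r)%R, eball c r x &
    a = (mu (eball c r))^-1 * \int[mu]_(y in eball c r) `|f y|]].

Definition maximal_pow (t : R) f : Rn -> \bar R := fun x =>
  maximal (fun y => `|f y| `^ t) x `^ t^-1.

Definition maximal_bounded_on X :=
  exists2 C : R, (0 < C)%R &
    forall f, in_space X f -> X (maximal f) <= C%:E * X f.

Definition exponent p :=
  [/\ measurable_fun setT p, forall x, (0 < p x)%R,
      0 < ess_inf mu (EFin \o p) & ess_sup mu (EFin \o p) < +oo].

Definition p_star p : R := Num.min (fine (ess_inf mu (EFin \o p))) 1%R.

(* M is bounded on the weighted space with exponent (s p)' / k and weight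
   w^(- k / s); the conjugate of 1 is +oo, and +oo / k = +oo. *)
Definition maximal_cond p w (s k : R) :=
  {ae mu, forall x, (1 <= s * p x)%R} /\
  maximal_bounded_on (weighted_norm
    (fun x => hoelder_conjugate (s * p x)%:E * (k^-1)%:E)
    (fun x => w x `^ (- (k / s)))).

(* w is in ]0, +oo[ only almost everywhere: the values of its powers at 0 and
   +oo, and of hoelder_conjugate below 1, matter only on null sets. *)
Record weight_class p w : Prop := WeightClass {
  weight_measurable : measurable_fun setT w;
  weight_pos_fin : {ae mu, forall x, 0 < w x < +oo};
  weight_ball : forall c (r : R), (0 < r)%R ->
    weighted_norm (fun x => (p x / p_star p)%:E) (fun x => w x `^ p_star p)
      (fun x => (\1_(eball c r) x)%:E) < +oo;
  weight_ball_dual : forall c (r : R), (0 < r)%R ->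
    weighted_norm (fun x => hoelder_conjugate (p x / p_star p)%:E)
      (fun x => w x `^ (- p_star p)) (fun x => (\1_(eball c r) x)%:E) < +oo;
  weight_maximal : exists k s : R,
    [/\ (1 < k)%R, (1 < s)%R & maximal_cond p w s k]
}.

Definition kappa p w (s : R) : \bar R :=
  ereal_sup [set k%:E | k in [set k : R | (1 < k)%R /\ maximal_cond p w s k]].

(* Elements are finite almost everywhere, so that f \+ g is meaningful. *)
Record ball_quasi_banach X : Prop := BallQuasiBanach {
  bqb_ge0 : forall f, measurable_fun setT f -> 0 <= X f;
  bqb_fin : forall f, in_space X f -> {ae mu, forall x, f x \is a fin_num};
  bqb_scale : forall (a : R) f, in_space X f ->
    X (fun x => a%:E * f x) = `|a|%:E * X f;
  bqb_add : exists K : R, forall f g, in_space X f -> in_space X g ->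
    X (f \+ g) <= K%:E * (X f + X g);
  bqb_eq0 : forall f, measurable_fun setT f -> X f = 0 ->
    {ae mu, forall x, f x = 0};
  bqb_le : forall f g, measurable_fun setT f -> measurable_fun setT g ->
    {ae mu, forall x, `|g x| <= `|f x|} -> X g <= X f;
  bqb_fatou : forall (u : nat -> Rn -> \bar R) f,
    (forall m, measurable_fun setT (u m)) -> measurable_fun setT f ->
    {ae mu, forall x, [/\ forall m, 0 <= u m x,
      nondecreasing_seq (fun m => u m x) & u m x @[m --> \oo] --> f x]} ->
    nondecreasing_seq (fun m => X (u m)) /\ X (u m) @[m --> \oo] --> X f;
  bqb_ball : forall c (r : R), (0 < r)%R ->
    in_space X (fun x => (\1_(eball c r) x)%:E)
}.

Record ball_banach X : Prop := BallBanach {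
  bb_quasi : ball_quasi_banach X;
  bb_triangle : forall f g, in_space X f -> in_space X g ->
    X (f \+ g) <= X f + X g;
  bb_integral : forall c (r : R), (0 < r)%R -> exists2 C : R, (0 < C)%R &
    forall f, in_space X f -> \int[mu]_(x in eball c r) `|f x| <= C%:E * X f
}.

Definition convexification (r : R) X : norm_space := fun f =>
  X (fun x => `|f x| `^ r) `^ r^-1.

Definition associate X : norm_space := fun f =>
  ereal_sup [set \int[mu]_x `|f x * g x| | g in
    [set g | in_space X g /\ X g = 1]].

End definitions.

(* Main.v *)
(* On measurable functions the norm of the 1/h = s convexification X is that of the
   weighted space with exponent s p >= 1 and weight w^(1/s), so X is a ball Banach
   space, and by Hoelder's inequality and its converse the associate norm is
   equivalent to that of the weighted space with exponent (s p)' and weight w^(-1/s).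
   For (b), the exponent t = (q0/h)' is smaller than kappa_w^s, hence t <= k for some
   admissible k, and M^(t) <= 2^(1/t) M^(k) pointwise, while the boundedness of M^(k)
   on the dual space is exactly the hypothesis on k.
   For (a), put u_j = |f_j|^theta and r = h / theta > 1: the claim is the bound
   ||sum_j (M u_j)^r||_X <= C ||sum_j u_j^r||_X, which follows by duality from the
   Fefferman-Stein inequality, int (M u)^r phi <= C int |u|^r M phi for r > 1, and
   from the boundedness of M on the dual space. *)
Require Import Defs.
From HB Require Import structures.
From mathcomp Require Import all_boot all_order all_algebra.
From mathcomp Require Import all_classical all_reals all_analysis.
From mathcomp Require Import measurable_realfun ess_sup_inf.
From mathcomp Require Import ring lra.
Import Order.TTheory GRing.Theory Num.Theory.
Import numFieldNormedType.Exports.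

Local Open Scope classical_set_scope.
Local Open Scope ring_scope.
Local Open Scope ereal_scope.

Set Implicit Arguments.
Unset Strict Implicit.
Unset Printing Implicit Defensive.

(** * Euclidean balls and Lebesgue measure *)

(** The analysis takes place on a measure space with an abstract family of doubling balls and an
    exhaustion by sets of finite measure; Euclidean space enters only at both ends. The exponent
    [s p] is real-valued, but its conjugate is [+oo] wherever [s p = 1] and may be unbounded
    elsewhere, and this shapes the duality. A modular is an integral plus an essential supremum; the
    two parts scale differently, so norms of powers and dual norms are compared only up to constants
    such as 2 and 4. The extremal function of the converse of Hoelder's inequality is available only
    after a truncation, and is built separately for each part of the modular. The Fefferman-Stein
    constant is the same for all weights [phi], which is what allows testing against the whole dual
    ball. Finally, the hypothesis on indicators of balls in the dual is stated at the exponent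
    [1 / p_star] and not at [s], so local integrability in [X] needs a passage from one exponent to
    the other. *)

Section euclidean_distance.
Context {R : realType} {n : nat}.
Local Open Scope ring_scope.
Implicit Types (x y z c : Rn R n).

Definition euclid x y : R := Num.sqrt (\sum_(i < n) (tnth x i - tnth y i) ^+ 2).

Lemma eballE c r y : eball c r y = (euclid c y < r).
Proof. by []. Qed.

Lemma euclidxx x : euclid x x = 0.
Proof.
by rewrite /euclid big1 ?sqrtr0// => i _; rewrite subrr expr0n.
Qed.

Lemma euclid_sym x y : euclid x y = euclid y x.
Proof.
by rewrite /euclid; congr Num.sqrt; apply: eq_bigr => i _; rewrite -opprB sqrrN.
Qed.

Lemma euclid_ge0 x y : 0 <= euclid x y. Proof. exact: sqrtr_ge0. Qed.

Lemma sum_sqr_ge0 (I : finType) (a : I -> R) : 0 <= \sum_i a i ^+ 2.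
Proof. by apply: sumr_ge0 => i _; exact: sqr_ge0. Qed.

(** The nonnegative sum of the squares of [B a_i - P b_i] expands to [B (A B - P^2)]. Dividing by
    [B] excludes [B = 0], but then every [b_i] vanishes and so does [P]. *)
Lemma cauchy_schwarz_sum (I : finType) (a b : I -> R) :
  (\sum_i a i * b i) ^+ 2 <= (\sum_i a i ^+ 2) * (\sum_i b i ^+ 2).
Proof.
set A := \sum_i a i ^+ 2; set B := \sum_i b i ^+ 2; set P := \sum_i a i * b i.
have A0 : 0 <= A by exact: sum_sqr_ge0.
have B0 : 0 <= B by exact: sum_sqr_ge0.
have : 0 <= \sum_i (B * a i - P * b i) ^+ 2 by exact: sum_sqr_ge0.
have -> : \sum_i (B * a i - P * b i) ^+ 2 = B * (A * B - P ^+ 2).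
  under eq_bigr do rewrite sqrrB !exprMn.
  rewrite big_split/= sumrB -!mulr_sumr -/A -/B.
  have -> : \sum_i B * a i * (P * b i) *+ 2 = 2 * B * P * P.
    rewrite -[in RHS]/P [in RHS]mulr_sumr; apply: eq_bigr => i _.
    by rewrite -mulr_natl; ring.
  by ring.
have [B00|BN0] := eqVneq B 0; last by rewrite pmulr_rge0 ?lt0r ?BN0// subr_ge0.
move=> _; suff -> : P = 0 by rewrite expr0n mulr_ge0.
rewrite /P big1// => i _.
have /(_ i isT)/eqP := psumr_eq0P (fun i _ => sqr_ge0 (b i)) B00.
by rewrite sqrf_eq0 => /eqP ->; rewrite mulr0.
Qed.

Lemma euclid_triangle y x z : euclid x z <= euclid x y + euclid y z.
Proof.
pose a (i : 'I_n) := tnth x i - tnth y i.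
pose b (i : 'I_n) := tnth y i - tnth z i.
have xzE : euclid x z ^+ 2 =
    euclid x y ^+ 2 + 2 * (\sum_i a i * b i) + euclid y z ^+ 2.
  rewrite !sqr_sqrtr ?sum_sqr_ge0// mulr_sumr -!big_split/=.
  by apply: eq_bigr => i _; rewrite /a /b; ring.
rewrite -(@ler_pXn2r _ 2)// ?nnegrE ?addr_ge0 ?euclid_ge0//.
rewrite xzE sqrrD lerD2r lerD2l mulr_natl lerMn2r/=.
rewrite (le_trans (ler_norm _))// -sqrtr_sqr -sqrtrM ?sum_sqr_ge0//.
by rewrite ler_wsqrtr// cauchy_schwarz_sum.
Qed.

Lemma tnth_le_euclid x y (i : 'I_n) : `|tnth x i - tnth y i| <= euclid x y.
Proof.
rewrite -sqrtr_sqr ler_wsqrtr// (bigD1 i)//= lerDl.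
by apply: sumr_ge0 => j _; exact: sqr_ge0.
Qed.

(** The [n] squared coordinates add up to at most [n (r / (n+1))^2], and [n < (n+1)^2]; dividing by
    [n.+1] covers [n = 0] too. *)
Lemma euclid_lt x y (r : R) : 0 < r ->
  (forall i : 'I_n, `|tnth x i - tnth y i| < r / n.+1%:R) -> euclid x y < r.
Proof.
move=> r0 xyr; rewrite -(@ltr_pXn2r _ 2)// ?nnegrE ?euclid_ge0 ?(ltW r0)//.
rewrite sqr_sqrtr ?sum_sqr_ge0//.
apply: (@le_lt_trans _ _ (\sum_(i < n) (r / n.+1%:R) ^+ 2)).
  apply: ler_sum => i _; rewrite -real_normK ?num_real//.
  by rewrite ler_pXn2r// ?nnegrE ?(ltW (xyr i))// divr_ge0// ltW.
rewrite sumr_const card_ord -[ltLHS]mulr_natl expr_div_n mulrA ltr_pdivrMr ?exprn_gt0//.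
rewrite mulrC ltr_pM2l ?exprn_gt0//.
by rewrite -natrX ltr_nat -mulnn mulnS addSn ltnS leq_addr.
Qed.

(** Going from [c'] to [x] to [c] to [y] costs less than [r' + r + r], which is at most [3 r']. *)
Lemma eball_eball c c' x (r r' : R) : r <= r' -> eball c r x -> eball c' r' x ->
  eball c r `<=` eball c' (3 * r').
Proof.
move=> rr'; rewrite !eballE => cx c'x y; rewrite !eballE => cy.
have := euclid_triangle x c' y; have := euclid_triangle c x y.
by rewrite (euclid_sym x c); lra.
Qed.

Lemma eball0 c (r : R) : r <= 0 -> eball c r = set0.
Proof.
move=> r0; apply/seteqP; split => // y; rewrite eballE => /lt_le_trans/(_ r0).
by rewrite ltNge euclid_ge0.
Qed.

Definition rat_point (q : n.-tuple rat) : Rn R n := [tuple ratr (tnth q i) | i < n].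

(** With [rho] below half of the slack [r - euclid c x] and a rational point within [rho] of [x],
    every point of the rational ball is within [2 rho] of [x], hence still in the given ball. *)
Lemma eball_rat c (r : R) x : eball c r x -> exists (q : n.-tuple rat) (rho : rat),
  eball (rat_point q) (ratr rho) x /\ eball (rat_point q) (ratr rho) `<=` eball c r.
Proof.
rewrite eballE => cxr.
have [rho] := @rat_in_itvoo R 0 ((r - euclid c x) / 2) ltac:(by rewrite divr_gt0// subr_gt0).
rewrite in_itv/= => /andP[rho0 rhor].
have rn0 : 0 < (ratr rho : R) / n.+1%:R by rewrite divr_gt0.
have /choice[q qP] (i : 'I_n) : exists q : rat, `|ratr q - tnth x i| < ratr rho / n.+1%:R.
  have [q] := @rat_in_itvoo R (tnth x i - ratr rho / n.+1%:R) (tnth x i + ratr rho / n.+1%:R)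
    ltac:(by rewrite ltrD2l gtrN).
  by rewrite in_itv/= => qx; exists q; rewrite ltr_distl.
have qx : euclid (rat_point [tuple q i | i < n]) x < ratr rho.
  by apply: euclid_lt => // i; rewrite !tnth_mktuple.
exists [tuple q i | i < n], rho; split => // y; rewrite !eballE => qy.
have := euclid_triangle x c y; have := euclid_triangle (rat_point [tuple q i | i < n]) x y.
rewrite (euclid_sym x (rat_point _)); lra.
Qed.

(** Rational balls are countably many, and [eball_rat] puts each point of the union in one that lies
    inside a member of [B]. The integer [k] codes a rational ball and [b k] is a member of [B]
    containing it; if there is none, [b k] gets radius 0 and is empty. *)
Lemma lindelof_eball (B : set (Rn R n * R)) : exists b : nat -> Rn R n * R,
  (forall k, B (b k) \/ (b k).2 = 0) /\
  \bigcup_(z in B) eball z.1 z.2 = \bigcup_k eball (b k).1 (b k).2.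
Proof.
pose P (k : nat) (z : Rn R n * R) := exists qr : (n.-tuple rat * rat)%type,
  [/\ unpickle k = Some qr, B z &
   eball (rat_point qr.1) (ratr qr.2) `<=` eball z.1 z.2].
have /choice[b bP] (k : nat) : exists z : (Rn R n * R)%type,
    (B z \/ z.2 = 0) /\ ((exists z' : (Rn R n * R)%type, P k z') -> P k z).
  have [[z Pz]|nP] := pselect (exists z' : (Rn R n * R)%type, P k z').
    by exists z; split => //; left; case: Pz => qr [].
  by exists (rat_point [tuple 0 | i < n], 0); split => //; right.
exists b; split; first by move=> k; exact: (bP k).1.
apply/seteqP; split => [x [z Bz zx]|x [k _ kx]].
  have [q [rho [qx qz]]] := eball_rat zx.
  have [|qr [qrE _]] := (bP (pickle (q, rho))).2.
    by exists z, (q, rho); rewrite pickleK.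
  move: qrE; rewrite pickleK => -[<-] /(_ _ qx) ?.
  by exists (pickle (q, rho)).
have [Bk|k0] := (bP k).1; first by exists (b k).
by move: kx; rewrite k0 eball0.
Qed.

End euclidean_distance.

Section lebesgue_eball.
Context {R : realType} {n : nat}.
Local Notation mu := (lebesgue R n).

Lemma measurable_lebesgue (A : set (n.-tuple (measurableTypeR R))) :
  measurable A -> measurable (A : set (Rn R n)).
Proof.
by move=> mA; apply: sub_caratheodory; apply: sub_sigma_algebra.
Qed.

Lemma lebesgueE (A : set (n.-tuple (measurableTypeR R))) :
  measurable A -> mu A = lebesgue_borel R n A.
Proof. by move=> mA; rewrite /lebesgue/= /completed_measure_extension measurable_mu_extE. Qed.

Lemma measurable_eball_tuple (c : Rn R n) (r : R) :
  measurable (eball c r : set (n.-tuple (measurableTypeR R))).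
Proof.
have [r0|r0] := leP r 0%R; first by rewrite eball0.
rewrite -[X in measurable X]setTI.
have -> : eball c r = [set y : n.-tuple (measurableTypeR R) |
    (\sum_(i < n) (tnth c i - tnth y i) ^+ 2 < r ^+ 2)%R].
  apply/seteqP; split => y; rewrite eballE /=.
    by rewrite -(@ltr_pXn2r _ 2)// ?nnegrE ?euclid_ge0 ?(ltW r0)// sqr_sqrtr// sum_sqr_ge0.
  by rewrite -{1}[X in (X < _)%R]sqr_sqrtr ?sum_sqr_ge0// ltr_pXn2r// ?nnegrE ?euclid_ge0 ?(ltW r0).
have mf : measurable_fun [set: n.-tuple (measurableTypeR R)]
    (fun y => \sum_(i < n) (tnth c i - tnth y i) ^+ 2)%R.
  apply: measurable_sum => i; apply: measurable_funX; apply: measurable_funB => //.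
  exact: measurable_tnth.
have := mf measurableT `]-oo, (r ^+ 2)%R[%classic (measurable_itv _).
by rewrite set_itvE.
Qed.

Lemma measurable_eball (c : Rn R n) (r : R) : measurable (eball c r).
Proof. by apply: measurable_lebesgue; exact: measurable_eball_tuple. Qed.

End lebesgue_eball.

(** * Volume of cubes and the doubling property of balls *)

Section cube.
Context {R : realType}.

Definition cube {n} (c : n.-tuple R) (r : R) : set (n.-tuple (measurableTypeR R)) :=
  [set y | forall i, (`|tnth c i - tnth y i| < r)%R].

Lemma measurable_cube n (c : n.-tuple R) (r : R) : measurable (cube c r).
Proof.
have -> : cube c r = \bigcap_(i in [set: 'I_n]) ((@tnth _ _ ^~ i) @^-1` ball (tnth c i) r).
  apply/seteqP; split => [y cy i _|y cy i]; first exact: cy.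
  exact: (cy i).
apply: fin_bigcap_measurable => // i _; rewrite -[X in measurable X]setTI.
by apply: measurable_tnth => //; exact: measurable_ball.
Qed.

(** Along [tuple_consT] the cube pulls back to an interval of length [r *+ 2] times a cube of one
    dimension less. In dimension 0 the measure is a Dirac mass and the cube, defined by an empty
    condition, is everything. *)
Lemma lebesgue_borel_cube n (c : n.-tuple R) (r : R) : (0 <= r)%R ->
  lebesgue_borel R n (cube c r) = ((r *+ 2) ^+ n)%:E.
Proof.
move=> r0; elim: n c => [c|n IHn c].
  have -> : cube c r = setT by apply/seteqP; split => // y _ [].
  by rewrite /= diracT expr0.
have -> : lebesgue_borel R n.+1 (cube c r) =
    (lebesgue_measure \x lebesgue_borel R n)%E (ball (thead c) r `*` cube [tuple of behead c] r).
  rewrite /= /lebesgue_step /pushforward; congr product_measure1.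
  apply/seteqP; split => [[a t] /= H|[a t] /= [H1 H2] i].
    split; first by have := H ord0; rewrite tnth0.
    move=> i; have := H (lift ord0 i).
    by rewrite !(tnth_nth 0%R)/= nth_behead.
  case: (unliftP ord0 i) => [j ->|->]; last by rewrite tnth0.
  by have := H2 j; rewrite !(tnth_nth 0%R)/= nth_behead.
rewrite product_measure1E; [|exact: measurable_ball|exact: measurable_cube].
by rewrite IHn exprS EFinM; congr (_ * _); exact: lebesgue_measure_ball.
Qed.

End cube.

Section doubling.
Context {R : realType} {n : nat}.
Local Notation mu := (lebesgue R n).

Lemma lebesgue_eball_le (c : Rn R n) (r : R) : (0 <= r)%R ->
  mu (eball c r) <= ((r *+ 2) ^+ n)%:E.
Proof.
move=> r0; rewrite -(lebesgue_borel_cube c r0) -lebesgueE; last exact: measurable_cube.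
apply: le_measure; rewrite ?inE; [exact: measurable_eball| |].
  by apply: measurable_lebesgue; exact: measurable_cube.
by move=> y cy i; exact: le_lt_trans (tnth_le_euclid _ _ _) cy.
Qed.

Lemma lebesgue_eball_ge (c : Rn R n) (r : R) : (0 < r)%R ->
  ((r / n.+1%:R *+ 2) ^+ n)%:E <= mu (eball c r).
Proof.
move=> r0; have rn0 : (0 <= r / n.+1%:R)%R by rewrite divr_ge0// ltW.
rewrite -(lebesgue_borel_cube c rn0) -lebesgueE; last exact: measurable_cube.
apply: le_measure; rewrite ?inE; [|exact: measurable_eball|].
  by apply: measurable_lebesgue; exact: measurable_cube.
by move=> y cy; exact: euclid_lt.
Qed.

Lemma lebesgue_eball_gt0 (c : Rn R n) (r : R) : (0 < r)%R -> 0 < mu (eball c r).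
Proof.
move=> r0; apply: lt_le_trans (lebesgue_eball_ge c r0).
by rewrite lte_fin exprn_gt0// pmulrn_lgt0// divr_gt0.
Qed.

Lemma lebesgue_eball_lty (c : Rn R n) (r : R) : mu (eball c r) < +oo.
Proof.
have [r0|r0] := leP r 0%R; first by rewrite eball0// measure0.
by rewrite (le_lt_trans (lebesgue_eball_le c (ltW r0)))// ltry.
Qed.

Lemma lebesgue_setT_gt0 : 0 < mu [set: Rn R n].
Proof.
pose c : Rn R n := [tuple 0%R | i < n].
apply: lt_le_trans (lebesgue_eball_gt0 c ltr01) _.
by apply: le_measure; rewrite ?inE//; exact: measurable_eball.
Qed.

(** A ball lies in the cube whose half-side is its radius and contains the one of half-side
    [r / (n+1)]; the constant is the ratio of [(6 r)^n] to [(2 r / (n+1))^n]. *)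
Lemma lebesgue_doubling : exists2 K : R, (0 < K)%R &
  forall (c : Rn R n) (r : R), (0 < r)%R -> mu (eball c (3 * r)%R) <= K%:E * mu (eball c r).
Proof.
exists ((3 * n.+1%:R) ^+ n)%R; first by rewrite exprn_gt0.
move=> c r r0; apply: le_trans (lebesgue_eball_le _ _) _; first by rewrite mulr_ge0// ltW.
apply: le_trans (lee_wpmul2l _ (lebesgue_eball_ge c r0)); last first.
  by rewrite lee_fin exprn_ge0.
rewrite -EFinM lee_fin -exprMn le_eqVlt; apply/orP; left; apply/eqP; congr (_ ^+ _)%R.
have : (n.+1%:R != 0 :> R)%R by rewrite pnatr_eq0.
by move: (n.+1%:R)%R => N N0; field.
Qed.

End doubling.

(** * The weighted maximal inequality *)

Section poweR_extra.
Context {R : realType}.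
Implicit Types (x y : \bar R) (r : R).

Lemma lee_poweR r x y : (0 <= r)%R -> 0 <= x -> x <= y -> x `^ r <= y `^ r.
Proof.
by move=> r0 x0 xy; apply: gt0_ler_poweR; rewrite // in_itv/= leey ?andbT ?(le_trans x0).
Qed.

Lemma poweR_le_1D r x : (0 <= r <= 1)%R -> 0 <= x -> x `^ r <= 1 + x.
Proof.
move=> /andP[r0 r1] x0; have [x1|x1] := leP x 1.
  by rewrite (le_trans (lee_poweR r0 x0 x1))// poweR1r leeDl.
case: x x0 x1 => [x||]// x0 x1; last by rewrite addey// leey.
rewrite lte_fin in x1; rewrite -EFinD poweR_EFin lee_fin.
rewrite (@le_trans _ _ (x `^ 1)%R)// ?ler_powR// ?(ltW x1)//.
by rewrite powRr1 ?(le_trans ler01 (ltW x1))// lerDr.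
Qed.

End poweR_extra.

(* [ball_engulf] and [ball_doubling] serve the covering argument, [ball_lindelof]
   the measurability of the maximal function. *)
Record doubling_balls d (T : measurableType d) (R : realType)
    (mu : {measure set T -> \bar R}) (K : R) (B : T -> R -> set T) : Prop :=
  DoublingBalls {
  ball_measurable : forall c r, measurable (B c r);
  ball_gt0 : forall c r, (0 < r)%R -> 0 < mu (B c r);
  ball_lty : forall c r, mu (B c r) < +oo;
  ball_center : forall c r, (0 < r)%R -> B c r c;
  ball_widen : forall c r, (0 < r)%R -> B c r `<=` B c (3 * r)%R;
  ball_engulf : forall c c' x r r', (r <= r')%R -> B c r x -> B c' r' x ->
    B c r `<=` B c' (3 * r')%R;
  ball_empty : forall c r, (r <= 0)%R -> B c r = set0;
  ball_lindelof : forall S : set (T * R), exists b : nat -> T * R,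
    (forall k, S (b k) \/ (b k).2 = 0%R) /\
    \bigcup_(z in S) B z.1 z.2 = \bigcup_k B (b k).1 (b k).2;
  ball_doubling_gt0 : (0 < K)%R;
  ball_doubling : forall c r, (0 < r)%R -> mu (B c (3 * r)%R) <= K%:E * mu (B c r)
}.

(** For [lebesgue R n] and [eball] this is convertible to [maximal]; [var_norm_over] and
    [associate_over] below relate in the same way to [var_norm] and [associate]. *)
Definition maximal_over d (T : measurableType d) (R : realType)
    (mu : {measure set T -> \bar R}) (B : T -> R -> set T) (f : T -> \bar R) x : \bar R :=
  ereal_sup [set a | exists c (r : R), [/\ (0 < r)%R, B c r x &
    a = (mu (B c r))^-1 * \int[mu]_(y in B c r) `|f y|]].

Section maximal_function.
Context {d : measure_display} {T : measurableType d} {R : realType}.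
Variables (mu : {measure set T -> \bar R}) (K : R) (B : T -> R -> set T).
Hypothesis DB : doubling_balls mu K B.
Implicit Types (f u phi : T -> \bar R).
Local Notation maximal := (maximal_over mu B).

Lemma lt_average (A : set T) (y z : \bar R) : 0 < mu A -> mu A < +oo ->
  (y < (mu A)^-1 * z) = (y * mu A < z).
Proof.
move=> A0 Aoo; have : mu A \is a fin_num by rewrite ge0_fin_numE.
case: (mu A) A0 => // m m0 _; rewrite lte_fin in m0.
by rewrite inver gt_eqF//= lte_pdivlMl// muleC.
Qed.

Lemma le_average (A : set T) (y z : \bar R) : 0 < mu A -> mu A < +oo ->
  ((mu A)^-1 * z <= y) = (z <= y * mu A).
Proof. by move=> A0 Aoo; rewrite !leNgt lt_average. Qed.

Lemma integral_ball_le_maximal f c r x : (0 < r)%R -> B c r x ->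
  \int[mu]_(y in B c r) `|f y| <= maximal f x * mu (B c r).
Proof.
move=> r0 cx; rewrite -le_average ?(ball_gt0 DB) ?(ball_lty DB)//.
by apply: ereal_sup_ubound; exists c, r.
Qed.

Lemma maximal_leP f x y :
  (forall c r, (0 < r)%R -> B c r x ->
    \int[mu]_(y in B c r) `|f y| <= y * mu (B c r)) ->
  maximal f x <= y.
Proof.
move=> H; apply: ge_ereal_sup => _ [c [r [r0 cx ->]]].
by rewrite le_average ?(ball_gt0 DB) ?(ball_lty DB)//; exact: H.
Qed.

Lemma lt_maximalP f x y : y < maximal f x <->
  exists c r, [/\ (0 < r)%R, B c r x &
    y * mu (B c r) < \int[mu]_(z in B c r) `|f z|].
Proof.
split=> [/ereal_sup_gt[_ [c [r [r0 cx ->]]]]|[c [r [r0 cx]]]].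
  rewrite lt_average ?(ball_gt0 DB) ?(ball_lty DB)// => H.
  by exists c, r.
rewrite -lt_average ?(ball_gt0 DB) ?(ball_lty DB)// => /lt_le_trans; apply.
by apply: ereal_sup_ubound; exists c, r.
Qed.

Lemma maximal_ge0 f x : 0 <= maximal f x.
Proof.
have cx : B x 1%R x by exact: (ball_center DB).
apply: le_trans (ereal_sup_ubound _); last by exists x, 1%R; split.
by rewrite mule_ge0 ?inve_ge0//; exact: integral_ge0.
Qed.

Definition maximal_balls f (y : \bar R) : set (T * R) :=
  [set z | (0 < z.2)%R /\
    y * mu (B z.1 z.2) < \int[mu]_(x in B z.1 z.2) `|f x|].

Lemma maximal_superlevel f y :
  [set x | y < maximal f x] = \bigcup_(z in maximal_balls f y) B z.1 z.2.
Proof.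
apply/seteqP; split=> x.
  by move=> /lt_maximalP[c [r [r0 cx H]]]; exists (c, r).
by move=> [[c r] [/= r0 H] cx]; apply/lt_maximalP; exists c, r.
Qed.

Lemma measurable_maximal_superlevel f y : measurable [set x | y < maximal f x].
Proof.
rewrite maximal_superlevel; have [b [_ ->]] := ball_lindelof DB (maximal_balls f y).
by apply: bigcup_measurable => k _; exact: (ball_measurable DB).
Qed.

Lemma measurable_maximal f : measurable_fun setT (maximal f).
Proof.
apply: (measurability _ (ErealGenOInfty.measurableE R)) => /= _ [_ [y ->]] <-.
by rewrite setTI preimage_itvoy; exact: measurable_maximal_superlevel.
Qed.

Definition ball_cover (s : seq (T * R)) : set T :=
  \bigcup_(z in [set` s]) B z.1 z.2.

Lemma measurable_ball_cover s : measurable (ball_cover s).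
Proof.
by apply: fin_bigcup_measurable => // z _; exact: (ball_measurable DB).
Qed.

Section weak_type.
Let K0 : (0 < K)%R := ball_doubling_gt0 DB.
Variables (u phi : T -> \bar R).
Hypotheses (mu_ : measurable_fun setT u) (mphi : measurable_fun setT phi).
Hypothesis phi0 : forall x, 0 <= phi x.

Let H x := `|u x| * maximal phi x.

Let mH : measurable_fun setT H.
Proof.
by apply: emeasurable_funM; [exact: measurableT_comp|exact: measurable_maximal].
Qed.

Let H0 x : 0 <= H x. Proof. by rewrite mule_ge0// maximal_ge0. Qed.

(** Every point of the ball also lies in the tripled ball, so [maximal phi] is there at least the
    average of [phi] over the tripled ball, and by doubling at least [c0 / (K m)], with [c0] the
    integral of [phi] over the tripled ball and [m] the measure of the ball. The integral of [|u|]
    over the ball exceeds [l m]. *)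
Lemma ball_weak_type (l : R) z : (0 < l)%R -> maximal_balls u l%:E z ->
  l%:E * \int[mu]_(x in B z.1 (3 * z.2)%R) phi x <=
  K%:E * \int[mu]_(x in B z.1 z.2) H x.
Proof.
case: z => c r l0 [/= r0 lu].
have mB : measurable (B c r) by exact: (ball_measurable DB).
set c0 := \int[mu]_(x in _) phi x.
have c00 : 0 <= c0 by exact: integral_ge0.
have B0 := ball_gt0 DB c r0.
have : mu (B c r) \is a fin_num by rewrite ge0_fin_numE// (ball_lty DB).
move: lu B0; have := ball_doubling DB c r0.
move: (mu (B c r)) => [m| |]// dm lu m0 _; rewrite lte_fin in m0.
have Km : (0 < K * m)%R by exact: mulr_gt0.
have c0M y : B c r y -> c0 * (K * m)^-1%:E <= maximal phi y.
  move=> cy; rewrite lee_pdivrMr//.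
  have c3y : B c (3 * r)%R y.
    exact: (ball_widen DB).
  have := integral_ball_le_maximal phi (mulr_gt0 (ltr0n _ 3) r0) c3y.
  under eq_integral do rewrite gee0_abs//.
  move=> /le_trans; apply; rewrite EFinM lee_wpmul2l// ?maximal_ge0//.
have : \int[mu]_(x in B c r) (`|u x| * (c0 * (K * m)^-1%:E)) <=
    \int[mu]_(x in B c r) H x.
  apply: ge0_le_integral.
  - exact: mB.
  - by move=> x _; rewrite !mule_ge0// lee_fin invr_ge0 ltW.
  - apply: measurable_funTS; apply: emeasurable_funM; last exact: measurable_cst.
    exact: measurableT_comp (@abse_measurable R setT) mu_.
  - exact: measurable_funTS mH.
  - by move=> x cx; rewrite lee_wpmul2l//; exact: c0M.
rewrite ge0_integralZr; last 4 first.
- exact: mB.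
- by apply: measurable_funTS; exact: measurableT_comp (@abse_measurable R setT) mu_.
- by [].
- by rewrite mule_ge0// lee_fin invr_ge0 ltW.
move=> /(lee_wpmul2l (ltW K0 : 0 <= K%:E)); apply: le_trans.
have : K%:E * ((l%:E * m%:E) * (c0 * (K * m)^-1%:E)) = l%:E * c0.
  rewrite [c0 * _]muleC -EFinM !muleA -!EFinM; congr (_%:E * _).
  by field; rewrite !gt_eqF.
move=> <-; rewrite lee_wpmul2l ?lee_fin ?(ltW K0)// lee_wpmul2r ?(ltW lu)//.
by rewrite mule_ge0// lee_fin invr_ge0 ltW.
Qed.

Lemma exists_max_radius (s : seq (T * R)) : s != [::] ->
  exists2 z, z \in s & forall z', z' \in s -> (z'.2 <= z.2)%R.
Proof.
elim: s => // a s IHs _; have [->|s0] := eqVneq s [::].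
  by exists a; rewrite ?mem_head// => z'; rewrite inE => /eqP ->.
have [z zs zM] := IHs s0; have [az|za] := leP a.2 z.2.
  exists z; first by rewrite inE zs orbT.
  by move=> z'; rewrite inE => /predU1P[->//|]; exact: zM.
exists a; rewrite ?mem_head// => z'; rewrite inE => /predU1P[->//|/zM].
by move=> /le_trans; apply; exact: ltW.
Qed.

(* The Vitali selection is built into the induction: a ball of maximal radius
   is removed together with all the balls that meet it, all of which lie in the
   ball of three times its radius. *)
Lemma ball_cover_weak_type (l : R) (s : seq (T * R)) : (0 < l)%R ->
  (forall z, z \in s -> maximal_balls u l%:E z) ->
  l%:E * \int[mu]_(x in ball_cover s) phi x <=
  K%:E * \int[mu]_(x in ball_cover s) H x.
Proof.
move=> l0; have [N] := ubnP (size s); elim: N s => // N IHN s sN sM.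
have [->|s0] := eqVneq s [::].
  by rewrite /ball_cover set_nil bigcup_set0 !integral_set0 !mule0.
have [z0 z0s z0M] := exists_max_radius s0.
pose P (z : T * R) := `[< B z.1 z.2 `&` B z0.1 z0.2 = set0 >].
pose s' := [seq z <- s | P z].
(* [z0] itself leaves the list because it meets itself: it contains its centre. *)
have ss' : (size s' < size s)%N.
  rewrite size_filter -(count_predC P s) -[ltnLHS]addn0 ltn_add2l -has_count.
  apply/hasP; exists z0 => //=; apply/negP => /asboolP /seteqP[/(_ z0.1) + _].
  by rewrite setIid => /(_ (ball_center DB _ (sM _ z0s).1)).
have := IHN s' (leq_trans ss' sN) (fun z => _).
have sM' z : z \in s' -> maximal_balls u l%:E z.
  by rewrite mem_filter => /andP[_]; exact: sM.
move=> /(_ sM') IH.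
have mB0 := ball_measurable DB z0.1 z0.2.
have mB3 := ball_measurable DB z0.1 (3 * z0.2)%R.
have ms' := measurable_ball_cover s'.
have ms := measurable_ball_cover s.
have cov : ball_cover s `<=` B z0.1 (3 * z0.2)%R `|` ball_cover s'.
  move=> x [z /= zs zx]; have [Pz|/asboolP Pz] := boolP (P z).
    by right; exists z => //=; rewrite mem_filter Pz.
  left; have [y [zy z0y]] : B z.1 z.2 `&` B z0.1 z0.2 !=set0.
    by apply/set0P/eqP.
  exact: (ball_engulf DB (z0M _ zs) zy z0y).
have dis : [disjoint B z0.1 z0.2 & ball_cover s'].
  apply/disj_setPS => x [z0x [z /=]]; rewrite mem_filter => /andP[/asboolP/seteqP[+ _] _].
  by move=> /(_ x) /[swap] zx; apply; split.
have sub : B z0.1 z0.2 `|` ball_cover s' `<=` ball_cover s.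
  move=> x [z0x|[z /=]]; first by exists z0.
  by rewrite mem_filter => /andP[_ zs] zx; exists z.
have phi_le : \int[mu]_(x in ball_cover s) phi x <=
    \int[mu]_(x in B z0.1 (3 * z0.2)%R) phi x + \int[mu]_(x in ball_cover s') phi x.
  set A := B z0.1 (3 * z0.2)%R.
  apply: (@le_trans _ _ (\int[mu]_(x in (A `\` ball_cover s') `|` ball_cover s') phi x)).
    apply: ge0_subset_integral => //.
    - by apply: measurableU => //; exact: measurableD.
    - exact: measurable_funTS.
    - by move=> x /cov [Ax|]; [have [|] := pselect (ball_cover s' x); [right|left]|right].
  rewrite ge0_integral_setU//.
  - rewrite leeD2r// ge0_subset_integral//; first exact: measurableD.
    exact: measurable_funTS.
  - exact: measurableD.
  - exact: measurable_funTS.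
  - by apply/disj_setPS => x [[]].
apply: le_trans (lee_wpmul2l _ phi_le) _; first by rewrite lee_fin ltW.
rewrite ge0_muleDr ?integral_ge0//.
(* On the right the two integrals of [H] add up, because the remaining balls are disjoint from
   [B z0.1 z0.2]; only [phi] is integrated over the tripled ball. *)
apply: le_trans (leeD (ball_weak_type l0 (sM _ z0s)) IH) _.
rewrite -ge0_muleDr ?integral_ge0// lee_wpmul2l ?lee_fin ?(ltW K0)//.
rewrite -ge0_integral_setU//; last exact: measurable_funTS.
by apply: ge0_subset_integral => //; [exact: measurableU|exact: measurable_funTS].
Qed.

(** The weak type (1,1) inequality for the pair of weights [phi] and [maximal phi].
    [ball_cover_weak_type] handles the finite subfamilies of a countable cover with a constant
    independent of their size, and monotone convergence gives the union. Filtering on a positive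
    radius discards the empty balls that [ball_lindelof] may insert. *)
Lemma maximal_weak_type (l : R) : (0 < l)%R ->
  l%:E * \int[mu]_(x in [set x | l%:E < maximal u x]) phi x <= K%:E * \int[mu]_x H x.
Proof.
move=> l0; rewrite maximal_superlevel.
have [b [bM bE]] := ball_lindelof DB (maximal_balls u l%:E).
pose s N := [seq b k | k <- iota 0 N & (0 < (b k).2)%R].
have sM N z : z \in s N -> maximal_balls u l%:E z.
  move=> /mapP[k]; rewrite mem_filter => /andP[bk0 _] ->.
  by have [//|bk] := bM k; move: bk0; rewrite bk ltxx.
have nds : nondecreasing_seq (fun N => ball_cover (s N)).
  move=> N M NM; rewrite subsetEset => x [_ /mapP[k + ->] kx].
  rewrite mem_filter mem_iota => /andP[bk0 /andP[_ kN]].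
  exists (b k) => //; apply/mapP; exists k => //.
  by rewrite mem_filter bk0 mem_iota (leq_trans kN).
have bigE : \bigcup_N ball_cover (s N) = \bigcup_k B (b k).1 (b k).2.
  apply/seteqP; split => [x [N _ [_ /mapP[k _ ->] kx]]|x [k _ kx]]; first by exists k.
  exists k.+1 => //; exists (b k) => //; apply/mapP; exists k => //.
  rewrite mem_filter mem_iota leq0n ltnSn !andbT.
  by rewrite ltNge; apply/negP => /(ball_empty DB (b k).1) b0; move: kx; rewrite b0.
rewrite bE -bigE -lee_pdivlMl//.
apply: cvge_le (ge0_nondecreasing_set_cvg_integral _ _ _ _) => //; last 2 first.
- by move=> N; exact: measurable_ball_cover.
- by move=> N; exact: measurable_funTS.
apply: nearW => N; rewrite lee_pdivlMl//.
apply: le_trans (ball_cover_weak_type l0 (@sM N)) _.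
rewrite lee_wpmul2l ?lee_fin ?(ltW K0)// ge0_subset_integral//.
exact: measurable_ball_cover.
Qed.

End weak_type.

End maximal_function.

(** * Dyadic levels: the sums behind the interpolation argument *)

Section dyadic_ratio.
Context {R : realType}.
Variable r : R.
Hypothesis r1 : (1 < r)%R.
Local Open Scope ring_scope.
Local Notation b := (2 `^ (r - 1)).

Lemma powR2_gt1 : 1 < b.
Proof.
rewrite -[ltLHS](_ : 1 `^ (r - 1) = 1); last by rewrite powR1.
by rewrite gt0_ltr_powR ?nnegrE ?ltr1n// subr_gt0.
Qed.

(** The constant of [level_series_le]: [2^r 2] comes from [(2 t)^r (2 / t)], [b / (b - 1)] from a
    geometric sum of ratio [b], and the last power of 2 from the cut at [t < 2 a]. *)
Definition level_const : R := 2 `^ r * 2 * (b / (b - 1) * 2 `^ (r - 1)).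

Lemma level_const_gt0 : 0 < level_const.
Proof.
have b1 := powR2_gt1; have b10 : 0 < b - 1 by rewrite subr_gt0.
by rewrite !mulr_gt0 ?powR_gt0 ?invr_gt0.
Qed.

End dyadic_ratio.

Section dyadic_levels.
Context {R : realType}.
Variables (r d : R).
Hypotheses (r1 : (1 < r)%R) (d0 : (0 < d)%R).
Local Open Scope ring_scope.

Definition level (j : nat) : R := d * 2 ^+ j.

Lemma level_gt0 j : 0 < level j.
Proof. by rewrite mulr_gt0// exprn_gt0. Qed.

Lemma levelS j : level j.+1 = 2 * level j.
Proof. by rewrite /level exprS mulrCA. Qed.

Lemma level_ge_nat j : d * j%:R <= level j.
Proof. by rewrite ler_pM2l// -natrX ler_nat ltnW// ltn_expl. Qed.

Lemma exists_level (a : R) : d < a -> exists j, level j < a <= 2 * level j.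
Proof.
move=> da; have aj : exists j, a <= level j.+1.
  exists (Num.truncn (a / d)); apply: le_trans (level_ge_nat _).
  by rewrite mulrC -ler_pdivrMr// ltW// truncnS_gt.
have := ex_minnP aj; case=> j ja jmin.
exists j; rewrite -levelS ja andbT; case: j ja jmin => [|j] ja jmin.
  by rewrite /level expr0 mulr1.
by rewrite ltNge; apply/negP => /jmin; rewrite ltnn.
Qed.

Local Notation b := (2 `^ (r - 1)).
Let b1 : 1 < b := powR2_gt1 r1.

Lemma powR_levelS j : level j.+1 `^ (r - 1) = b * level j `^ (r - 1).
Proof. by rewrite levelS powRM// ltW// level_gt0. Qed.

Lemma sum_level_le j :
  \sum_(i < j.+1) level i `^ (r - 1) <= b / (b - 1) * level j `^ (r - 1).
Proof.
have b10 : 0 < b - 1 by rewrite subr_gt0 b1.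
elim: j => [|j IH].
  rewrite big_ord_recr big_ord0/= add0r ler_peMl ?powR_ge0//.
  by rewrite ler_pdivlMr// mul1r; lra.
rewrite big_ord_recr/= (le_trans (lerD IH (lexx _)))//.
rewrite powR_levelS le_eqVlt; apply/orP; left; apply/eqP; field.
by rewrite gt_eqF.
Qed.

(** The powers of the levels below [a] form a geometric sum, controlled by its last term, and that
    term is at most [a^(r-1)]. Both the ratio above 1 and the monotonicity of the power come from
    [r > 1]. *)
Lemma sum_level_lt_le (a : R) N : 0 <= a ->
  \sum_(i < N) (if level i < a then level i `^ (r - 1) else 0) <=
  b / (b - 1) * a `^ (r - 1).
Proof.
move=> a0; have b10 : 0 < b - 1 by rewrite subr_gt0 b1.
have bb0 : 0 <= b / (b - 1) by rewrite divr_ge0 ?(ltW b10) ?powR_ge0.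
elim: N => [|N IH]; first by rewrite big_ord0 mulr_ge0 ?powR_ge0.
have [Na|aN] := ltP (level N) a; last by rewrite big_ord_recr/= ltNge aN/= addr0.
apply: (@le_trans _ _ (\sum_(i < N.+1) level i `^ (r - 1))).
  by apply: ler_sum => i _; case: ifP => // _; rewrite powR_ge0.
apply: le_trans (sum_level_le N) _; rewrite ler_wpM2l//.
by rewrite ge0_ler_powR ?nnegrE ?subr_ge0 ?(ltW r1)// ?(ltW Na)// ltW// level_gt0.
Qed.

(** A nonzero term is [2^r 2 a t_j^(r-1)] with [t_j < 2 a], so the series is [a] times a geometric
    sum of size [(2 a)^(r-1)]. The factor [2 / t_j] is the one lost in the weak type inequality at
    height [t_j / 2]. *)
Lemma level_series_le (a : \bar R) : (0 <= a)%E ->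
  (\sum_(0 <= j <oo) (((2 * level j) `^ r * (2 / level j))%:E *
     (if ((level j / 2)%:E < a)%E then a else 0)) <= (level_const r)%:E * a `^ r)%E.
Proof.
have b10 : 0 < b - 1 by rewrite subr_gt0 b1.
have bb0 : 0 < b / (b - 1) by rewrite divr_gt0 ?powR_gt0.
case: a => [a| |]//; last first.
  by move=> _; rewrite poweRyr ?gt_eqF ?(lt_trans ltr01)// gt0_muley ?leey// lte_fin; exact: level_const_gt0.
rewrite lee_fin => a0; apply: lime_le.
  apply: is_cvg_nneseries => j _ _; rewrite mule_ge0//; last by case: ifPn.
  by rewrite lee_fin mulr_ge0 ?powR_ge0// divr_ge0// ltW// level_gt0.
apply: nearW => N; rewrite big_mkord.
have -> : (\sum_(i < N) (((2 * level i) `^ r * (2 / level i))%:E *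
     (if ((level i / 2)%:E < a%:E)%E then a%:E else 0)) =
   (2 `^ r * 2 * a * \sum_(i < N) (if level i < 2 * a then level i `^ (r - 1) else 0))%:E)%E.
  rewrite mulr_sumr -sumEFin; apply: eq_bigr => i _.
  rewrite lte_fin ltr_pdivrMr// (mulrC a); case: ifPn => // _; last by rewrite mule0 mulr0.
  rewrite -EFinM powRM ?(ltW (level_gt0 i))//; congr EFin.
  have -> : level i `^ r = level i `^ (r - 1) * level i.
    by rewrite mulrC mulr_powRB1// ?(ltW (level_gt0 i))// (lt_trans ltr01).
  by field; rewrite gt_eqF// level_gt0.
rewrite poweR_EFin -EFinM lee_fin.
have a20 : 0 <= 2 * a by rewrite mulr_ge0.
apply: le_trans (ler_wpM2l _ (sum_level_lt_le N a20)) _.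
  by rewrite !mulr_ge0// powR_ge0.
rewrite powRM// le_eqVlt; apply/orP; left; apply/eqP.
have [->|aN0] := eqVneq a 0.
  by rewrite !(mulr0, mul0r) powR0 ?mulr0// gt_eqF// (lt_trans ltr01).
have -> : a `^ r = a `^ (r - 1) * a.
  by rewrite mulrC mulr_powRB1// (lt_trans ltr01).
by rewrite /level_const; ring.
Qed.

Lemma le_nneseries_term (v : nat -> \bar R) j :
  (forall i, 0 <= v i)%E -> (v j <= \sum_(0 <= i <oo) v i)%E.
Proof.
move=> v0; apply: le_trans (nneseries_lim_ge j.+1 _); last by move=> i _ _; exact: v0.
by rewrite big_nat_recr//= leeDr// sume_ge0.
Qed.

Lemma nneseries_unbounded (e : \bar R) (v : nat -> \bar R) :
  (0 < e)%E -> (forall j, e <= v j)%E -> (\sum_(0 <= i <oo) v i = +oo)%E.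
Proof.
move=> e0 ev; have v0 i : (0 <= v i)%E by rewrite (le_trans (ltW e0)).
have ge1 N : (N%:R%:E * e <= \sum_(0 <= i <oo) v i)%E.
  apply: le_trans (nneseries_lim_ge N _); last by move=> i _ _; exact: v0.
  elim: N => [|N IH]; first by rewrite mul0e big_nil.
  rewrite big_nat_recr//= -natr1 EFinD ge0_muleDl ?lee_fin// mul1e.
  exact: leeD.
apply/eqP; rewrite -leye_eq leNgt; apply/negP => Soo.
have := ge1 (Num.truncn (fine (\sum_(0 <= i <oo) v i) / fine e)).+1.
have S0 : (0 <= \sum_(0 <= i <oo) v i)%E by apply: nneseries_ge0 => i _ _; exact: v0.
have eS : (e <= \sum_(0 <= i <oo) v i)%E.
  by have := ge1 1%N; rewrite mul1e.
have efin : e \is a fin_num.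
  by rewrite ge0_fin_numE ?(ltW e0)// (le_lt_trans eS).
have Sfin : (\sum_(0 <= i <oo) v i)%E \is a fin_num by rewrite ge0_fin_numE.
rewrite -(fineK efin) -(fineK Sfin) -EFinM lee_fin leNgt fineK// fineK//.
have fe0 : 0 < fine e by rewrite fine_gt0// e0 ltey_eq efin.
by rewrite -ltr_pdivrMr// truncnS_gt.
Qed.

(** For finite [a] the single level with [t_j < a <= 2 t_j] is enough. For [a = +oo] every level
    counts and the series diverges unless [c = 0]. *)
Lemma level_series_ge (a c : \bar R) : (d%:E < a)%E -> (0 <= c)%E ->
  (a `^ r * c <= \sum_(0 <= j <oo)
    (((2 * level j) `^ r)%:E * (if (level j)%:E < a then c else 0)))%E.
Proof.
move=> da c0; have v0 (j : nat) : (0 <= ((2 * level j) `^ r)%:E *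
    (if (level j)%:E < a then c else 0))%E.
  by rewrite mule_ge0// ?lee_fin ?powR_ge0//; case: ifPn.
case: a da v0 => [a| |]// da v0; last first.
  have [->|cN0] := eqVneq c 0%E.
    by rewrite mule0; apply: nneseries_ge0 => j _ _; rewrite mule_ge0 ?lee_fin ?powR_ge0// if_same.
  rewrite (@nneseries_unbounded (((2 * d) `^ r)%:E * c)%E) ?leey//.
    by rewrite mule_gt0 ?lte_fin ?powR_gt0 ?mulr_gt0// lt0e cN0.
  move=> j; rewrite ltry lee_wpmul2r// lee_fin ge0_ler_powR ?nnegrE//.
  - by rewrite ltW// (lt_trans ltr01).
  - by rewrite mulr_ge0// ltW.
  - by rewrite mulr_ge0// ltW// level_gt0.
  - by rewrite ler_pM2l// /level ler_peMr ?(ltW d0)// exprn_ege1// ler1n.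
rewrite lte_fin in da; have [j /andP[ja aj]] := exists_level da.
apply: le_trans (le_nneseries_term j v0).
rewrite lte_fin ja lee_wpmul2r// poweR_EFin lee_fin ge0_ler_powR ?nnegrE//.
- by rewrite ltW// (lt_trans ltr01).
- by rewrite ltW// (lt_trans d0).
- by rewrite mulr_ge0// ltW// level_gt0.
Qed.

End dyadic_levels.

(** * From the weak type inequality to the Fefferman-Stein inequality; powers of the maximal
    function *)

Section fefferman_stein.
Context {d : measure_display} {T : measurableType d} {R : realType}.
Variables (mu : {measure set T -> \bar R}) (K : R) (B : T -> R -> set T).
Hypothesis DB : doubling_balls mu K B.
Local Notation maximal := (maximal_over mu B).

(** The values of [|u|] up to [t / 2] contribute at most [t / 2] to any average, so an average above
    [t] leaves more than [t / 2] to the larger values. *)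
Lemma maximal_truncate (u : T -> \bar R) (t : R) x : (0 < t)%R ->
  measurable_fun setT u ->
  t%:E < maximal u x ->
  (t / 2)%:E < maximal (fun y => if (t / 2)%:E < `|u y| then u y else 0) x.
Proof.
move=> t0 mu_ /(lt_maximalP DB)[c [r [r0 cx tu]]]; apply/(lt_maximalP DB); exists c, r; split => //.
have mB := ball_measurable DB c r.
pose v y := if (t / 2)%:E < `|u y| then u y else 0; rewrite -/v.
have mv : measurable_fun setT v.
  apply: measurable_fun_ifT => //.
  apply: measurable_fun_lte => //; exact: measurableT_comp (@abse_measurable R setT) mu_.
have m2 : ((t / 2)%:E + (t / 2)%:E) * mu (B c r) = t%:E * mu (B c r).
  by rewrite -EFinD -splitr.
rewrite -m2 in tu.
have : \int[mu]_(z in B c r) `|u z| <=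
    \int[mu]_(z in B c r) (`|v z| + (t / 2)%:E).
  apply: ge0_le_integral => //.
  - by apply: measurable_funTS; exact: measurableT_comp (@abse_measurable R setT) mu_.
  - apply: emeasurable_funD => //.
    by apply: measurable_funTS; exact: measurableT_comp (@abse_measurable R setT) mv.
  - move=> z _; rewrite /v; case: ifPn => [_|]; first by rewrite leeDl// lee_fin divr_ge0// ltW.
    by rewrite -leNgt abse0 add0e.
rewrite ge0_integralD//; last 2 first.
- by apply: measurable_funTS; exact: measurableT_comp (@abse_measurable R setT) mv.
- by move=> z _; rewrite lee_fin divr_ge0// ltW.
rewrite integral_cst// => ub.
have := lt_le_trans tu ub.
rewrite ge0_muleDl ?lee_fin ?divr_ge0 ?(ltW t0)// lteD2rE//.
by rewrite fin_numM// ge0_fin_numE// (ball_lty DB).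
Qed.

Lemma integral_if_in (A : set T) (f : T -> \bar R) :
  \int[mu]_(x in A) f x = \int[mu]_x (if x \in A then f x else 0).
Proof. by rewrite integral_mkcond. Qed.

Lemma integral_lt_patch (t : \bar R) (F f : T -> \bar R) :
  \int[mu]_(x in [set x | t < F x]) f x = \int[mu]_x (if t < F x then f x else 0).
Proof.
rewrite integral_if_in; apply: eq_integral => x _.
by rewrite (_ : (x \in _) = (t < F x))//; apply/idP/idP; rewrite inE.
Qed.

(* Marcinkiewicz interpolation over the levels [e 2^j], letting [e] go to [0]: at
   each level only the part of [u] above half of it matters. *)
Lemma fefferman_stein (r : R) : (1 < r)%R -> exists2 C : R, (0 < C)%R &
  forall u phi : T -> \bar R, measurable_fun setT u -> measurable_fun setT phi ->
  (forall x, 0 <= phi x) ->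
  \int[mu]_x (maximal u x `^ r * phi x) <= C%:E * \int[mu]_x (`|u x| `^ r * maximal phi x).
Proof.
move=> r1; have K0 := ball_doubling_gt0 DB.
exists (K * level_const r)%R; first by rewrite mulr_gt0// level_const_gt0.
move=> u phi mu_ mphi phi0.
have mMu := measurable_maximal DB u.
have mMphi := measurable_maximal DB phi.
have mau := measurableT_comp (@abse_measurable R setT) mu_.
have r0 : (0 < r)%R by rewrite (lt_trans ltr01).
pose G x := maximal u x `^ r * phi x.
have mG : measurable_fun setT G.
  apply: emeasurable_funM => //; exact: (measurableT_comp (measurable_poweR r)).
have G0 x : 0 <= G x by rewrite mule_ge0// poweR_ge0.
have key (e : R) : (0 < e)%R -> \int[mu]_(x in [set x | e%:E < maximal u x]) G x <=
    (K * level_const r)%:E * \int[mu]_x (`|u x| `^ r * maximal phi x).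
  move=> d0.
  pose t := level e.
  have t0 j : (0 < t j)%R by exact: level_gt0.
  pose A j := [set x | (t j)%:E < maximal u x].
  have mA j : measurable (A j) by exact: (measurable_maximal_superlevel DB).
  pose uj j y := if (t j / 2)%:E < `|u y| then u y else 0.
  have muj j : measurable_fun setT (uj j).
    by apply: measurable_fun_ifT => //; exact: measurable_fun_lte.
  have mauj j := measurableT_comp (@abse_measurable R setT) (muj j).
  (* By [maximal_truncate] the superlevel set of [maximal u] at height [t j] lies in that of
     [maximal (uj j)] at height [t j / 2], where the weak type inequality applies. *)
  have weak j : \int[mu]_(x in A j) phi x <=
      (2 / t j)%:E * (K%:E * \int[mu]_x (`|uj j x| * maximal phi x)).
    apply: (@le_trans _ _ (\int[mu]_(x in [set x | (t j / 2)%:E < maximal (uj j) x]) phi x)).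
      apply: ge0_subset_integral => //; first exact: (measurable_maximal_superlevel DB).
        exact: measurable_funTS.
      by move=> x /= /(maximal_truncate (t0 j) mu_).
    have tj20 : (0 < t j / 2)%R by rewrite divr_gt0.
    have -> : (2 / t j = (t j / 2)^-1)%R by rewrite invf_div.
    by rewrite lee_pdivlMl//; exact: (maximal_weak_type DB).
  have mphiA j : measurable_fun setT (fun x => if (t j)%:E < maximal u x then phi x else 0).
    by apply: measurable_fun_ifT => //; exact: measurable_fun_lte.
  (* Pointwise, [(maximal u)^r phi] is at most the sum of [(2 t_j)^r phi] over the levels below
     [maximal u]. *)
  apply: (@le_trans _ _ (\int[mu]_x \sum_(0 <= j <oo)
      (((2 * t j) `^ r)%:E * (if (t j)%:E < maximal u x then phi x else 0)))).
    rewrite integral_lt_patch; apply: ge0_le_integral => //.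
    - by move=> x _; case: ifPn.
    - by apply: measurable_fun_ifT => //; exact: measurable_fun_lte.
    - apply: ge0_emeasurable_sum => j *.
        by rewrite mule_ge0 ?lee_fin ?powR_ge0//; case: ifPn.
      exact: measurable_funeM.
    - move=> x _; case: ifPn => [dx|_].
        exact: (level_series_ge r1 d0 dx (phi0 x)).
      by apply: nneseries_ge0 => j _ _; rewrite mule_ge0 ?lee_fin ?powR_ge0//; case: ifPn.
  rewrite integral_nneseries//; last 2 first.
  - by move=> j; exact: measurable_funeM.
  - by move=> j x _; rewrite mule_ge0 ?lee_fin ?powR_ge0//; case: ifPn.
  apply: (@le_trans _ _ (\sum_(0 <= j <oo) K%:E * \int[mu]_x
      (((2 * t j) `^ r * (2 / t j))%:E * `|uj j x| * maximal phi x))).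
    apply: lee_nneseries => [j _ _|j _].
      by apply: integral_ge0 => x _; rewrite mule_ge0 ?lee_fin ?powR_ge0//; case: ifPn.
    rewrite ge0_integralZl_EFin//; last 2 first.
    - by move=> x _; case: ifPn.
    - by rewrite powR_ge0.
    under [X in _ <= _ * X]eq_integral do rewrite -muleA.
    rewrite ge0_integralZl_EFin//; last 3 first.
    - by move=> x _; rewrite mule_ge0// (maximal_ge0 DB).
    - exact: emeasurable_funM (mauj j) mMphi.
    - by rewrite mulr_ge0 ?powR_ge0// divr_ge0// ltW.
    rewrite (EFinM ((2 * t j) `^ r)%R) -(muleA (((2 * t j) `^ r)%R)%:E).
    rewrite (muleCA K%:E) lee_wpmul2l ?lee_fin ?powR_ge0// (muleCA K%:E).
    apply: le_trans (weak j).
    by rewrite [leRHS]integral_lt_patch.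
  rewrite nneseriesZl; last first.
    move=> j _; apply: integral_ge0 => x _; rewrite !mule_ge0 ?(maximal_ge0 DB)//.
    by rewrite lee_fin mulr_ge0 ?powR_ge0// divr_ge0// ltW.
  rewrite EFinM -muleA lee_wpmul2l ?lee_fin ?(ltW K0)//.
  have w0 j : (0 <= (2 * t j) `^ r * (2 / t j))%R.
    by rewrite mulr_ge0 ?powR_ge0// divr_ge0// ltW.
  have mw j : measurable_fun setT
      (fun x => ((2 * t j) `^ r * (2 / t j))%:E * `|uj j x| * maximal phi x).
    by apply: emeasurable_funM mMphi; exact: measurable_funeM (mauj j).
  rewrite -integral_nneseries//; last first.
    by move=> j x _; rewrite !mule_ge0 ?(maximal_ge0 DB)// lee_fin.
  rewrite -ge0_integralZl_EFin//; last 3 first.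
  - by move=> x _; rewrite mule_ge0 ?poweR_ge0// (maximal_ge0 DB).
  - by apply: emeasurable_funM => //; exact: (measurableT_comp (measurable_poweR r)).
  - by rewrite ltW// level_const_gt0.
  apply: ge0_le_integral => //.
  - by move=> x _; apply: nneseries_ge0 => j _ _; rewrite !mule_ge0 ?(maximal_ge0 DB)// lee_fin.
  - by apply: ge0_emeasurable_sum => j *; rewrite ?mw// !mule_ge0 ?(maximal_ge0 DB)// lee_fin.
  - apply: measurable_funeM; apply: emeasurable_funM => //.
    exact: (measurableT_comp (measurable_poweR r)).
  (* This is [level_series_le] at [a = |u x|]; going through partial sums allows the possibly
     infinite [maximal phi x] to be factored out. *)
  - move=> x _; rewrite muleA.
    apply: lime_le.
      by apply: is_cvg_nneseries => j _ _; rewrite !mule_ge0 ?(maximal_ge0 DB)// lee_fin.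
    apply: nearW => N; rewrite -ge0_sume_distrl; last first.
      by move=> j _; rewrite mule_ge0// lee_fin.
    rewrite lee_wpmul2r ?(maximal_ge0 DB)//.
    apply: le_trans (level_series_le r1 d0 (abse_ge0 (u x))).
    apply: le_trans (nneseries_lim_ge N _); last first.
      by move=> j _ _; rewrite mule_ge0 ?lee_fin ?w0//; case: ifPn.
    apply: lee_sum => j _.
    by rewrite lee_wpmul2l ?lee_fin ?w0// /uj; case: ifPn; rewrite ?abse0.
have mF N : measurable [set x | (N.+1%:R^-1)%:E < maximal u x].
  exact: (measurable_maximal_superlevel DB).
(* The integrand vanishes where [maximal u] does, and the heights [1 / (N+1)] exhaust the rest. *)
have -> : \int[mu]_x G x =
    \int[mu]_(x in \bigcup_N [set x | (N.+1%:R^-1)%:E < maximal u x]) G x.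
  rewrite [RHS]integral_if_in; apply: eq_integral => x _; case: ifPn => // /negP xN.
  rewrite /G (_ : maximal u x = 0) ?poweR0r ?mul0e ?gt_eqF//.
  apply/eqP; rewrite eq_le (maximal_ge0 DB) andbT leNgt; apply/negP => Mx0; apply: xN.
  apply/mem_set; have [a a0 aM] : exists2 a : R, (0 < a)%R & a%:E < maximal u x.
    case: (maximal u x) Mx0 => [m| |]//; last by exists 1%R; rewrite ?ltr01 ?ltry.
    by rewrite lte_fin => m0; exists (m / 2)%R; [rewrite divr_gt0|rewrite lte_fin gtr_pMr// invf_lt1// ltr1n].
  exists (Num.truncn (a^-1)) => //=; apply: le_lt_trans aM; rewrite lee_fin.
  by rewrite invf_ple ?posrE// ltW// truncnS_gt.
apply: cvge_le (ge0_nondecreasing_set_cvg_integral _ _ _ _) => //; last 2 first.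
- move=> N M NM; rewrite subsetEset => x /=; apply: le_lt_trans.
  by rewrite lee_fin lef_pV2 ?posrE// ler_nat ltnS.
- by move=> N; exact: measurable_funTS.
by apply: nearW => N; apply: key; rewrite invr_gt0.
Qed.

(* Jensen's inequality up to a factor: with [L] above the average of [|f|^k],
   [|f|^t = L^(t/k) (|f|^k / L)^(t/k) <= L^(t/k) (1 + |f|^k / L)]. *)
Lemma maximal_over_pow_le (t k : R) f x : (0 < t)%R -> (t <= k)%R ->
  measurable_fun setT f ->
  maximal (fun y => `|f y| `^ t) x `^ t^-1 <=
  (2 `^ t^-1)%:E * maximal (fun y => `|f y| `^ k) x `^ k^-1.
Proof.
move=> t0 tk mf; have k0 : (0 < k)%R by rewrite (lt_le_trans t0).
have maf := measurableT_comp (@abse_measurable R setT) mf.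
set S := maximal (fun y => `|f y| `^ k) x.
have S0 : 0 <= S by exact: (maximal_ge0 DB).
have tk01 : (0 <= t / k <= 1)%R.
  by rewrite ler_pdivrMr// mul1r tk andbT divr_ge0// ltW.
(* [L] stays strictly above [S], so that it is positive and can be divided by even when [S = 0]. *)
have main (L : R) : S < L%:E -> maximal (fun y => `|f y| `^ t) x <= (2 * L `^ (t / k))%:E.
  move=> SL; have L0 : (0 < L)%R by rewrite -lte_fin (le_lt_trans S0).
  apply: (maximal_leP DB) => c r r0 cx.
  have mB := ball_measurable DB c r.
  have mBk : measurable_fun (B c r) (fun y => `|f y| `^ k).
    by apply: measurable_funTS; exact: (measurableT_comp (measurable_poweR k)).
  have mBt : measurable_fun (B c r) (fun y => `|f y| `^ t).
    by apply: measurable_funTS; exact: (measurableT_comp (measurable_poweR t)).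
  have SB : \int[mu]_(y in B c r) `|f y| `^ k <= L%:E * mu (B c r).
    have := integral_ball_le_maximal DB (fun y => `|f y| `^ k) r0 cx.
    under eq_integral do rewrite gee0_abs ?poweR_ge0//.
    by move=> /le_trans; apply; rewrite lee_wpmul2r// ltW.
  under eq_integral do rewrite gee0_abs ?poweR_ge0//.
  have : \int[mu]_(y in B c r) `|f y| `^ t <=
      \int[mu]_(y in B c r) ((L `^ (t / k))%:E * (1 + (L^-1)%:E * `|f y| `^ k)).
    apply: ge0_le_integral => //.
    - by move=> y _; rewrite poweR_ge0.
    - apply: measurable_funeM; apply: emeasurable_funD => //.
      exact: measurable_funeM.
    - move=> y _; have -> : `|f y| `^ t = (L%:E * ((L^-1)%:E * `|f y| `^ k)) `^ (t / k).
        rewrite muleA -EFinM divff ?gt_eqF// mul1e -poweRrM.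
        by rewrite mulrC divfK// gt_eqF.
      have z0 : 0 <= (L^-1)%:E * `|f y| `^ k.
        by rewrite mule_ge0 ?poweR_ge0// lee_fin invr_ge0 ltW.
      by rewrite poweRM// ?lee_fin ?(ltW L0)// lee_wpmul2l ?lee_fin ?powR_ge0// poweR_le_1D.
  rewrite ge0_integralZl_EFin//; last 3 first.
  - by move=> y _; rewrite adde_ge0// mule_ge0 ?poweR_ge0// lee_fin invr_ge0 ltW.
  - by apply: emeasurable_funD => //; exact: measurable_funeM.
  - by rewrite powR_ge0.
  rewrite ge0_integralD//; last 2 first.
  - by move=> y _; rewrite mule_ge0 ?poweR_ge0// lee_fin invr_ge0 ltW.
  - exact: measurable_funeM.
  rewrite ge0_integralZl_EFin//; last 2 first.
  - by move=> y _; rewrite poweR_ge0.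
  - by rewrite invr_ge0 ltW.
  rewrite integral_cst// mul1e => /le_trans; apply.
  rewrite (mulrC 2%R) EFinM -muleA lee_wpmul2l ?lee_fin ?powR_ge0//.
  have -> : 2%:E * mu (B c r) = mu (B c r) + mu (B c r).
    by rewrite -mule2n muleC mule_natr.
  by rewrite leeD2l// lee_pdivrMl.
have [->|Soo] := eqVneq S +oo.
  by rewrite poweRyr ?invr_eq0 ?gt_eqF// gt0_muley ?leey// lte_fin powR_gt0.
have Sfin : S \is a fin_num by rewrite ge0_fin_numE// ltey.
have : maximal (fun y => `|f y| `^ t) x <= 2%:E * S `^ (t / k).
  have M0 := maximal_ge0 DB (fun y => `|f y| `^ t) x.
  set M := maximal (fun y => `|f y| `^ t) x in main M0 *.
  have kt0 : (0 < k / t)%R by rewrite divr_gt0.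
  (* Raised to the power [k / t], the bound [main] becomes linear in [L], so that [L] can decrease
     to [S] by an additive [e]. *)
  suff H : ((2^-1)%:E * M) `^ (k / t) <= S.
    rewrite -lee_pdivrMl//; have := lee_poweR _ (poweR_ge0 _ _) H.
    move=> /(_ (t / k)%R); rewrite -poweRrM mulf_div (mulrC k) divff ?mulf_neq0 ?gt_eqF//.
    have M20 : 0 <= (2^-1)%:E * M by apply: mule_ge0 M0; rewrite lee_fin invr_ge0.
    by rewrite (poweRe1 M20) => H'; apply: H'; case/andP: tk01.
  apply/lee_addgt0Pr => e e0.
  have /main ML : S < (fine S + e)%:E by rewrite EFinD fineK// lteDl.
  have L0 : (0 <= fine S + e)%R by exact: addr_ge0 (fine_ge0 S0) (ltW e0).
  rewrite -(fineK Sfin) -EFinD.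
  have : (2^-1)%:E * M <= ((fine S + e) `^ (t / k))%:E by rewrite lee_pdivrMl// -EFinM.
  move=> /(lee_poweR (ltW kt0) _); rewrite mule_ge0// => /(_ isT)/le_trans; apply.
  by rewrite poweR_EFin lee_fin -powRrM mulf_div (mulrC t) divff ?powRr1// mulf_neq0 ?gt_eqF.
move=> /(lee_poweR _ (maximal_ge0 DB _ _)) => /(_ t^-1%R); rewrite invr_ge0 (ltW t0).
move=> /(_ isT)/le_trans; apply.
rewrite poweRM ?poweR_ge0// -poweRrM mulrAC divff ?gt_eqF// mul1r.
by rewrite poweR_EFin.
Qed.

End fefferman_stein.

(** * Variable Lebesgue spaces *)

Section measurable_power.
Context {d : measure_display} {T : measurableType d} {R : realType}.

Lemma measurable_powR2 (f g : T -> R) : measurable_fun setT f -> measurable_fun setT g ->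
  measurable_fun setT (fun x => (f x `^ g x)%R).
Proof.
move=> mf mg; rewrite /powR; apply: measurable_fun_ifT => /=.
- exact: measurable_fun_eqr mf (measurable_cst _).
- rewrite (_ : (fun _ => _) = (fun t => if g t == 0 then 1 else 0)%R); last first.
    by apply/funext => t; case: eqP.
  apply: (measurable_fun_ifT (measurable_fun_eqr mg (measurable_cst _))) => //.
- apply: measurableT_comp (@measurable_expR R) _.
  by apply: measurable_funM mg _; exact: measurableT_comp (@measurable_ln R) mf.
Qed.

Lemma measurable_poweR2 (f : T -> \bar R) (g : T -> R) :
  measurable_fun setT f -> measurable_fun setT g ->
  measurable_fun setT (fun x => f x `^ g x).
Proof.
move=> mf mg.
have mff : measurable_fun setT (fine \o f).
  exact: measurableT_comp (fine_measurable measurableT) mf.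
rewrite (_ : (fun _ => _) = (fun x => if f x == +oo then (if g x == 0%R then 1 else +oo)
   else if f x == -oo then (if g x == 0%R then 1 else 0) else ((fine (f x)) `^ g x)%:E)); last first.
  by apply/funext => x; case: (f x).
have mg0 := measurable_fun_eqr mg (measurable_cst (0%R : R)).
apply: (measurable_fun_ifT (measurable_fun_eqe mf (measurable_cst _))).
  exact: measurable_fun_ifT mg0 (measurable_cst _) (measurable_cst _).
apply: (measurable_fun_ifT (measurable_fun_eqe mf (measurable_cst _))).
  exact: measurable_fun_ifT mg0 (measurable_cst _) (measurable_cst _).
by apply/measurable_EFinP; exact: (measurable_powR2 mff mg).
Qed.

End measurable_power.

Section variable_lebesgue.
Context {d : measure_display} {T : measurableType d} {R : realType}.
Variable mu : {measure set T -> \bar R}.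
Hypothesis mu_gt0 : 0 < mu setT.
Implicit Types (q : T -> \bar R) (f g : T -> \bar R).

Definition modular_over q f : \bar R :=
  \int[mu]_(x in [set x | q x < +oo]) (`|f x| `^ fine (q x))
  + Lnorm mu +oo (fun x => f x * (\1_[set x | q x = +oo%E] x)%:E).

Definition var_norm_over q f : \bar R :=
  ereal_inf [set l%:E | l in
    [set l : R | (0 < l)%R /\ modular_over q (fun x => f x * (l^-1)%:E) <= 1]].

(** The value 0 where [q = +oo] makes modulars with different exponents integrals over one and the
    same set. *)
Definition pow_part q f x : \bar R := if q x < +oo then `|f x| `^ fine (q x) else 0.

Definition sup_part q f : \bar R :=
  Lnorm mu +oo (fun x => f x * (\1_[set x | q x = +oo%E] x)%:E).

Lemma pow_part_ge0 q f x : 0 <= pow_part q f x.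
Proof. by rewrite /pow_part; case: ifPn => // _; exact: poweR_ge0. Qed.

Lemma sup_part_ge0 q f : 0 <= sup_part q f. Proof. exact: Lnorm_ge0. Qed.

Lemma measurable_pow_part q f : measurable_fun setT q -> measurable_fun setT f ->
  measurable_fun setT (pow_part q f).
Proof.
move=> mq mf; apply: measurable_fun_ifT (measurable_cst _).
  exact: measurable_fun_lte mq (measurable_cst _).
apply: measurable_poweR2; first exact: measurableT_comp (@abse_measurable R setT) mf.
exact: measurableT_comp (fine_measurable measurableT) mq.
Qed.

Lemma modularE q f : modular_over q f = \int[mu]_x pow_part q f x + sup_part q f.
Proof.
rewrite /modular_over integral_mkcond; congr (_ + _); apply: eq_integral => x _.
by rewrite patchE /pow_part (_ : (x \in _) = (q x < +oo))//; apply/idP/idP; rewrite inE.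
Qed.

(** [Lnorm] at [+oo] is an essential supremum only when [mu setT] is positive: this is where
    [mu_gt0] comes from. [0 <= c] takes care of the points with finite exponent, where the function
    is 0. *)
Lemma sup_part_leP q f c : 0 <= c ->
  sup_part q f <= c <-> {ae mu, forall x, q x = +oo -> `|f x| <= c}.
Proof.
move=> c0; rewrite /sup_part unlock mu_gt0; split=> [/ess_supP|H].
  by apply: filterS => x /= + qx; rewrite indicE mem_set// mule1.
apply/ess_supP; apply: filterS H => x /= H.
rewrite indicE; have [qx|qx] := eqVneq (q x) +oo.
  by rewrite mem_set// mule1; exact: H.
by rewrite memNset ?mule0 ?abse0//=; exact/eqP.
Qed.

Lemma ae_le_pow_part q f g : measurable_fun setT q -> measurable_fun setT f ->
  measurable_fun setT g -> (forall x, 0 <= q x) ->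
  {ae mu, forall x, `|f x| <= `|g x|} ->
  \int[mu]_x pow_part q f x <= \int[mu]_x pow_part q g x.
Proof.
move=> mq mf mg q0 fg; apply: ae_ge0_le_integral => //.
- by move=> x _; exact: pow_part_ge0.
- exact: measurable_pow_part.
- by move=> x _; exact: pow_part_ge0.
- exact: measurable_pow_part.
apply: filterS fg => x fg _; rewrite /pow_part; case: ifPn => // _.
by apply: lee_poweR => //; exact: fine_ge0.
Qed.

Lemma ae_le_modular q f g : measurable_fun setT q -> measurable_fun setT f ->
  measurable_fun setT g -> (forall x, 0 <= q x) ->
  {ae mu, forall x, `|f x| <= `|g x|} ->
  modular_over q f <= modular_over q g.
Proof.
move=> mq mf mg q0 fg; rewrite !modularE; apply: leeD; first exact: ae_le_pow_part.
apply/sup_part_leP; first exact: sup_part_ge0.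
have /sup_part_leP := lexx (sup_part q g); move=> /(_ (sup_part_ge0 _ _)) gS.
apply: filterS2 fg gS => x fg gS qx.
exact: le_trans fg (gS qx).
Qed.

Lemma ae_eq_modular q q' f g : measurable_fun setT q -> measurable_fun setT q' ->
  measurable_fun setT f -> measurable_fun setT g ->
  {ae mu, forall x, q x = q' x} -> {ae mu, forall x, `|f x| = `|g x|} ->
  modular_over q f = modular_over q' g.
Proof.
move=> mq mq' mf mg qq fg; rewrite !modularE; congr (_ + _).
  apply: ge0_ae_eq_integral => //.
  - exact: measurable_pow_part.
  - exact: measurable_pow_part.
  - by move=> x _; exact: pow_part_ge0.
  - by move=> x _; exact: pow_part_ge0.
  by apply: filterS2 qq fg => x qx fx _; rewrite /pow_part qx fx.
have le q1 q2 f1 f2 : {ae mu, forall x, q1 x = q2 x} -> {ae mu, forall x, `|f1 x| = `|f2 x|} ->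
    sup_part q1 f1 <= sup_part q2 f2.
  move=> qe fe; apply/sup_part_leP; first exact: sup_part_ge0.
  have /sup_part_leP := lexx (sup_part q2 f2); move=> /(_ (sup_part_ge0 _ _)).
  by apply: filterS3 qe fe => x q12 f12; rewrite q12 f12.
apply/eqP; rewrite eq_le !le//.
- by apply: filterS qq => x ->.
- by apply: filterS fg => x ->.
Qed.

Lemma measurable_scaler f (l : R) : measurable_fun setT f ->
  measurable_fun setT (fun x => f x * l%:E).
Proof. by move=> mf; apply: emeasurable_funM mf (measurable_cst _). Qed.

Lemma modular_scale_le q f (c : R) : measurable_fun setT q -> measurable_fun setT f ->
  (forall x, 1 <= q x) -> (0 <= c <= 1)%R ->
  modular_over q (fun x => f x * c%:E) <= c%:E * modular_over q f.
Proof.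
move=> mq mf q1 /andP[c0 c1]; rewrite !modularE.
rewrite ge0_muleDr ?integral_ge0 ?sup_part_ge0//; last by move=> x _; exact: pow_part_ge0.
apply: leeD.
  rewrite -ge0_integralZl_EFin//; last 2 first.
  - by move=> x _; exact: pow_part_ge0.
  - exact: measurable_pow_part.
  apply: ge0_le_integral => //.
  - by move=> x _; exact: pow_part_ge0.
  - by apply: measurable_pow_part => //; exact: measurable_scaler.
  - by apply: measurable_funeM; exact: measurable_pow_part.
  move=> x _; rewrite /pow_part; have [qx|] := ltP (q x) +oo; last by rewrite mule0.
  have qf : q x \is a fin_num by rewrite ge0_fin_numE// (le_trans _ (q1 x)).
  rewrite abseM poweRM// muleC lee_wpmul2r ?poweR_ge0//.
  rewrite (_ : `|c%:E| = c%:E); last by rewrite gee0_abs ?lee_fin.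
  rewrite poweR_EFin lee_fin.
  have [->|cN0] := eqVneq c 0%R.
    rewrite powR0// gt_eqF// -lte_fin fineK// (lt_le_trans _ (q1 x))//.
  by rewrite ge1r_powR// ?lt0r ?cN0 ?c0 ?c1// -lee_fin fineK.
apply/sup_part_leP; first by rewrite mule_ge0 ?lee_fin ?sup_part_ge0.
have /sup_part_leP := lexx (sup_part q f); move=> /(_ (sup_part_ge0 _ _)).
apply: filterS => x fS qx; rewrite abseM muleC gee0_abs ?lee_fin//.
by rewrite lee_wpmul2l ?lee_fin//; exact: fS.
Qed.

Lemma var_norm_ge0 q f : 0 <= var_norm_over q f.
Proof. by apply: le_ereal_inf_tmp => _ [l [/ltW l0 _] <-]; rewrite lee_fin. Qed.

Lemma var_norm_le q f (l : R) : (0 < l)%R ->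
  modular_over q (fun x => f x * (l^-1)%:E) <= 1 -> var_norm_over q f <= l%:E.
Proof. by move=> l0 fl; apply: ereal_inf_lbound; exists l. Qed.

Lemma var_norm_lt q f (l : R) : measurable_fun setT q -> measurable_fun setT f ->
  (forall x, 0 <= q x) -> var_norm_over q f < l%:E ->
  modular_over q (fun x => f x * (l^-1)%:E) <= 1.
Proof.
move=> mq mf q0 /ereal_inf_lt[_ [l' [l'0 fl'] <-]]; rewrite lte_fin => l'l.
have l0 : (0 < l)%R by rewrite (lt_trans l'0).
apply: le_trans fl'; apply: ae_le_modular => //; [exact: measurable_scaler..|].
apply: nearW => x; rewrite !abseM lee_wpmul2l// !gee0_abs ?lee_fin ?invr_ge0 ?ltW//.
by rewrite ltf_pV2.
Qed.

(** The bound is inverted to [(X / C)^(1/k) <= l] for all admissible [l], so that the infimum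
    appears without a continuity argument, and a norm equal to [+oo] is no exception. *)
Lemma var_norm_le_pow q f (X : \bar R) (C k : R) : (0 < C)%R -> (0 < k)%R -> 0 <= X ->
  (forall l : R, (0 < l)%R -> modular_over q (fun x => f x * (l^-1)%:E) <= 1 ->
    X <= (C * l `^ k)%:E) ->
  X <= C%:E * var_norm_over q f `^ k.
Proof.
move=> C0 k0 X0 H; have ik0 : (0 < k^-1)%R by rewrite invr_gt0.
have CX0 : 0 <= (C^-1)%:E * X by rewrite mule_ge0// lee_fin invr_ge0 ltW.
rewrite -lee_pdivrMl//.
have -> : (C^-1)%:E * X = (((C^-1)%:E * X) `^ k^-1) `^ k.
  by rewrite -poweRrM mulVf ?gt_eqF// poweRe1.
apply: lee_poweR; [exact: ltW|exact: poweR_ge0|].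
apply: le_ereal_inf_tmp => _ [l [l0 fl] <-].
have -> : l%:E = (l `^ k)%:E `^ k^-1.
  by rewrite poweR_EFin -powRrM divff ?gt_eqF// powRr1// ltW.
by apply: lee_poweR => //; [exact: ltW|rewrite lee_pdivrMl// -EFinM; exact: H].
Qed.

Lemma var_norm_le_mul q q' f g (C : R) : (0 < C)%R ->
  (forall l : R, (0 < l)%R -> modular_over q (fun x => f x * (l^-1)%:E) <= 1 ->
    var_norm_over q' g <= (C * l)%:E) ->
  var_norm_over q' g <= C%:E * var_norm_over q f.
Proof.
move=> C0 H; rewrite -[X in _ * X]poweRe1 ?var_norm_ge0//.
apply: var_norm_le_pow => //; first exact: var_norm_ge0.
by move=> l l0 /(H _ l0); rewrite powRr1// ltW.
Qed.

Lemma ae_le_var_norm q f g : measurable_fun setT q -> measurable_fun setT f ->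
  measurable_fun setT g -> (forall x, 0 <= q x) ->
  {ae mu, forall x, `|f x| <= `|g x|} -> var_norm_over q f <= var_norm_over q g.
Proof.
move=> mq mf mg q0 fg; rewrite -[leRHS]mul1e; apply: var_norm_le_mul => // l l0 gl.
rewrite mul1r; apply: var_norm_le => //; apply: le_trans gl.
apply: ae_le_modular => //; [exact: measurable_scaler..|].
by apply: filterS fg => x fg; rewrite !abseM lee_wpmul2r.
Qed.

Lemma ae_eq_var_norm q q' f g : measurable_fun setT q -> measurable_fun setT q' ->
  measurable_fun setT f -> measurable_fun setT g ->
  {ae mu, forall x, q x = q' x} -> {ae mu, forall x, `|f x| = `|g x|} ->
  var_norm_over q f = var_norm_over q' g.
Proof.
move=> mq mq' mf mg qq fg; rewrite /var_norm_over.
have E l : modular_over q (fun x => f x * (l^-1)%:E) = modular_over q' (fun x => g x * (l^-1)%:E).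
  apply: ae_eq_modular => //; [exact: measurable_scaler..|].
  by apply: filterS fg => x fg; rewrite !abseM fg.
by congr (ereal_inf (_ @` _)); apply/seteqP; split => l /= [l0]; rewrite E.
Qed.

Lemma var_norm_scale_le q f (a : R) : (0 < a)%R ->
  var_norm_over q (fun x => f x * a%:E) <= a%:E * var_norm_over q f.
Proof.
move=> a0; apply: var_norm_le_mul => // l l0 fl; apply: var_norm_le; first exact: mulr_gt0.
rewrite (_ : (fun _ => _) = (fun x => f x * (l^-1)%:E))//; apply/funext => x.
by rewrite -muleA -EFinM invfM mulrA divff ?gt_eqF// mul1r.
Qed.

Lemma var_norm_scale q f (a : R) : (0 < a)%R ->
  var_norm_over q (fun x => f x * a%:E) = a%:E * var_norm_over q f.
Proof.
move=> a0; apply/eqP; rewrite eq_le var_norm_scale_le//=.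
rewrite -lee_pdivlMl//.
apply: le_trans (var_norm_scale_le _ _ _); last by rewrite invr_gt0.
rewrite (_ : (fun x => f x * a%:E * (a^-1)%:E) = f)//; apply/funext => x.
by rewrite -muleA -EFinM divff ?gt_eqF// mule1.
Qed.

Section conjugate.
Implicit Types (r : R).

Lemma hoelder_conjugate_fin r : (1 < r)%R -> hoelder_conjugate r%:E = (r / (r - 1))%:E.
Proof.
move=> r1; rewrite /hoelder_conjugate /= eqe gt_eqF ?(lt_trans ltr01)//.
by rewrite -EFinB inver subr_eq0 gt_eqF.
Qed.

(** Young's inequality with the factors [1 / r] and [(r - 1) / r] dropped, both being at most 1. *)
Lemma young_poweR r (a b : \bar R) : (1 < r)%R -> 0 <= a -> 0 <= b ->
  a * b <= a `^ r + b `^ (r / (r - 1)).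
Proof.
move=> r1; have r0 : (0 < r)%R by rewrite (lt_trans ltr01).
have r10 : (0 < r - 1)%R by rewrite subr_gt0.
have r'0 : (0 < r / (r - 1))%R by rewrite divr_gt0.
have r'1 : (1 <= r / (r - 1))%R by rewrite ler_pdivlMr// mul1r; lra.
case: a b => [a| |]// [b| |]//.
- rewrite !poweR_EFin -EFinM -EFinD !lee_fin => a0 b0.
  apply: le_trans (conjugate_powR a0 b0 r0 r'0 _) _.
    by field; rewrite !gt_eqF.
  by apply: lerD; rewrite ler_pdivrMr// ler_peMr ?powR_ge0// ltW.
- by move=> _ _; rewrite (poweRyr (r := r / (r - 1)%R)) ?gt_eqF// addey ?leey.
- by move=> _ _; rewrite poweRyr ?gt_eqF// addye ?leey.
- by move=> _ _; rewrite poweRyr ?gt_eqF// addye ?leey// poweRyr ?gt_eqF.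
Qed.

End conjugate.

Lemma sup_part_le1 q f : modular_over q f <= 1 -> sup_part q f <= 1.
Proof.
rewrite modularE; apply: le_trans; rewrite leeDr// integral_ge0// => x _.
exact: pow_part_ge0.
Qed.

Lemma pow_part_le1 q f : modular_over q f <= 1 -> \int[mu]_x pow_part q f x <= 1.
Proof. by rewrite modularE; apply: le_trans; rewrite leeDl// sup_part_ge0. Qed.

(** For exponents at least 1, halving the function at least halves the modular; this is the price of
    bounding its two parts by 1 separately. *)
Lemma modular_half q f : measurable_fun setT q -> measurable_fun setT f ->
  (forall x, 1 <= q x) -> \int[mu]_x pow_part q f x <= 1 -> sup_part q f <= 1 ->
  modular_over q (fun x => f x * (2^-1)%:E) <= 1.
Proof.
move=> mq mf q1 f1 f2; apply: le_trans (modular_scale_le mq mf q1 _) _.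
  by rewrite invr_ge0 ler0n invf_le1// ler1n.
rewrite lee_pdivrMl// mule1 modularE.
by apply: le_trans (leeD f1 f2) _; rewrite -EFinD lee_fin.
Qed.

Lemma leye_natP (x : \bar R) : (forall M : nat, M%:R%:E <= x) -> x = +oo.
Proof.
move=> xM; apply/eqP; rewrite -leye_eq leNgt; apply/negP => xoo.
have x0 := xM 0%N; have xf : x \is a fin_num by rewrite ge0_fin_numE.
have := truncnS_gt (fine x); rewrite -lte_fin fineK// ltNge.
by rewrite xM.
Qed.

(** Monotone convergence with [f] only dominated by the limit: at each point some [g N] already
    reaches [f], or the sequence is unbounded, as for truncations of an infinite value. *)
Lemma monotone_integral_le (g : nat -> T -> \bar R) (f : T -> \bar R) (c : \bar R) :
  (forall N, measurable_fun setT (g N)) -> measurable_fun setT f ->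
  (forall x, 0 <= f x) ->
  (forall N x, 0 <= g N x) -> (forall x, nondecreasing_seq (g ^~ x)) ->
  (forall x, (exists N, f x <= g N x) \/ (forall M : nat, exists N, M%:R%:E <= g N x)) ->
  (forall N, \int[mu]_x g N x <= c) -> \int[mu]_x f x <= c.
Proof.
move=> mg mf f0 g0 ndg fg gc.
have cg x : g ^~ x @ \oo --> limn (g ^~ x).
  by apply: ereal_nondecreasing_is_cvgn.
have ub x N : g N x <= limn (g ^~ x).
  rewrite (cvg_lim _ (ereal_nondecreasing_cvgn (ndg x)))//.
  by apply: ereal_sup_ubound; exists N.
have cv := @cvg_monotone_convergence _ _ _ mu _ measurableT _ mg (fun N x _ => g0 N x) (fun x _ => ndg x).
apply: le_trans (cvge_le (b := c) _ cv); last by apply: nearW.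
apply: ge0_le_integral => //.
- by apply: emeasurable_fun_cvg mg _ => x _; exact: cg.
- move=> x _; have [[N fN]|H'] := fg x; first exact: le_trans fN (ub x N).
  rewrite (_ : limn _ = +oo) ?leey//; apply: leye_natP => M.
  by have [N MN] := H' M; exact: le_trans MN (ub x N).
Qed.

(** * Hoelder's inequality and its converse for variable exponents *)

Section duality.
Variables (q q' : T -> \bar R).
Hypotheses (mq : measurable_fun setT q) (mq' : measurable_fun setT q').
Hypotheses (q1 : forall x, 1 <= q x) (qq' : forall x, q' x = hoelder_conjugate (q x)).

Let q'1 x : 1 <= q' x. Proof. by rewrite qq'; exact: hoelder_conj_ge1. Qed.

(** Young's inequality applies where [1 < q < +oo]. Where [q] is 1 or [+oo], one factor belongs to
    an essential supremum bounded by 1 and the product is at most the other factor. Each of the two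
    integrals is at most 1. *)
Lemma modular_hoelder f g : measurable_fun setT f -> measurable_fun setT g ->
  modular_over q f <= 1 -> modular_over q' g <= 1 -> \int[mu]_x `|f x * g x| <= 2%:E.
Proof.
move=> mf mg f1 g1.
have mpf := measurable_pow_part mq mf; have mpg := measurable_pow_part mq' mg.
have p0 := pow_part_ge0.
apply: (@le_trans _ _ (\int[mu]_x (pow_part q f x + pow_part q' g x))).
  apply: ae_ge0_le_integral => //.
  - by apply: measurableT_comp (@abse_measurable R setT) _; exact: emeasurable_funM.
  - by move=> x _; rewrite adde_ge0.
  - exact: emeasurable_funD.
  have /(sup_part_leP _ _ lee01) := sup_part_le1 f1.
  have /(sup_part_leP _ _ lee01) := sup_part_le1 g1.
  apply: filterS2 => x gx fx _; rewrite abseM.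
  have := q1 x; rewrite /pow_part; have := qq' x; case: (q x) fx => [r| |]// fx q'x.
    rewrite lee_fin le_eqVlt => /predU1P[r1|r1].
      rewrite q'x -r1 hoelder_conjugate1 ltxx adde0 ltry/= poweRe1//.
      by rewrite -[leRHS]mule1 lee_wpmul2l// gx// q'x -r1 hoelder_conjugate1.
    by rewrite q'x hoelder_conjugate_fin// !ltry; exact: young_poweR.
  move=> _; rewrite q'x hoelder_conjugatey ltxx add0e ltry/= poweRe1//.
  by rewrite -[leRHS]mul1e lee_wpmul2r// fx.
rewrite ge0_integralD//; apply: le_trans (leeD (pow_part_le1 f1) (pow_part_le1 g1)) _.
by rewrite -EFinD lee_fin.
Qed.

Lemma var_norm_hoelder f g (b : R) : measurable_fun setT f -> measurable_fun setT g ->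
  (0 < b)%R -> var_norm_over q' g < b%:E ->
  \int[mu]_x `|f x * g x| <= (2 * b)%:E * var_norm_over q f.
Proof.
move=> mf mg b0 gb; have gm := var_norm_lt mq' mg (fun x => le_trans lee01 (q'1 x)) gb.
have i0 : 0 <= \int[mu]_x `|f x * g x| by exact: integral_ge0.
have b20 : (0 < 2 * b)%R by exact: mulr_gt0.
rewrite -[X in _ * X]poweRe1 ?var_norm_ge0//.
apply: var_norm_le_pow => // l l0 fl.
have := modular_hoelder (measurable_scaler _ mf) (measurable_scaler _ mg) fl gm.
have -> : (fun x => `|f x * (l^-1)%:E * (g x * (b^-1)%:E)|) =
    (fun x => ((l * b)^-1)%:E * `|f x * g x|).
  apply/funext => x; rewrite muleACA abseM muleC -EFinM -invfM gee0_abs// lee_fin.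
  by rewrite invr_ge0 mulr_ge0// ltW.
rewrite ge0_integralZl_EFin//; last 2 first.
- by apply: measurableT_comp (@abse_measurable R setT) _; exact: emeasurable_funM.
- by rewrite invr_ge0 mulr_ge0// ltW.
rewrite lee_pdivrMl ?mulr_gt0// => /le_trans; apply.
rewrite -EFinM lee_fin powRr1 ?(ltW l0)//.
by rewrite le_eqVlt; apply/orP; left; apply/eqP; ring.
Qed.

Variable E : nat -> set T.
Hypotheses (mE : forall N, measurable (E N)) (ndE : nondecreasing_seq E).
Hypotheses (Efin : forall N, mu (E N) < +oo) (Ecover : forall x, exists N, E N x).

(* [K] is truncated where [q] is bounded, on a set of finite measure, and tested
   against [K^(q-1)]. *)
Lemma dual_pow_part_le (K : T -> \bar R) (c : R) : measurable_fun setT K ->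
  (forall x, 0 <= K x) -> (c < 2^-1)%R ->
  (forall phi, measurable_fun setT phi -> (forall x, 0 <= phi x) ->
    modular_over q' phi <= 1 -> \int[mu]_x (K x * phi x) <= c%:E) ->
  \int[mu]_x pow_part q K x <= 1.
Proof.
move=> mK K0 c2 H.
pose P N x := (q x <= N.+1%:R%:E) && (x \in E N).
have mP N : measurable_fun setT (P N).
  apply: measurable_and; first exact: measurable_fun_lee mq (measurable_cst _).
  by apply: (measurable_fun_bool true); rewrite setTI preimage_mem_true.
pose KN N x : \bar R := if P N x then mine (K x) N.+1%:R%:E else 0.
have KN0 N x : 0 <= KN N x by rewrite /KN; case: ifP => // _; rewrite le_min K0/= lee_fin.
have mKN N : measurable_fun setT (KN N).
  by apply: measurable_fun_ifT => //; exact: measurable_mine.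
have KNK N x : KN N x <= K x by rewrite /KN; case: ifP => // _; rewrite ge_min lexx.
have KNfin N x : KN N x \is a fin_num.
  rewrite ge0_fin_numE// /KN; case: ifP => // _.
  by rewrite (@le_lt_trans _ _ N.+1%:R%:E) ?ltry// ge_min lexx orbT.
have qfin N x : P N x -> exists2 r, q x = r%:E & (1 <= r <= N.+1%:R)%R.
  move=> /andP[+ _]; have := q1 x; case: (q x) => // r; rewrite !lee_fin => r1 rN.
  by exists r => //; rewrite r1.
have abKN N x : `|KN N x| = KN N x by rewrite gee0_abs.
have ndKN x : nondecreasing_seq (fun N => pow_part q (KN N) x).
  move=> N M NM; rewrite /pow_part; case: ifPn => // _; rewrite !abKN.
  apply: lee_poweR => //; first by rewrite fine_ge0// (le_trans lee01).
  rewrite /KN; case: ifPn => [/andP[qN xN]|]; last by case: ifP => // _; rewrite le_min K0/= lee_fin.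
  have -> : P M x.
    rewrite /P (le_trans qN) ?lee_fin ?ler_nat ?ltnS//=.
    by move: xN; rewrite !inE; exact/subsetPset/ndE.
  by rewrite le_min !ge_min lexx/= lee_fin ler_nat ltnS NM orbT.
apply: (@monotone_integral_le (fun N => pow_part q (KN N))) => //.
- by move=> N; exact: measurable_pow_part.
- exact: measurable_pow_part.
- exact: pow_part_ge0.
- by move=> N x; exact: pow_part_ge0.
- move=> x; have := q1 x; rewrite /pow_part; case qx : (q x) => [r| |]//; last first.
    by move=> _; left; exists 0%N; rewrite ltxx.
  rewrite lee_fin => r1; rewrite ltry/=.
  have [N0 xN0] := Ecover x.
  have PN N : (N0 <= N)%N -> (Num.truncn r <= N)%N -> P N x.
    move=> N0N rN; rewrite /P qx lee_fin; apply/andP; split.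
      by rewrite (le_trans (ltW (truncnS_gt r)))// ler_nat ltnS.
    by rewrite inE; move: xN0; exact/subsetPset/ndE.
  have [Kx|Kx] := eqVneq (K x) +oo.
    right=> M; exists (maxn M (maxn N0 (Num.truncn r))).
    set N := maxn _ _; have NM : (M <= N)%N by exact: leq_maxl.
    rewrite abKN /KN PN ?leq_max ?leqnn ?orbT// Kx minye poweR_EFin lee_fin.
    apply: (@le_trans _ _ N.+1%:R%R); first by rewrite ler_nat leqW.
    by rewrite -{1}[N.+1%:R%R]powRr1// ler_powR// ler1n.
  left; have Kf : K x \is a fin_num by rewrite ge0_fin_numE// ltey.
  exists (maxn (Num.truncn (fine (K x))) (maxn N0 (Num.truncn r))).
  set N := maxn _ _; rewrite abKN /KN PN ?leq_max ?leqnn ?orbT//.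
  rewrite (_ : mine _ _ = K x); first by rewrite gee0_abs.
  apply/min_idPl; rewrite -(fineK Kf) lee_fin (le_trans (ltW (truncnS_gt _)))//.
  by rewrite ler_nat ltnS leq_maxl.
move=> N; rewrite leNgt; apply/negP => I1.
(* Values and exponents at most [N+1] on a set of finite measure make the integral finite, so that
   it can serve for normalisation. *)
have Ioo : \int[mu]_x pow_part q (KN N) x < +oo.
  apply: (@le_lt_trans _ _ (\int[mu]_(x in E N) (cst (N.+1%:R `^ N.+1%:R)%:E) x)); last first.
    by rewrite integral_cst// lte_mul_pinfty ?lee_fin ?powR_ge0.
  rewrite [leRHS]integral_mkcond; apply: ge0_le_integral => //.
  - by move=> x _; exact: pow_part_ge0.
  - exact: measurable_pow_part.
  - by apply/(measurable_restrictT _ (mE N)).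
  move=> x _; rewrite patchE /pow_part; case: ifPn => qoo; last first.
    by case: ifP => // _; rewrite lee_fin powR_ge0.
  rewrite abKN /KN; have [PNx|nP] := boolP (P N x); last first.
    rewrite poweR0r; first by case: ifP => // _; rewrite lee_fin powR_ge0.
    have qf : q x \is a fin_num by rewrite ge0_fin_numE// (le_trans lee01).
    by rewrite gt_eqF// fine_gt0// qoo (lt_le_trans lte01).
  have [r qx /andP[r1 rN]] := qfin _ _ PNx; rewrite (andP PNx).2 qx /=.
  have r0 : (0 <= r)%R by rewrite (le_trans ler01).
  apply: (@le_trans _ _ (N.+1%:R%:E `^ r)).
    by apply: lee_poweR => //; [rewrite le_min K0/= lee_fin|rewrite ge_min lexx orbT].
  by rewrite poweR_EFin lee_fin ler_powR// ler1n.
have I0 : 0 <= \int[mu]_x pow_part q (KN N) x by exact/ltW/(lt_trans lte01).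
have If : \int[mu]_x pow_part q (KN N) x \is a fin_num by rewrite ge0_fin_numE.
set rho := fine (\int[mu]_x pow_part q (KN N) x).
have IE : \int[mu]_x pow_part q (KN N) x = rho%:E by rewrite fineK.
have rho1 : (1 < rho)%R by rewrite -lte_fin -IE.
have a0 : (0 < (2 * rho)^-1)%R by rewrite invr_gt0 mulr_gt0// (lt_trans ltr01).
have a1 : ((2 * rho)^-1 <= 2^-1)%R.
  have rho0 : (0 < rho)%R by rewrite (lt_trans ltr01).
  by rewrite lef_pV2 ?posrE ?mulr_gt0// ler_peMr// ltW.
have a11 : ((2 * rho)^-1 <= 1)%R by rewrite (le_trans a1)// invf_le1// ler1n.
(* Both parts of the modular of [phi] are at most 1/2: [KN^((q-1) q')] is [KN^q], of integral [rho],
   and where [q = 1] the function is at most [1 / (2 rho)] with [rho > 1]. Pairing with [K] gives at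
   least [rho / (2 rho) = 1/2], which exceeds [c]. *)
pose phi x := if P N x then ((2 * rho)^-1)%:E * KN N x `^ (fine (q x) - 1) else 0.
have phi0 x : 0 <= phi x.
  by rewrite /phi; case: ifP => // _; rewrite mule_ge0 ?poweR_ge0// lee_fin ltW.
have abphi x : `|phi x| = phi x by rewrite gee0_abs.
have mphi : measurable_fun setT phi.
  apply: measurable_fun_ifT => //; apply: measurable_funeM; apply: measurable_poweR2 => //.
  apply: measurable_funB => //; exact: measurableT_comp (fine_measurable measurableT) mq.
have Hphi : modular_over q' phi <= 1.
  have -> : 1 = (2^-1)%:E + (2^-1)%:E :> \bar R.
    by rewrite -EFinD; congr EFin; field.
  rewrite modularE; apply: leeD.
    have -> : (2^-1)%:E = ((2 * rho)^-1)%:E * \int[mu]_x pow_part q (KN N) x :> \bar R.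
      by rewrite IE -EFinM; congr EFin; field; rewrite gt_eqF// (lt_trans ltr01).
    rewrite -ge0_integralZl_EFin//; last 3 first.
    - by move=> x _; exact: pow_part_ge0.
    - exact: measurable_pow_part.
    - exact: ltW.
    apply: ge0_le_integral => //.
    - by move=> x _; exact: pow_part_ge0.
    - exact: measurable_pow_part.
    - by apply: measurable_funeM; exact: measurable_pow_part.
    move=> x _; rewrite [leLHS]/pow_part; have [q'oo|] := ltP (q' x) +oo; last first.
      by rewrite mule_ge0 ?pow_part_ge0// lee_fin ltW.
    rewrite abphi /phi; have [PNx|nP] := boolP (P N x); last first.
      rewrite poweR0r; first by rewrite mule_ge0 ?pow_part_ge0// lee_fin ltW.
      have qf : q' x \is a fin_num by rewrite ge0_fin_numE// (le_trans lee01).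
      by rewrite gt_eqF// fine_gt0// q'oo (lt_le_trans lte01).
    have [r qx /andP[r1 rN]] := qfin _ _ PNx.
    rewrite /pow_part qx ltry abKN /=; move: r1; rewrite le_eqVlt => /predU1P[r1|r1].
      by move: q'oo; rewrite qq' qx -r1 hoelder_conjugate1 ltxx.
    have r10 : (0 < r - 1)%R by rewrite subr_gt0.
    rewrite qq' qx hoelder_conjugate_fin//= poweRM ?poweR_ge0 ?lee_fin ?(ltW a0)//.
    rewrite -poweRrM mulrCA divff ?gt_eqF// mulr1 lee_wpmul2r ?poweR_ge0//.
    rewrite poweR_EFin lee_fin ge1r_powR ?a0//.
    by rewrite ler_pdivlMr// mul1r; lra.
  apply/sup_part_leP; first by rewrite lee_fin invr_ge0.
  apply: nearW => x q'x; rewrite abphi /phi; have [PNx|nP] := boolP (P N x); last first.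
    by rewrite lee_fin invr_ge0.
  have [r qx /andP[r1 rN]] := qfin _ _ PNx.
  have {r1}r1 : r = 1%R.
    move: r1; rewrite le_eqVlt => /predU1P[//|r1].
    by move: q'x; rewrite qq' qx hoelder_conjugate_fin.
  by rewrite qx r1 /= subrr poweRe0 mule1 lee_fin.
have := H phi mphi phi0 Hphi; apply/negP; rewrite -ltNge.
apply: (@lt_le_trans _ _ (2^-1)%:E); first by rewrite lte_fin.
have -> : (2^-1)%:E = ((2 * rho)^-1)%:E * \int[mu]_x pow_part q (KN N) x :> \bar R.
  by rewrite IE -EFinM; congr EFin; field; rewrite gt_eqF// (lt_trans ltr01).
rewrite -ge0_integralZl_EFin//; last 3 first.
- by move=> x _; exact: pow_part_ge0.
- exact: measurable_pow_part.
- exact: ltW.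
apply: ge0_le_integral => //.
- by move=> x _; rewrite mule_ge0 ?pow_part_ge0// lee_fin ltW.
- by apply: measurable_funeM; exact: measurable_pow_part.
- exact: emeasurable_funM.
move=> x _; rewrite /phi; have [PNx|nP] := boolP (P N x); last first.
  rewrite mule0 /pow_part; case: ifPn => qoo; last by rewrite mule0.
  rewrite abKN /KN (negbTE nP) poweR0r ?mule0//.
  have qf : q x \is a fin_num by rewrite ge0_fin_numE// (le_trans lee01).
  by rewrite gt_eqF// fine_gt0// qoo (lt_le_trans lte01).
have [r qx /andP[r1 rN]] := qfin _ _ PNx.
rewrite /pow_part qx ltry abKN /= muleCA lee_wpmul2l ?lee_fin ?(ltW a0)//.
apply: le_trans (lee_wpmul2r (poweR_ge0 _ _) (KNK N x)).
rewrite -(fineK (KNfin N x)) !poweR_EFin -EFinM lee_fin mulr_powRB1//.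
  by rewrite fine_ge0.
by rewrite (lt_le_trans ltr01).
Qed.

(** If [K > 1] on a part of [q = +oo] of positive measure, some [E N] cuts out a piece of positive
    finite measure. Its indicator divided by its measure has modular at most 1, as [q' = 1] there,
    and pairs with [K] to at least 1. *)
Lemma dual_sup_part_le (K : T -> \bar R) (c : R) : measurable_fun setT K ->
  (forall x, 0 <= K x) -> (c < 1)%R ->
  (forall phi, measurable_fun setT phi -> (forall x, 0 <= phi x) ->
    modular_over q' phi <= 1 -> \int[mu]_x (K x * phi x) <= c%:E) ->
  sup_part q K <= 1.
Proof.
move=> mK K0 c1 H; apply/sup_part_leP => //.
pose A := [set x | q x = +oo /\ 1 < K x].
have mA : measurable A.
  apply: measurableI.
    have /(_ measurableT [set true] I) := measurable_fun_eqe mq (measurable_cst (+oo : \bar R)).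
    rewrite setTI; have -> : (fun x => q x == +oo) @^-1` [set true] = [set x | q x = +oo].
      by apply/seteqP; split => x /eqP.
    exact.
  have /(_ measurableT [set true] I) := measurable_fun_lte (measurable_cst (1 : \bar R)) mK.
  by rewrite setTI.
suff AN0 N : mu (A `&` E N) = 0.
  have nA : mu.-negligible (\bigcup_N (A `&` E N)).
    apply: negligible_bigcup => N; apply/negligibleP; first exact: measurableI.
    exact: AN0.
  apply: negligibleS nA.
  move=> x /= /not_implyP[qx /negP]; rewrite -ltNge gee0_abs// => Kx.
  by have [N xN] := Ecover x; exists N.
apply/eqP; rewrite eq_le measure_ge0 andbT leNgt; apply/negP => m0.
set S := A `&` E N in m0 *.
have mS : measurable S by exact: measurableI.
have moo : mu S < +oo.
  by apply: le_lt_trans (Efin N); apply: le_measure; rewrite ?inE//; exact: subIsetr.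
have mf : mu S \is a fin_num by rewrite ge0_fin_numE.
pose m := fine (mu S); have mE' : mu S = m%:E by rewrite fineK.
have {m0}m0 : (0 < m)%R by rewrite -lte_fin -mE'.
pose phi x : \bar R := (m^-1)%:E * (\1_S x)%:E.
have phi0 x : 0 <= phi x by rewrite mule_ge0// lee_fin ?invr_ge0 ?ltW.
have mphi : measurable_fun setT phi.
  by apply: measurable_funeM; apply/measurable_EFinP; exact: measurable_indic.
have Sphi : \int[mu]_x phi x = 1.
  rewrite ge0_integralZl_EFin//; last 2 first.
  - by apply/measurable_EFinP; exact: measurable_indic.
  - by rewrite invr_ge0 ltW.
  by rewrite integral_indic// setIT mE' -EFinM mulVf// gt_eqF.
have Hphi : modular_over q' phi <= 1.
  rewrite modularE -[leRHS]adde0; apply: leeD.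
    rewrite -Sphi; apply: ge0_le_integral => //.
    - by move=> x _; exact: pow_part_ge0.
    - exact: measurable_pow_part.
    move=> x _; rewrite /pow_part; have [q'oo|//] := ltP (q' x) +oo.
    rewrite gee0_abs// /phi indicE; have [xS|xS] := boolP (x \in S).
      have [[qx _] _] : S x by exact/set_mem.
      by rewrite qq' qx hoelder_conjugatey (_ : fine 1 = 1%R)// poweRe1// mule_ge0 ?lee_fin ?invr_ge0 ?ltW.
    rewrite mule0 poweR0r//.
    have qf : q' x \is a fin_num by rewrite ge0_fin_numE// (le_trans lee01).
    by rewrite gt_eqF// fine_gt0// q'oo (lt_le_trans lte01).
  apply/sup_part_leP => //; apply: nearW => x q'x; rewrite /phi indicE.
  rewrite memNset ?mule0 ?abse0//= => -[[qx _] _].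
  by move: q'x; rewrite qq' qx hoelder_conjugatey.
have := H phi mphi phi0 Hphi; apply/negP; rewrite -ltNge.
apply: (@lt_le_trans _ _ 1); first by rewrite lte_fin.
rewrite -Sphi; apply: ge0_le_integral => //.
- exact: emeasurable_funM.
move=> x _; rewrite /phi indicE; have [xS|xS] := boolP (x \in S); last by rewrite !mule0.
have [[_ /ltW Kx] _] : S x by exact/set_mem.
by rewrite -[leLHS]mul1e lee_wpmul2r// mule1 lee_fin invr_ge0 ltW.
Qed.

(** Dividing by [l = 2 A + e / 2] brings the pairings below 1/2, so that both parts of the modular
    are at most 1; halving once more bounds their sum, at the scale [2 l = 4 A + e]. *)
Lemma var_norm_dual (G : T -> \bar R) (A : R) : measurable_fun setT G ->
  (forall x, 0 <= G x) -> (0 <= A)%R ->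
  (forall phi, measurable_fun setT phi -> (forall x, 0 <= phi x) ->
    modular_over q' phi <= 1 -> \int[mu]_x (G x * phi x) <= A%:E) ->
  var_norm_over q G <= (4 * A)%:E.
Proof.
move=> mG G0 A0 H; apply/lee_addgt0Pr => e e0.
pose l := (2 * A + e / 2)%R.
have l0 : (0 < l)%R by rewrite ltr_wpDl ?mulr_ge0// divr_gt0.
have -> : (4 * A)%:E + e%:E = (l * 2)%:E by rewrite -EFinD; congr EFin; rewrite /l; field.
pose K x := G x * (l^-1)%:E.
have mK : measurable_fun setT K by exact: measurable_scaler.
have K0 x : 0 <= K x by rewrite mule_ge0// lee_fin invr_ge0 ltW.
have HK phi : measurable_fun setT phi -> (forall x, 0 <= phi x) ->
    modular_over q' phi <= 1 -> \int[mu]_x (K x * phi x) <= (A / l)%:E.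
  move=> mphi phi0 Hphi; under eq_integral do rewrite /K muleAC muleC.
  rewrite ge0_integralZl_EFin//; last 3 first.
  - by move=> x _; rewrite mule_ge0.
  - exact: emeasurable_funM.
  - by rewrite invr_ge0 ltW.
  by rewrite mulrC EFinM lee_wpmul2l ?lee_fin ?invr_ge0 ?(ltW l0)//; exact: H.
have Al : (A / l < 2^-1)%R by rewrite ltr_pdivrMr// /l; lra.
apply: var_norm_le; first exact: mulr_gt0.
rewrite (_ : (fun _ => _) = (fun x => K x * (2^-1)%:E)); last first.
  by apply/funext => x; rewrite /K -muleA -EFinM invfM.
apply: modular_half => //.
  exact: dual_pow_part_le Al HK.
apply: dual_sup_part_le HK => //.
by rewrite (lt_trans Al)// invf_lt1// ltr1n.
Qed.

End duality.

End variable_lebesgue.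

Lemma abse_pow_scale (R : realType) (k l : R) (a : \bar R) : (0 < l)%R ->
  `|a| `^ k * ((l `^ k)^-1)%:E = `|a * (l^-1)%:E| `^ k.
Proof.
move=> l0; rewrite abseM poweRM// (_ : `|(l^-1)%:E| = (l^-1)%:E); last first.
  by rewrite gee0_abs// lee_fin invr_ge0 ltW.
congr (_ * _); rewrite [RHS]poweR_EFin; congr EFin.
by rewrite -(powR_inv1 (ltW l0)) -powRrM mulN1r powRN.
Qed.

(** * Norms of powers when the exponent may be infinite *)

Section power.
Context {d : measure_display} {T : measurableType d} {R : realType}.
Variable mu : {measure set T -> \bar R}.
Hypothesis mu_gt0 : 0 < mu setT.

Lemma measurable_abse_pow (f : T -> \bar R) (k : R) : measurable_fun setT f ->
  measurable_fun setT (fun x => `|f x| `^ k).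
Proof.
move=> mf; apply: (measurableT_comp (measurable_poweR k)).
exact: measurableT_comp (@abse_measurable R setT) mf.
Qed.

Variables (q : T -> \bar R) (k : R).
Hypotheses (mq : measurable_fun setT q) (q1 : forall x, 1 <= q x) (k1 : (1 <= k)%R).

Let k0 : (0 < k)%R. Proof. exact: lt_le_trans k1. Qed.

Let qk x := q x * (k^-1)%:E.

Lemma pow_part_pow (f : T -> \bar R) x :
  pow_part qk (fun y => `|f y| `^ k) x = pow_part q f x.
Proof.
rewrite /pow_part /qk; case: (q x) (q1 x) => [r| |]// r1; last first.
  by rewrite gt0_mulye ?lte_fin ?invr_gt0// ltxx.
by rewrite !ltry/= gee0_abs ?poweR_ge0// -poweRrM mulrCA divff ?mulr1// gt_eqF.
Qed.

Let qkE x : qk x = +oo -> q x = +oo.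
Proof. by rewrite /qk; case: (q x) (q1 x). Qed.

(** The integrals in the two modulars coincide. The suprema are those of [|g|^k] and [|g|], and a
    modular at most 1 keeps [|g|] at most 1 on that part, where [a^k <= a]. *)
Lemma var_norm_pow_le (f : T -> \bar R) : measurable_fun setT f ->
  var_norm_over mu qk (fun x => `|f x| `^ k) <= var_norm_over mu q f `^ k.
Proof.
move=> mf; rewrite -[leRHS]mul1e; apply: var_norm_le_pow => //.
  exact: var_norm_ge0.
move=> l l0 fl; rewrite mul1r; apply: var_norm_le; first by rewrite powR_gt0.
rewrite (_ : (fun _ => _) = (fun x => `|f x * (l^-1)%:E| `^ k)); last first.
  by apply/funext => x; rewrite abse_pow_scale.
set g := (fun x => f x * (l^-1)%:E) in fl *.
apply: le_trans (fl); rewrite !modularE; apply: leeD.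
  by rewrite (eq_integral (pow_part q g))// => x _; exact: pow_part_pow.
apply/(sup_part_leP mu_gt0); first exact: sup_part_ge0.
have /(sup_part_leP mu_gt0 _ _ lee01) g1 := sup_part_le1 fl.
have /(sup_part_leP mu_gt0 _ _ (sup_part_ge0 _ _ _)) := lexx (sup_part mu q g).
apply: filterS2 g1 => x g1 gS /qkE qx; apply: le_trans (gS qx).
rewrite gee0_abs ?poweR_ge0//; move: (g1 qx); rewrite -/(g x); move: (abse_ge0 (g x)).
case: `|g x| => [a| |]//; rewrite poweR_EFin !lee_fin => a0 a1.
have [->|aN0] := eqVneq a 0%R; first by rewrite powR0// gt_eqF.
by rewrite ge1r_powR// lt0r aN0 a0.
Qed.

(** In this direction [|g|^k <= 1] yields [|g| <= 1] but not [|g| <= |g|^k]; the two parts of the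
    modular are bounded separately and [modular_half] costs the factor 2. *)
Lemma var_norm_le_power (f : T -> \bar R) : measurable_fun setT f ->
  var_norm_over mu q f <= 2%:E * var_norm_over mu qk (fun x => `|f x| `^ k) `^ k^-1.
Proof.
move=> mf; apply: var_norm_le_pow => //; [by rewrite invr_gt0|exact: var_norm_ge0|].
move=> l l0 fl; have lk0 : (0 < l `^ k^-1)%R by rewrite powR_gt0.
apply: var_norm_le; first by rewrite mulr_gt0.
pose g x := f x * ((l `^ k^-1)^-1)%:E.
have mg : measurable_fun setT g by exact: measurable_scaler.
rewrite (_ : (fun _ => _) = (fun x => g x * (2^-1)%:E)); last first.
  by apply/funext => x; rewrite /g -muleA -EFinM invfM mulrC.
have gE : (fun x => `|f x| `^ k * (l^-1)%:E) = (fun x => `|g x| `^ k).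
  apply/funext => x; rewrite /g -abse_pow_scale// -powRrM mulVf ?gt_eqF// powRr1//.
  exact: ltW.
rewrite gE in fl; apply: modular_half => //.
  have := pow_part_le1 fl.
  by rewrite (eq_integral (pow_part q g))// => x _; exact: pow_part_pow.
have /(sup_part_leP mu_gt0 _ _ lee01) g1 := sup_part_le1 fl.
apply/(sup_part_leP mu_gt0) => //; apply: filterS g1 => x g1 qx.
have /g1 : qk x = +oo by rewrite /qk qx gt0_mulye// lte_fin invr_gt0.
rewrite gee0_abs ?poweR_ge0// => gk; rewrite leNgt; apply/negP => g1'.
move: gk; apply/negP; rewrite -ltNge; move: g1'.
case: `|g x| => [a| |]//; rewrite ?poweRyr ?gt_eqF// lte_fin poweR_EFin lte_fin => a1.
rewrite -[ltLHS](_ : 1 `^ k = 1)%R; last by rewrite powR1.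
by rewrite gt0_ltr_powR ?nnegrE// (le_trans ler01)// ltW.
Qed.

End power.

(** * Exponents that are finite everywhere: norm axioms *)

Section finite_exponent.
Context {d : measure_display} {T : measurableType d} {R : realType}.
Variable mu : {measure set T -> \bar R}.
Hypothesis mu_gt0 : 0 < mu setT.
Variable (q : T -> R).
Hypotheses (mq : measurable_fun setT q) (q0 : forall x, (0 < q x)%R).

Let mEq : measurable_fun setT (EFin \o q). Proof. exact/measurable_EFinP. Qed.
Let q0' x : 0 <= (EFin \o q) x. Proof. by rewrite lee_fin ltW. Qed.

Lemma modular_fin (f : T -> \bar R) :
  modular_over mu (EFin \o q) f = \int[mu]_x `|f x| `^ q x.
Proof.
rewrite modularE (_ : sup_part _ _ _ = 0) ?adde0; last first.
  apply/eqP; rewrite eq_le sup_part_ge0 andbT; apply/(sup_part_leP mu_gt0) => //.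
  exact: nearW.
by apply: eq_integral => x _; rewrite /pow_part /= ltry.
Qed.

Lemma var_norm_fin_num (f : T -> \bar R) : measurable_fun setT f ->
  var_norm_over mu (EFin \o q) f < +oo -> {ae mu, forall x, f x \is a fin_num}.
Proof.
move=> mf /ereal_inf_lt[_ [l [l0 fl] <-] _].
have mfl : measurable_fun setT (fun x => f x * (l^-1)%:E) by exact: measurable_scaler.
have mG : measurable_fun setT (fun x => `|f x * (l^-1)%:E| `^ q x).
  by apply: measurable_poweR2 => //; exact: measurableT_comp (@abse_measurable R setT) mfl.
have : mu.-integrable setT (fun x => `|f x * (l^-1)%:E| `^ q x).
  apply/integrableP; split => //.
  under eq_integral do rewrite gee0_abs ?poweR_ge0//.
  by rewrite -modular_fin (le_lt_trans fl)// ltry.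
move=> /(integrable_ae measurableT); apply: filterS => x /(_ I).
rewrite ge0_fin_numE ?poweR_ge0// => /(lty_poweRy _); rewrite gt_eqF// => /(_ isT).
have li0 : (0 < l^-1)%R by rewrite invr_gt0.
rewrite abseM (_ : `|(l^-1)%:E| = (l^-1)%:E); last by rewrite gee0_abs// lee_fin ltW.
case: (f x) => [r| |]//=; by rewrite gt0_mulye.
Qed.

(** When the norm is 0 every [l > 0] is admissible, and [|f|^q <= l |f / l|^q] for [l <= 1] and
    [q >= 1]; so the integral of [|f|^q] is at most every such [l]. *)
Lemma var_norm_eq0 (f : T -> \bar R) : (forall x, (1 <= q x)%R) -> measurable_fun setT f ->
  var_norm_over mu (EFin \o q) f = 0 -> {ae mu, forall x, f x = 0}.
Proof.
move=> q1 mf f0.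
have mG : measurable_fun setT (fun x => `|f x| `^ q x).
  by apply: measurable_poweR2 => //; exact: measurableT_comp (@abse_measurable R setT) mf.
have I0 : \int[mu]_x `|f x| `^ q x = 0.
  apply/eqP; rewrite eq_le integral_ge0 ?andbT; last by move=> x _; exact: poweR_ge0.
  apply/lee_addgt0Pr => e e0; rewrite add0e.
  pose l := Num.min e 1%R.
  have l0 : (0 < l)%R by rewrite lt_min e0 ltr01.
  have l1 : (l <= 1)%R by rewrite ge_min lexx orbT.
  apply: (@le_trans _ _ l%:E); last by rewrite lee_fin ge_min lexx.
  have mfl := measurable_scaler (l^-1) mf.
  have /(_ _)/le_trans := @var_norm_lt _ _ _ mu mu_gt0 _ _ l mEq mf q0'.
  rewrite f0 lte_fin => /(_ _ l0) fl.
  have : \int[mu]_x `|f x| `^ q x <= \int[mu]_x (l%:E * `|f x * (l^-1)%:E| `^ q x).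
    apply: ge0_le_integral => //.
    - by move=> x _; exact: poweR_ge0.
    - apply: measurable_funeM; apply: measurable_poweR2 => //.
      exact: measurableT_comp (@abse_measurable R setT) mfl.
    move=> x _; have {1}-> : f x = l%:E * (f x * (l^-1)%:E).
      by rewrite muleCA -EFinM divff ?gt_eqF// mule1.
    rewrite abseM poweRM// lee_wpmul2r ?poweR_ge0//.
    rewrite (_ : `|l%:E| = l%:E); last by rewrite gee0_abs// lee_fin ltW.
    by rewrite poweR_EFin lee_fin ge1r_powR ?l0.
  move=> /le_trans; apply.
  rewrite ge0_integralZl_EFin//; last 3 first.
  - by move=> x _; exact: poweR_ge0.
  - apply: measurable_poweR2 => //.
    exact: measurableT_comp (@abse_measurable R setT) mfl.
  - exact: ltW.
  rewrite -modular_fin -[leRHS]mule1 lee_wpmul2l ?lee_fin ?(ltW l0)//.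
  exact: fl.
have := (ae_eq_integral_abs mu measurableT mG).1.
under eq_integral do rewrite gee0_abs ?poweR_ge0//.
move=> /(_ I0); apply: filterS => x /(_ I) /= /(poweR_eq0_eq0 (abse_ge0 _)) /eqP.
by rewrite abse_eq0 => /eqP.
Qed.

(** For [a] and [b] slightly above the two norms, [(f + g) / (a + b)] is the convex combination of
    [f / a] and [g / b] with weights [a / (a + b)] and [b / (a + b)], and convexity of the power
    bounds its modular by 1. Finite norms make both functions finite almost everywhere, so that the
    sum is meaningful. *)
Lemma var_norm_triangle (f g : T -> \bar R) : (forall x, (1 <= q x)%R) ->
  measurable_fun setT f -> measurable_fun setT g ->
  var_norm_over mu (EFin \o q) f < +oo -> var_norm_over mu (EFin \o q) g < +oo ->
  var_norm_over mu (EFin \o q) (f \+ g) <=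
  var_norm_over mu (EFin \o q) f + var_norm_over mu (EFin \o q) g.
Proof.
move=> q1 mf mg Nf Ng; set NF := var_norm_over mu _ f; set NG := var_norm_over mu _ g.
have NF0 : 0 <= NF by exact: var_norm_ge0.
have NG0 : 0 <= NG by exact: var_norm_ge0.
have NFf : NF \is a fin_num by rewrite ge0_fin_numE.
have NGf : NG \is a fin_num by rewrite ge0_fin_numE.
apply/lee_addgt0Pr => e e0; have e20 : (0 < e / 2)%R by rewrite divr_gt0.
pose a := (fine NF + e / 2)%R; pose b := (fine NG + e / 2)%R.
have a0 : (0 < a)%R by rewrite ltr_wpDl// fine_ge0.
have b0 : (0 < b)%R by rewrite ltr_wpDl// fine_ge0.
have ab0 : (0 < a + b)%R by rewrite addr_gt0.
have -> : NF + NG + e%:E = (a + b)%:E.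
  rewrite -(fineK NFf) -(fineK NGf) -!EFinD; congr EFin.
  by rewrite /a /b; field.
have /var_norm_lt fa : NF < a%:E by rewrite EFinD fineK// lteDl// lte_fin.
have {}fa := fa mu_gt0 mEq mf q0'.
have /var_norm_lt gb : NG < b%:E by rewrite EFinD fineK// lteDl// lte_fin.
have {}gb := gb mu_gt0 mEq mg q0'.
apply: var_norm_le => //; rewrite !modular_fin in fa gb *.
have mpow (h : T -> \bar R) (c : R) : measurable_fun setT h ->
    measurable_fun setT (fun x => `|h x * c%:E| `^ q x).
  move=> mh; apply: measurable_poweR2 => //.
  exact: measurableT_comp (@abse_measurable R setT) (measurable_scaler c mh).
have ta : (0 <= a / (a + b))%R by rewrite divr_ge0 ?ltW.
have tb : (0 <= b / (a + b))%R by rewrite divr_ge0 ?ltW.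
apply: (@le_trans _ _ (\int[mu]_x ((a / (a + b))%:E * `|f x * (a^-1)%:E| `^ q x +
    (b / (a + b))%:E * `|g x * (b^-1)%:E| `^ q x))).
  apply: ae_ge0_le_integral => //.
  - by move=> x _; exact: poweR_ge0.
  - by apply: mpow; exact: emeasurable_funD.
  - by move=> x _; rewrite adde_ge0// mule_ge0 ?poweR_ge0.
  - by apply: emeasurable_funD; apply: measurable_funeM; exact: mpow.
  apply: filterS2 (var_norm_fin_num mf Nf) (var_norm_fin_num mg Ng) => x.
  case: (f x) => // u _; case: (g x) => // v _ _.
  suff : (`|(u + v) / (a + b)| `^ q x <=
      a / (a + b) * `|u / a| `^ q x + b / (a + b) * `|v / b| `^ q x)%R.
    by rewrite -lee_fin.
  pose X : R := `|u / a|%R; pose Y : R := `|v / b|%R; rewrite -/X -/Y.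
  have X0 : (0 <= X)%R by exact: normr_ge0.
  have Y0 : (0 <= Y)%R by exact: normr_ge0.
  have tt : (1 - a / (a + b) = b / (a + b))%R by field; rewrite gt_eqF.
  have t01 : (0 <= a / (a + b) <= 1)%R.
    by rewrite ta ler_pdivrMr// mul1r lerDl ltW.
  apply: (@le_trans _ _ ((a / (a + b) * X + b / (a + b) * Y) `^ q x)%R).
    apply: ge0_ler_powR; [exact: ltW|by rewrite nnegrE|
      by rewrite nnegrE; exact: addr_ge0 (mulr_ge0 ta X0) (mulr_ge0 tb Y0)|].
    have -> : ((u + v) / (a + b) = a / (a + b) * (u / a) + b / (a + b) * (v / b))%R.
      by field; rewrite !gt_eqF.
    apply: le_trans (ler_normD _ _) _.
    rewrite (normrM (a / (a + b))%R) (normrM (b / (a + b))%R).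
    by rewrite (ger0_norm ta) (ger0_norm tb).
  rewrite -tt; case/andP: t01 => t0 t1.
  have := convex_powR (q1 x) (Itv01 t0 t1) (x := X) (y := Y).
  by rewrite !inE/= !in_itv/= X0 Y0 => /(_ isT isT).
rewrite ge0_integralD//; last 4 first.
- by move=> x _; rewrite mule_ge0 ?poweR_ge0.
- by apply: measurable_funeM; exact: mpow.
- by move=> x _; rewrite mule_ge0 ?poweR_ge0.
- by apply: measurable_funeM; exact: mpow.
rewrite !ge0_integralZl_EFin//; try by [move=> x _; exact: poweR_ge0|exact: mpow].
apply: (@le_trans _ _ ((a / (a + b))%:E * 1 + (b / (a + b))%:E * 1)).
  by apply: leeD; rewrite lee_wpmul2l ?lee_fin.
by rewrite !mule1 -EFinD lee_fin -mulrDl divff// gt_eqF.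
Qed.

Lemma limn_einf_ub (v : nat -> \bar R) (c : \bar R) : (forall m, v m <= c) -> limn_einf v <= c.
Proof.
move=> vc; rewrite limn_einf_lim; apply: lime_le; first exact: is_cvg_einfs.
by apply: nearW => m; apply: le_trans (vc m); apply: ereal_inf_lbound; exists m => /=.
Qed.

Lemma limn_einf_ge0 (v : nat -> \bar R) : (forall m, 0 <= v m) -> 0 <= limn_einf v.
Proof.
move=> v0; rewrite limn_einf_lim; apply: lime_ge; first exact: is_cvg_einfs.
by apply: nearW => m; apply: le_ereal_inf_tmp => _ [k _ <-].
Qed.

Lemma le_limn_einf (v : nat -> \bar R) m : nondecreasing_seq v -> v m <= limn_einf v.
Proof.
move=> ndv; rewrite limn_einf_lim.
have cv : einfs v @ \oo --> ereal_sup (range (einfs v)) by exact: cvg_einfs_sup.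
rewrite (cvg_lim _ cv)//; apply: le_trans (ereal_sup_ubound _); last by exists m.
by apply: le_ereal_inf_tmp => _ [k /= mk <-]; exact: ndv.
Qed.

(** For [l] above the supremum of the norms, the modulars of [u m / l] are at most 1, and Fatou's
    lemma passes this on to [f / l]. *)
Lemma var_norm_fatou (u : nat -> T -> \bar R) (f : T -> \bar R) :
  (forall m, measurable_fun setT (u m)) -> measurable_fun setT f ->
  {ae mu, forall x, [/\ forall m, 0 <= u m x,
    nondecreasing_seq (fun m => u m x) & u m x @[m --> \oo] --> f x]} ->
  nondecreasing_seq (fun m => var_norm_over mu (EFin \o q) (u m)) /\
  var_norm_over mu (EFin \o q) (u m) @[m --> \oo] --> var_norm_over mu (EFin \o q) f.
Proof.
move=> mum mf uf.
have ndN : nondecreasing_seq (fun m => var_norm_over mu (EFin \o q) (u m)).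
  move=> m m' mm'; apply: ae_le_var_norm => //.
  by apply: filterS uf => x [u0 ndu _]; rewrite !gee0_abs//; exact: ndu.
split=> //; have cS := ereal_nondecreasing_cvgn ndN.
set S := ereal_sup _ in cS.
suff -> : var_norm_over mu (EFin \o q) f = S by [].
apply/eqP; rewrite eq_le; apply/andP; split; last first.
  apply: ge_ereal_sup => _ [m _ <-]; apply: ae_le_var_norm => //.
  apply: filterS uf => x [u0 ndu cu].
  have uf m' : u m' x <= f x.
    by apply: cvge_ge cu; exists m' => //= k /= mk; exact: ndu.
  by rewrite !gee0_abs// (le_trans (u0 m)).
have S0 : 0 <= S.
  apply: (@le_trans _ _ (var_norm_over mu (EFin \o q) (u 0%N))); first exact: var_norm_ge0.
  by apply: ereal_sup_ubound; exists 0%N.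
have [->|Soo] := eqVneq S +oo; first exact: leey.
have Sf : S \is a fin_num by rewrite ge0_fin_numE// ltey.
apply/lee_addgt0Pr => e e0; pose l := (fine S + e)%R.
have l0 : (0 < l)%R by rewrite ltr_wpDl// fine_ge0.
have -> : S + e%:E = l%:E by rewrite EFinD fineK.
apply: var_norm_le => //; rewrite modular_fin.
have mpow (h : T -> \bar R) (c : R) : measurable_fun setT h ->
    measurable_fun setT (fun x => `|h x * c%:E| `^ q x).
  move=> mh; apply: measurable_poweR2 => //.
  exact: measurableT_comp (@abse_measurable R setT) (measurable_scaler c mh).
pose g m x := `|u m x * (l^-1)%:E| `^ q x.
have mg m : measurable_fun setT (g m) by exact: mpow.
have g1 m : \int[mu]_x g m x <= 1.
  rewrite -modular_fin; apply: var_norm_lt => //.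
  apply: (@le_lt_trans _ _ S); first by apply: ereal_sup_ubound; exists m.
  by rewrite /l EFinD fineK// lteDl// lte_fin.
have := @fatou _ _ _ mu _ measurableT g mg (fun m x _ => poweR_ge0 _ _).
move=> /le_trans => H; apply: le_trans (H _ (limn_einf_ub g1)).
apply: ae_ge0_le_integral => //.
- by move=> x _; exact: poweR_ge0.
- exact: mpow.
- by move=> x _; apply: limn_einf_ge0 => m; exact: poweR_ge0.
- under eq_fun do rewrite limn_einf_lim.
  apply: (emeasurable_fun_cvg (fun m x => einfs (g ^~ x) m)).
    exact: measurable_fun_einfs.
  by move=> x _; exact: is_cvg_einfs.
apply: filterS uf => x [u0 ndu cu] _.
have li0 : (0 <= l^-1)%R by rewrite invr_ge0 ltW.
have ndg : nondecreasing_seq (fun m => g m x).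
  move=> m m' mm'; apply: lee_poweR => //; first exact/ltW.
  by rewrite !abseM lee_wpmul2r// !gee0_abs//; exact: ndu.
set c := limn_einf _.
have gc m : g m x <= c by exact: (le_limn_einf m ndg).
have qi0 : (0 <= (q x)^-1)%R by rewrite invr_ge0 ltW.
have qN0 : q x != 0%R by rewrite gt_eqF.
have c0 : 0 <= c by rewrite (le_trans _ (gc 0%N))// poweR_ge0.
(* Taking roots before the limit in [m] avoids any appeal to continuity of the power. *)
have ul m : u m x <= l%:E * c `^ (q x)^-1.
  rewrite -lee_pdivrMl// muleC.
  have := lee_poweR qi0 (poweR_ge0 _ _) (gc m); rewrite /g -poweRrM divff// poweRe1//.
  by rewrite gee0_abs// mule_ge0.
have : f x <= l%:E * c `^ (q x)^-1 by apply: cvge_le cu; exact: nearW.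
have fx0 : 0 <= f x by apply: cvge_ge cu; exact: nearW.
rewrite -lee_pdivrMl// muleC => fl.
have fl0 : 0 <= f x * (l^-1)%:E by rewrite mule_ge0.
have := lee_poweR (ltW (q0 x)) fl0 fl; rewrite -poweRrM mulVf// poweRe1//.
by rewrite gee0_abs.
Qed.

End finite_exponent.

(** Without a supremum part the two modulars agree under the substitution of [l^s] for [l], so the
    identity carries no constant, unlike [var_norm_le_power]. *)
Lemma var_norm_power_fin d (T : measurableType d) (R : realType)
    (mu : {measure set T -> \bar R}) (q : T -> R) (s : R) (f : T -> \bar R) :
  0 < mu setT -> measurable_fun setT q -> (forall x, (0 < q x)%R) -> (0 < s)%R ->
  var_norm_over mu (fun x => (s * q x)%:E) f =
  var_norm_over mu (EFin \o q) (fun x => `|f x| `^ s) `^ s^-1.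
Proof.
move=> mu_gt0 mq q0 s0; have si0 : (0 < s^-1)%R by rewrite invr_gt0.
have sN0 : s != 0%R by rewrite gt_eqF.
have E (l : R) : (0 < l)%R -> modular_over mu (fun x => (s * q x)%:E) (fun x => f x * (l^-1)%:E) =
    modular_over mu (EFin \o q) (fun x => `|f x| `^ s * ((l `^ s)^-1)%:E).
  move=> l0; rewrite (@modular_fin _ _ _ _ mu_gt0 (fun x => s * q x)%R) modular_fin//.
  apply: eq_integral => x _.
  by rewrite abse_pow_scale// [in RHS]gee0_abs ?poweR_ge0// poweRrM.
apply/eqP; rewrite eq_le; apply/andP; split.
  rewrite -[leRHS]mul1e; apply: var_norm_le_pow => //; first exact: var_norm_ge0.
  move=> l l0 fl; rewrite mul1r; have ls0 : (0 < l `^ s^-1)%R by rewrite powR_gt0.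
  apply: var_norm_le => //; rewrite E// -powRrM mulVf// powRr1//; exact: ltW.
have -> : var_norm_over mu (fun x => (s * q x)%:E) f =
    (var_norm_over mu (fun x => (s * q x)%:E) f `^ s) `^ s^-1.
  by rewrite -poweRrM divff// poweRe1// var_norm_ge0.
apply: lee_poweR; [exact: ltW|exact: var_norm_ge0|].
rewrite -[leRHS]mul1e; apply: var_norm_le_pow => //; first exact: var_norm_ge0.
move=> l l0 fl; rewrite mul1r; apply: var_norm_le; first by rewrite powR_gt0.
by rewrite -E.
Qed.

(** * Weighted spaces and duality *)

Definition associate_over d (T : measurableType d) (R : realType)
    (mu : {measure set T -> \bar R}) (X : (T -> \bar R) -> \bar R) (f : T -> \bar R) : \bar R :=
  ereal_sup [set \int[mu]_x `|f x * g x| | g in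
    [set g | (measurable_fun setT g /\ X g < +oo) /\ X g = 1]].

Lemma measurable_hoelder_conjugate d (T : measurableType d) (R : realType) (q : T -> R) :
  measurable_fun setT q -> (forall x, q x != 0%R) ->
  measurable_fun setT (fun x => hoelder_conjugate (q x)%:E).
Proof.
(* [q x - 1] may be negative, so its reciprocal is written as [y (y^2)^(-1)], a power with
   nonnegative base. *)
move=> mq q0; rewrite (_ : (fun _ => _) = fun x => if q x == 1%R then +oo else
  (q x * ((q x - 1) * ((q x - 1) ^+ 2) `^ (-1)))%:E); last first.
  apply/funext => x; case: eqVneq => [->|q1]; first exact: hoelder_conjugate1.
  have q10 : (q x - 1 != 0)%R by rewrite subr_eq0.
  rewrite /hoelder_conjugate/= eqe (negbTE (q0 x)) -EFinB inver (negbTE q10) -EFinM.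
  by congr EFin; rewrite powR_inv1 ?sqr_ge0//; congr (_ * _)%R; field.
apply: measurable_fun_ifT (measurable_cst _) _.
  exact: measurable_fun_eqr mq (measurable_cst _).
have mq1 : measurable_fun setT (fun x => q x - 1)%R.
  exact: measurable_funB mq (measurable_cst _).
apply/measurable_EFinP; apply: (measurable_funM mq); apply: (measurable_funM mq1).
exact: measurable_powR2 (measurable_funX 2 mq1) (measurable_cst _).
Qed.

(** Both sides are integrals for the counting measure, which allows an infinite [c]. *)
Lemma nneseriesMr (R : realType) (a : nat -> \bar R) (c : \bar R) :
  (forall j, 0 <= a j) -> 0 <= c ->
  (\sum_(0 <= j <oo) a j) * c = \sum_(0 <= j <oo) (a j * c).
Proof.
move=> a0 c0; rewrite -ge0_integral_count// -ge0_integral_count; last first.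
  by move=> j; rewrite mule_ge0.
by rewrite ge0_integralZr.
Qed.

Section weighted.
Context {d : measure_display} {T : measurableType d} {R : realType}.
Variable mu : {measure set T -> \bar R}.
Hypothesis mu_gt0 : 0 < mu setT.
Variables (q v : T -> R).
Hypotheses (mq : measurable_fun setT q) (mv : measurable_fun setT v).
Hypotheses (q1 : forall x, (1 <= q x)%R) (v0 : forall x, (0 < v x)%R).
Implicit Types f g : T -> \bar R.

Definition weighted (v : T -> R) f x := f x * (v x)%:E.

Definition wnorm f : \bar R := var_norm_over mu (EFin \o q) (weighted v f).

Definition dual_exponent x : \bar R := hoelder_conjugate (q x)%:E.

Definition dual_weight x : R := (v x)^-1%R.

Definition dual_wnorm f : \bar R := var_norm_over mu dual_exponent (weighted dual_weight f).

Let q0 x : (0 < q x)%R. Proof. exact: lt_le_trans (q1 x). Qed.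
Let qe1 x : 1 <= (EFin \o q) x. Proof. by rewrite lee_fin. Qed.
Let qe0 x : 0 <= (EFin \o q) x. Proof. by rewrite lee_fin ltW. Qed.
Let mqe : measurable_fun setT (EFin \o q). Proof. exact/measurable_EFinP. Qed.

Lemma dual_weight_gt0 x : (0 < dual_weight x)%R.
Proof. by rewrite invr_gt0. Qed.

Lemma measurable_dual_weight : measurable_fun setT dual_weight.
Proof.
rewrite (_ : dual_weight = fun x => (v x `^ (-1))%R); last first.
  by apply/funext => x; rewrite powR_inv1// ltW.
exact: measurable_powR2 mv (measurable_cst _).
Qed.

Lemma measurable_weighted u f : measurable_fun setT u -> measurable_fun setT f ->
  measurable_fun setT (weighted u f).
Proof. by move=> mu' mf; apply: emeasurable_funM mf _; exact/measurable_EFinP. Qed.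

Let mwf f : measurable_fun setT f -> measurable_fun setT (weighted v f).
Proof. exact: measurable_weighted. Qed.

Lemma measurable_dual_exponent : measurable_fun setT dual_exponent.
Proof. by apply: measurable_hoelder_conjugate mq _ => x; rewrite gt_eqF. Qed.

Lemma dual_exponent_ge1 x : 1 <= dual_exponent x.
Proof. by apply: hoelder_conj_ge1; rewrite lee_fin. Qed.

Lemma wnorm_ge0 f : 0 <= wnorm f. Proof. exact: var_norm_ge0. Qed.

Lemma wnorm_fin_num f : measurable_fun setT f -> wnorm f < +oo ->
  {ae mu, forall x, f x \is a fin_num}.
Proof.
move=> mf /(var_norm_fin_num mu_gt0 mq q0 (mwf mf)); apply: filterS => x.
rewrite /weighted; case: (f x) => //; first by rewrite gt0_mulye ?lte_fin.
by rewrite gt0_mulNye ?lte_fin.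
Qed.

Lemma wnorm_eq0 f : measurable_fun setT f -> wnorm f = 0 -> {ae mu, forall x, f x = 0}.
Proof.
move=> mf /(var_norm_eq0 mu_gt0 mq q0 q1 (mwf mf)); apply: filterS => x /eqP.
by rewrite mule_eq0 => /orP[/eqP//|]; rewrite eqe gt_eqF.
Qed.

Lemma ae_le_wnorm f g : measurable_fun setT f -> measurable_fun setT g ->
  {ae mu, forall x, `|g x| <= `|f x|} -> wnorm g <= wnorm f.
Proof.
move=> mf mg gf; apply: ae_le_var_norm => //; [exact: mwf..|].
by apply: filterS gf => x gf; rewrite !abseM lee_wpmul2r.
Qed.

Lemma wnorm0 : wnorm (cst 0) = 0.
Proof.
apply/eqP; rewrite eq_le wnorm_ge0 andbT; apply/lee_addgt0Pr => e e0; rewrite add0e.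
apply: var_norm_le => //; rewrite modular_fin//.
under eq_integral => x _ do rewrite /weighted !mul0e abse0 poweR0r ?gt_eqF//.
by rewrite integral0.
Qed.

Lemma wnorm_scale (a : R) f : measurable_fun setT f ->
  wnorm (fun x => a%:E * f x) = `|a|%:E * wnorm f.
Proof.
move=> mf; have [->|aN0] := eqVneq a 0%R.
  rewrite normr0 mul0e -[RHS]wnorm0; congr wnorm.
  by apply/funext => x; rewrite mul0e.
have a0 : (0 < `|a|)%R by rewrite normr_gt0.
rewrite -var_norm_scale//; apply: ae_eq_var_norm => //.
- by apply: mwf; exact: measurable_funeM.
- exact: measurable_scaler _ (mwf mf).
- exact: nearW.
- by apply: nearW => x; rewrite /weighted !abseM !abse_EFin normr_id -muleA [RHS]muleC.
Qed.

Lemma wnorm_triangle f g : measurable_fun setT f -> measurable_fun setT g ->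
  wnorm f < +oo -> wnorm g < +oo -> wnorm (f \+ g) <= wnorm f + wnorm g.
Proof.
move=> mf mg Nf Ng.
apply: le_trans (var_norm_triangle mu_gt0 mq q0 q1 (mwf mf) (mwf mg) Nf Ng).
apply: ae_le_var_norm => //.
- by apply: mwf; exact: emeasurable_funD.
- by apply: emeasurable_funD; exact: mwf.
apply: filterS2 (wnorm_fin_num mf Nf) (wnorm_fin_num mg Ng) => x fx gx.
by rewrite /weighted/= muleDl// fin_num_adde_defl.
Qed.

Lemma wnorm_fatou (u : nat -> T -> \bar R) f :
  (forall m, measurable_fun setT (u m)) -> measurable_fun setT f ->
  {ae mu, forall x, [/\ forall m, 0 <= u m x,
    nondecreasing_seq (fun m => u m x) & u m x @[m --> \oo] --> f x]} ->
  nondecreasing_seq (fun m => wnorm (u m)) /\ wnorm (u m) @[m --> \oo] --> wnorm f.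
Proof.
move=> mum mf uf; apply: (var_norm_fatou mu_gt0 mq q0 (u := fun m => weighted v (u m))).
- by move=> m; exact: mwf.
- exact: mwf.
apply: filterS uf => x [u0 ndu cu]; split.
- by move=> m; rewrite mule_ge0// lee_fin ltW.
- by move=> m m' mm'; rewrite lee_wpmul2r ?lee_fin ?(ltW (v0 x))//; exact: ndu.
- by apply: cvgeZr => //; exact: cu.
Qed.

Let qq' x : dual_exponent x = hoelder_conjugate ((EFin \o q) x). Proof. by []. Qed.

Lemma dual_exponentK x : (EFin \o q) x = hoelder_conjugate (dual_exponent x).
Proof. by rewrite /dual_exponent hoelder_conjugateK. Qed.

Lemma wnorm_hoelder f g (b : R) : measurable_fun setT f -> measurable_fun setT g ->
  (0 < b)%R -> dual_wnorm g < b%:E ->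
  \int[mu]_x `|f x * g x| <= (2 * b)%:E * wnorm f.
Proof.
move=> mf mg b0 gb.
have := var_norm_hoelder mu_gt0 mqe measurable_dual_exponent qe1 qq' (mwf mf)
  (measurable_weighted measurable_dual_weight mg) b0 gb.
apply: le_trans; rewrite le_eqVlt; apply/orP; left; apply/eqP.
apply: eq_integral => x _; congr abse.
by rewrite /weighted muleACA -EFinM mulfV ?mule1// gt_eqF.
Qed.

Lemma associate_le_dual_wnorm g : measurable_fun setT g ->
  associate_over mu wnorm g <= 2%:E * dual_wnorm g.
Proof.
move=> mg; have g0 : 0 <= dual_wnorm g by exact: var_norm_ge0.
apply: ge_ereal_sup => _ [f [[mf _] f1] <-].
have [->|goo] := eqVneq (dual_wnorm g) +oo; first by rewrite gt0_muley ?leey.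
have gf : dual_wnorm g \is a fin_num by rewrite ge0_fin_numE// ltey.
apply/lee_addgt0Pr => e e0; pose b := (fine (dual_wnorm g) + e / 2)%R.
have b0 : (0 < b)%R by rewrite ltr_wpDl ?fine_ge0// divr_gt0.
have gb : dual_wnorm g < b%:E by rewrite EFinD fineK// lteDl// lte_fin divr_gt0.
have := wnorm_hoelder mf mg b0 gb; rewrite f1 mule1.
under eq_integral do rewrite muleC.
move=> /le_trans; apply; rewrite -(fineK gf) -EFinM -EFinD lee_fin /b.
by rewrite le_eqVlt; apply/orP; left; apply/eqP; field.
Qed.

Variable E : nat -> set T.
Hypotheses (mE : forall N, measurable (E N)) (ndE : nondecreasing_seq E).
Hypotheses (Efin : forall N, mu (E N) < +oo) (Ecover : forall x, exists N, E N x).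

Lemma wnorm_dual f (A : R) : measurable_fun setT f -> (forall x, 0 <= f x) -> (0 <= A)%R ->
  (forall phi, measurable_fun setT phi -> (forall x, 0 <= phi x) ->
    dual_wnorm phi <= 1 -> \int[mu]_x (f x * phi x) <= A%:E) ->
  wnorm f <= (4 * A)%:E.
Proof.
move=> mf f0 A0 H.
have vv0 x : 0 <= (v x)%:E by rewrite lee_fin ltW.
apply: (var_norm_dual mu_gt0 mqe measurable_dual_exponent qe1 qq' mE ndE Efin Ecover (mwf mf)).
- by move=> x; rewrite mule_ge0.
- exact: A0.
move=> phi mphi phi0 phi1.
have := H (weighted v phi) (mwf mphi) (fun x => mule_ge0 (phi0 x) (vv0 x)).
have -> : \int[mu]_x (f x * weighted v phi x) = \int[mu]_x (weighted v f x * phi x).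
  by apply: eq_integral => x _; rewrite /weighted muleCA muleC -muleA [_ * phi x]muleC.
apply; apply: var_norm_le => //; rewrite (_ : (fun _ => _) = phi)//.
by apply/funext => x; rewrite /weighted invr1 mule1 -muleA -EFinM mulfV ?mule1// gt_eqF.
Qed.

(** The converse of Hoelder's inequality with [q] and its conjugate exchanged. A function of
    positive finite norm makes the unit sphere nonempty; otherwise the supremum defining the
    associate norm would be [-oo]. *)
Lemma dual_wnorm_le_associate g : measurable_fun setT g ->
  (exists f, [/\ measurable_fun setT f, 0 < wnorm f & wnorm f < +oo]) ->
  associate_over mu wnorm g < +oo ->
  dual_wnorm g <= 4%:E * associate_over mu wnorm g.
Proof.
move=> mg [f0 [mf0 f00 f0oo]] goo.
have key f : measurable_fun setT f -> wnorm f < +oo -> 0 < wnorm f ->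
    \int[mu]_x `|g x * f x| <= associate_over mu wnorm g * wnorm f.
  move=> mf foo f_gt0; have ff : wnorm f \is a fin_num by rewrite ge0_fin_numE// wnorm_ge0.
  pose c := fine (wnorm f); have cE : wnorm f = c%:E by rewrite fineK.
  have c0 : (0 < c)%R by rewrite -lte_fin -cE.
  pose h x := (c^-1)%:E * f x.
  have mh : measurable_fun setT h by exact: measurable_funeM.
  have h1 : wnorm h = 1.
    by rewrite wnorm_scale// cE -EFinM ger0_norm ?invr_ge0 ?(ltW c0)// mulVf// gt_eqF.
  have : \int[mu]_x `|g x * h x| <= associate_over mu wnorm g.
    by apply: ereal_sup_ubound; exists h => //; split; rewrite ?h1 ?ltry.
  rewrite (_ : (fun x => `|g x * h x|) = (fun x => (c^-1)%:E * `|g x * f x|)); last first.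
    apply/funext => x; rewrite /h muleCA abseM; congr (_ * _).
    by rewrite gee0_abs// lee_fin invr_ge0 ltW.
  rewrite ge0_integralZl_EFin//; last 2 first.
  - by apply: measurableT_comp (@abse_measurable R setT) _; exact: emeasurable_funM.
  - by rewrite invr_ge0 ltW.
  by rewrite lee_pdivrMl// cE muleC.
have A0 : 0 <= associate_over mu wnorm g.
  have f0f : wnorm f0 \is a fin_num by rewrite ge0_fin_numE// wnorm_ge0.
  rewrite -(@pmule_lge0 _ (wnorm f0))//.
  by apply: le_trans (key f0 mf0 f0oo f00); exact: integral_ge0.
have Af : associate_over mu wnorm g \is a fin_num by rewrite ge0_fin_numE.
pose A := fine (associate_over mu wnorm g).
have AE : associate_over mu wnorm g = A%:E by rewrite fineK.
rewrite AE -EFinM.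
have vv0 x : 0 <= (dual_weight x)%:E by rewrite lee_fin ltW// dual_weight_gt0.
have mdg : measurable_fun setT (weighted dual_weight g).
  exact: measurable_weighted measurable_dual_weight mg.
have -> : dual_wnorm g = var_norm_over mu dual_exponent (fun x => `|weighted dual_weight g x|).
  apply: ae_eq_var_norm => //; first exact: measurable_dual_exponent.
  - exact: measurable_dual_exponent.
  - exact: measurableT_comp (@abse_measurable R setT) mdg.
  - exact: nearW.
  - by apply: nearW => x; rewrite abse_id.
apply: (var_norm_dual mu_gt0 measurable_dual_exponent mqe dual_exponent_ge1 dual_exponentK
  mE ndE Efin Ecover).
- exact: measurableT_comp (@abse_measurable R setT) mdg.
- by [].
- by rewrite -lee_fin -AE.
move=> phi mphi phi0 phi1; pose f := weighted dual_weight phi.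
have mf : measurable_fun setT f by exact: measurable_weighted measurable_dual_weight mphi.
have f1 : wnorm f <= 1.
  apply: var_norm_le => //; rewrite (_ : (fun _ => _) = phi)//.
  apply/funext => x; rewrite /f /weighted invr1 mule1 -muleA -EFinM mulVf ?mule1//.
  by rewrite gt_eqF.
have -> : \int[mu]_x (`|weighted dual_weight g x| * phi x) = \int[mu]_x `|g x * f x|.
  apply: eq_integral => x _; rewrite /f /weighted -[X in _ * X]gee0_abs// -abseM.
  by congr abse; rewrite -!muleA [_%:E * _]muleC.
(* A test function of norm 0 cannot be normalised, but it vanishes almost everywhere. *)
have [f_eq0|f_neq0] := eqVneq (wnorm f) 0.
  rewrite -AE; apply: le_trans A0; rewrite le_eqVlt; apply/orP; left; apply/eqP.
  apply/(ae_eq_integral_abs mu measurableT); first exact: emeasurable_funM.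
  by apply: filterS (wnorm_eq0 mf f_eq0) => x -> _; rewrite mule0.
have f_gt0 : 0 < wnorm f by rewrite lt0e f_neq0 wnorm_ge0.
apply: le_trans (key f mf (le_lt_trans f1 (ltry _)) f_gt0) _.
by rewrite AE -[leRHS]mule1 lee_wpmul2l// -AE.
Qed.

(** * The maximal operator on the dual space *)

Variables (K : R) (B : T -> R -> set T).
Hypothesis DB : doubling_balls mu K B.
Local Notation maximal := (maximal_over mu B).

Variable k : R.
Hypothesis k1 : (1 <= k)%R.

(** The functional of the hypothesis on [k]. It is applied below only to [|f|^k] and its maximal
    function. *)
Definition power_dual_wnorm f : \bar R :=
  var_norm_over mu (fun x => dual_exponent x * (k^-1)%:E)
    (weighted (fun x => dual_weight x `^ k)%R f).

Hypothesis maximal_bounded : exists2 C : R, (0 < C)%R & forall f, measurable_fun setT f ->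
  power_dual_wnorm f < +oo -> power_dual_wnorm (maximal f) <= C%:E * power_dual_wnorm f.

Let k0 : (0 < k)%R. Proof. exact: lt_le_trans k1. Qed.

Lemma power_dual_wnormE f : measurable_fun setT f ->
  power_dual_wnorm (fun x => `|f x| `^ k) =
  var_norm_over mu (fun x => dual_exponent x * (k^-1)%:E)
    (fun x => `|weighted dual_weight f x| `^ k).
Proof.
move=> mf; congr var_norm_over; apply/funext => x; rewrite /weighted abseM.
rewrite poweRM// (_ : `|(dual_weight x)%:E| = (dual_weight x)%:E) ?poweR_EFin//.
by rewrite gee0_abs// lee_fin ltW// dual_weight_gt0.
Qed.

(** The constant collects [2^(1/t)] from the pointwise comparison, 2 from [var_norm_le_power], and
    [C^(1/k)] from the hypothesis on [M(|f|^k)] after a [k]-th root. *)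
Lemma dual_wnorm_maximal_pow (t : R) : (0 < t)%R -> (t <= k)%R ->
  exists2 C : R, (0 < C)%R & forall f, measurable_fun setT f ->
  dual_wnorm (fun x => maximal (fun y => `|f y| `^ t) x `^ t^-1) <= C%:E * dual_wnorm f.
Proof.
move=> t0 tk; have [C C0 HC] := maximal_bounded.
have tt0 : (0 < 2 `^ t^-1 :> R)%R by rewrite powR_gt0.
have Ck0 : (0 < C `^ k^-1)%R by rewrite powR_gt0.
have ki0 : (0 <= k^-1)%R by rewrite invr_ge0 ltW.
exists (2 `^ t^-1 * (2 * C `^ k^-1))%R; first by rewrite !mulr_gt0.
move=> f mf; have [foo|foo] := eqVneq (dual_wnorm f) +oo.
  by rewrite foo gt0_muley ?leey// lte_fin !mulr_gt0.
have N0 : 0 <= dual_wnorm f by exact: var_norm_ge0.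
have mdw := measurable_dual_weight.
have mde := measurable_dual_exponent.
have mpow (r : R) (h : T -> \bar R) : measurable_fun setT h ->
    measurable_fun setT (fun x => h x `^ r).
  by move=> mh; exact: (measurableT_comp (measurable_poweR r)).
pose F x := maximal (fun y => `|f y| `^ k) x `^ k^-1.
have mF : measurable_fun setT F by apply: mpow; exact: measurable_maximal DB _.
have F0 x : 0 <= F x by exact: poweR_ge0.
have step1 : dual_wnorm (fun x => maximal (fun y => `|f y| `^ t) x `^ t^-1) <=
    (2 `^ t^-1)%:E * dual_wnorm F.
  rewrite -var_norm_scale//; apply: ae_le_var_norm => //.
  - by apply: measurable_weighted mdw _; apply: mpow; exact: measurable_maximal DB _.
  - by apply: measurable_scaler; exact: measurable_weighted.
  - by move=> x; apply: le_trans (dual_exponent_ge1 x).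
  apply: nearW => x; rewrite /weighted muleAC abseM [leRHS]abseM lee_wpmul2r//.
  rewrite gee0_abs ?poweR_ge0// gee0_abs; last by rewrite mule_ge0// lee_fin ltW.
  by rewrite muleC; exact: (maximal_over_pow_le DB).
have MFE : (fun x => `|F x| `^ k) = maximal (fun y => `|f y| `^ k).
  apply/funext => x; rewrite gee0_abs// /F -poweRrM mulVf ?gt_eqF// poweRe1//.
  exact: (maximal_ge0 DB).
have step2 : dual_wnorm F <= 2%:E * power_dual_wnorm (maximal (fun y => `|f y| `^ k)) `^ k^-1.
  rewrite -MFE power_dual_wnormE//; apply: var_norm_le_power => //.
  - exact: dual_exponent_ge1.
  - exact: measurable_weighted.
have step3 : power_dual_wnorm (fun y => `|f y| `^ k) <= dual_wnorm f `^ k.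
  rewrite power_dual_wnormE//; apply: var_norm_pow_le => //.
  - exact: dual_exponent_ge1.
  - exact: measurable_weighted.
have step4 : power_dual_wnorm (maximal (fun y => `|f y| `^ k)) <= C%:E * dual_wnorm f `^ k.
  apply: le_trans (HC _ _ _) _.
  - exact: measurable_abse_pow.
  - by apply: le_lt_trans step3 _; rewrite poweR_lty// ltey.
  - by rewrite lee_wpmul2l// lee_fin ltW.
apply: (le_trans step1); rewrite EFinM -muleA lee_wpmul2l ?lee_fin ?(ltW tt0)//.
apply: (le_trans step2); rewrite EFinM -muleA lee_wpmul2l//.
have := lee_poweR ki0 (var_norm_ge0 _ _ _) step4.
rewrite poweRM ?poweR_ge0 ?lee_fin ?(ltW C0)// poweR_EFin -poweRrM divff ?gt_eqF//.
by rewrite poweRe1.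
Qed.

Lemma associate_maximal_pow (t : R) : (0 < t)%R -> (t <= k)%R ->
  (exists f, [/\ measurable_fun setT f, 0 < wnorm f & wnorm f < +oo]) ->
  exists2 C : R, (0 < C)%R & forall f, measurable_fun setT f ->
  associate_over mu wnorm f < +oo ->
  associate_over mu wnorm (fun x => maximal (fun y => `|f y| `^ t) x `^ t^-1) <=
  C%:E * associate_over mu wnorm f.
Proof.
move=> t0 tk ex; have [C C0 HC] := dual_wnorm_maximal_pow t0 tk.
(* 2 and 4 compare the associate norm with [dual_wnorm], one in each direction. *)
exists (2 * (C * 4))%R; first by rewrite !mulr_gt0.
move=> f mf foo; apply: le_trans (associate_le_dual_wnorm _) _.
  apply: (measurableT_comp (measurable_poweR t^-1)); exact: measurable_maximal DB _.
rewrite EFinM -muleA lee_wpmul2l//; apply: le_trans (HC f mf) _.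
rewrite EFinM -muleA lee_wpmul2l ?lee_fin ?(ltW C0)//.
exact: dual_wnorm_le_associate.
Qed.

(* Testing against [phi] in the dual ball moves the maximal operator from [u] to
   [phi] by the weighted inequality [fefferman_stein], summed over [j]. *)
Lemma wnorm_maximal_vector (r : R) : (1 < r)%R ->
  exists2 C : R, (0 < C)%R & forall u : nat -> T -> \bar R,
  (forall j, measurable_fun setT (u j)) -> (forall j x, 0 <= u j x) ->
  wnorm (fun x => \sum_(0 <= j <oo) maximal (u j) x `^ r) <=
  C%:E * wnorm (fun x => \sum_(0 <= j <oo) u j x `^ r).
Proof.
move=> r1; have [C1 C10 FS] := fefferman_stein DB r1.
(* The case [t = 1]: the maximal operator itself is bounded on the dual space. *)
have [C2 C20 HC2] := dual_wnorm_maximal_pow ltr01 k1.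
(* 4 comes from [wnorm_dual] and 2 from [wnorm_hoelder], which asks for a bound strictly above the
   norm of [maximal phi], hence [C2 + 1]. *)
exists (4 * (C1 * (2 * (C2 + 1))))%R; first by rewrite !mulr_gt0// addr_gt0.
move=> u mu_ u0.
have mpow (h : T -> \bar R) : measurable_fun setT h ->
    measurable_fun setT (fun x => h x `^ r).
  by move=> mh; exact: (measurableT_comp (measurable_poweR r)).
pose G x := \sum_(0 <= j <oo) u j x `^ r.
pose F x := \sum_(0 <= j <oo) maximal (u j) x `^ r.
have G0 x : 0 <= G x by apply: nneseries_ge0 => j _ _; exact: poweR_ge0.
have F0 x : 0 <= F x by apply: nneseries_ge0 => j _ _; exact: poweR_ge0.
have mG : measurable_fun setT G.
  by apply: ge0_emeasurable_sum => j *; [exact: poweR_ge0|exact: mpow].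
have mM j : measurable_fun setT (maximal (u j)) by exact: measurable_maximal DB _.
have mF : measurable_fun setT F.
  by apply: ge0_emeasurable_sum => j *; [exact: poweR_ge0|exact: mpow].
rewrite -/(wnorm F) -/(wnorm G); have [Goo|Goo] := eqVneq (wnorm G) +oo.
  by rewrite Goo gt0_muley ?leey// lte_fin !mulr_gt0// addr_gt0.
have Gf : wnorm G \is a fin_num by rewrite ge0_fin_numE ?wnorm_ge0// ltey.
pose g := fine (wnorm G); have gE : wnorm G = g%:E by rewrite fineK.
have g0 : (0 <= g)%R by rewrite -lee_fin -gE wnorm_ge0.
rewrite gE -EFinM -mulrA; apply: wnorm_dual => //.
  by rewrite !mulr_ge0// ?(ltW C10)// addr_ge0// ltW.
move=> phi mphi phi0 phi1.
have mMphi : measurable_fun setT (maximal phi) by exact: measurable_maximal DB _.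
have Mphi0 x : 0 <= maximal phi x by exact: (maximal_ge0 DB).
apply: (@le_trans _ _ (C1%:E * \int[mu]_x (G x * maximal phi x))).
  apply: (@le_trans _ _ (\int[mu]_x \sum_(0 <= j <oo) (maximal (u j) x `^ r * phi x))).
    rewrite (eq_integral (fun x => \sum_(0 <= j <oo) (maximal (u j) x `^ r * phi x)))//.
    by move=> x _; rewrite nneseriesMr// => j; exact: poweR_ge0.
  rewrite integral_nneseries//; last 2 first.
  - by move=> j; apply: emeasurable_funM => //; exact: mpow.
  - by move=> j x _; rewrite mule_ge0 ?poweR_ge0.
  apply: (@le_trans _ _ (\sum_(0 <= j <oo) (C1%:E * \int[mu]_x (u j x `^ r * maximal phi x)))).
    apply: lee_nneseries => [j _ _|j _].
      by apply: integral_ge0 => x _; rewrite mule_ge0 ?poweR_ge0.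
    by under [X in _ <= _ * X]eq_integral do rewrite -[u j _]gee0_abs//; exact: FS.
  rewrite nneseriesZl; last first.
    by move=> j _; apply: integral_ge0 => x _; rewrite mule_ge0 ?poweR_ge0.
  rewrite lee_wpmul2l ?lee_fin ?(ltW C10)//.
  rewrite -integral_nneseries//; last 2 first.
  - by move=> j; apply: emeasurable_funM => //; exact: mpow.
  - by move=> j x _; rewrite mule_ge0 ?poweR_ge0.
  rewrite (eq_integral (fun x => G x * maximal phi x))//.
  by move=> x _; rewrite /G nneseriesMr// => j; exact: poweR_ge0.
rewrite -(mulrA C1) EFinM lee_wpmul2l ?lee_fin ?(ltW C10)//.
have C21 : (0 < C2 + 1)%R by rewrite addr_gt0.
have Mphi1 : dual_wnorm (maximal phi) < (C2 + 1)%:E.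
  apply: (@le_lt_trans _ _ C2%:E); last by rewrite lte_fin ltrDl.
  have := HC2 phi mphi.
  rewrite (_ : (fun x => maximal (fun y => `|phi y| `^ 1) x `^ 1^-1) = maximal phi).
    by move=> /le_trans; apply; rewrite -[leRHS]mule1 lee_wpmul2l// lee_fin ltW.
  apply/funext => x; rewrite invr1 poweRe1; last exact: (maximal_ge0 DB).
  by congr (maximal _ x); apply/funext => y; rewrite poweRe1// gee0_abs.
have := wnorm_hoelder mG mMphi C21 Mphi1; rewrite gE -EFinM.
apply: le_trans; rewrite le_eqVlt; apply/orP; left; apply/eqP.
by apply: eq_integral => x _; rewrite gee0_abs// mule_ge0.
Qed.

End weighted.

(** * The convexified space and its associate *)

Section regular_representatives.
Context {d : measure_display} {T : measurableType d} {R : realType}.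
Variable mu : {measure set T -> \bar R}.
Hypothesis mu_gt0 : 0 < mu setT.
Variables (p : T -> R) (w : T -> \bar R).
Hypotheses (mp : measurable_fun setT p) (p0 : forall x, (0 < p x)%R).
Hypotheses (mw : measurable_fun setT w) (w0 : {ae mu, forall x, 0 < w x < +oo}).
Implicit Types f : T -> \bar R.

(* Replacing [w] and [s p] by representatives that are positive and finite, resp.
   at least [1], everywhere removes the almost-everywhere hypotheses. *)
Definition pos_weight x : R := if 0 < w x < +oo then fine (w x) else 1%R.

Definition clipped_exponent (s : R) x : R := Num.max (s * p x)%R 1%R.

Definition root_weight (s : R) x : R := (pos_weight x `^ s^-1)%R.

Lemma pos_weight_gt0 x : (0 < pos_weight x)%R.
Proof. by rewrite /pos_weight; case: ifPn => // /fine_gt0. Qed.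

Lemma measurable_pos_weight : measurable_fun setT pos_weight.
Proof.
apply: measurable_fun_ifT (measurable_cst _).
  apply: measurable_and; first exact: measurable_fun_lte (measurable_cst _) mw.
  exact: measurable_fun_lte mw (measurable_cst _).
exact: measurableT_comp (fine_measurable measurableT) mw.
Qed.

Lemma ae_pos_weight : {ae mu, forall x, w x = (pos_weight x)%:E}.
Proof.
apply: filterS w0 => x wx; rewrite /pos_weight wx fineK//.
by case/andP: wx => wx0 wxoo; rewrite ge0_fin_numE// ltW.
Qed.

Variable s : R.
Hypotheses (s0 : (0 < s)%R) (sp1 : {ae mu, forall x, (1 <= s * p x)%R}).
Local Notation q := (clipped_exponent s).
Local Notation v := (root_weight s).

Lemma clipped_exponent_ge1 x : (1 <= q x)%R.
Proof. by rewrite le_max lexx orbT. Qed.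

Lemma measurable_clipped_exponent : measurable_fun setT q.
Proof.
apply: measurable_maxr (measurable_cst _).
exact: measurable_funM (measurable_cst _) mp.
Qed.

Lemma root_weight_gt0 x : (0 < v x)%R.
Proof. by rewrite powR_gt0// pos_weight_gt0. Qed.

Lemma measurable_root_weight : measurable_fun setT v.
Proof. exact: measurable_powR2 measurable_pos_weight (measurable_cst _). Qed.

Lemma ae_clipped_exponent : {ae mu, forall x, q x = (s * p x)%R}.
Proof. by apply: filterS sp1 => x spx; exact/max_idPl. Qed.

Let mv := measurable_root_weight.
Let mq := measurable_clipped_exponent.

Let msp : measurable_fun setT (fun x => s * p x)%R.
Proof. exact: measurable_funM (measurable_cst _) mp. Qed.

Let msc : measurable_fun setT (fun x => hoelder_conjugate (s * p x)%:E).
Proof. by apply: measurable_hoelder_conjugate => // x; rewrite mulf_neq0 ?gt_eqF. Qed.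

Lemma wnorm_power f : measurable_fun setT f ->
  var_norm_over mu (EFin \o p) (fun x => `|f x| `^ s * w x) = wnorm mu q v f `^ s.
Proof.
move=> mf; have -> : wnorm mu q v f = var_norm_over mu (fun x => (s * p x)%:E) (weighted v f).
  apply: ae_eq_var_norm => //.
  - exact/measurable_EFinP.
  - exact/measurable_EFinP.
  - exact: measurable_weighted.
  - exact: measurable_weighted.
  - by apply: filterS ae_clipped_exponent => x /= ->.
  - exact: nearW.
rewrite var_norm_power_fin// -poweRrM mulVf ?gt_eqF// poweRe1 ?var_norm_ge0//.
apply: ae_eq_var_norm => //.
- exact/measurable_EFinP.
- exact/measurable_EFinP.
- by apply: emeasurable_funM mw; exact: measurable_abse_pow.
- by apply: measurable_abse_pow; exact: measurable_weighted.
- exact: nearW.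
apply: filterS ae_pos_weight => x ->; rewrite /weighted [in RHS]abseM [in RHS]poweRM//.
rewrite (_ : `|(v x)%:E| = (v x)%:E); last by rewrite gee0_abs// lee_fin ltW// root_weight_gt0.
by rewrite poweR_EFin /root_weight -powRrM mulVf ?gt_eqF// powRr1// ltW// pos_weight_gt0.
Qed.

Lemma ae_dual_exponent : {ae mu, forall x, hoelder_conjugate (s * p x)%:E = dual_exponent q x}.
Proof. by apply: filterS ae_clipped_exponent => x; rewrite /dual_exponent => ->. Qed.

Lemma ae_dual_weight (k : R) :
  {ae mu, forall x, w x `^ (- (k / s)) = ((dual_weight v x) `^ k)%:E}.
Proof.
apply: filterS ae_pos_weight => x ->; rewrite poweR_EFin; congr EFin.
rewrite /dual_weight /root_weight -(powR_inv1 (powR_ge0 _ _)) -!powRrM.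
by congr (_ `^ _)%R; ring.
Qed.

Let mwpow (r : R) : measurable_fun setT (fun x => w x `^ r).
Proof. exact: (measurableT_comp (measurable_poweR r)). Qed.

Lemma power_dual_wnormP (k : R) f : measurable_fun setT f ->
  var_norm_over mu (fun x => hoelder_conjugate (s * p x)%:E * (k^-1)%:E)
    (fun x => f x * w x `^ (- (k / s))) = power_dual_wnorm mu q v k f.
Proof.
move=> mf; apply: ae_eq_var_norm => //.
- exact: emeasurable_funM msc (measurable_cst _).
- apply: emeasurable_funM (measurable_cst _).
  by apply: measurable_dual_exponent => // x; exact: clipped_exponent_ge1.
- exact: emeasurable_funM.
- apply: measurable_weighted => //; apply: measurable_powR2 (measurable_cst _).
  by apply: measurable_dual_weight => //; exact: root_weight_gt0.
- by apply: filterS ae_dual_exponent => x ->.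
- by apply: filterS (ae_dual_weight k) => x ->.
Qed.

Lemma dual_wnormP f : measurable_fun setT f ->
  var_norm_over mu (fun x => hoelder_conjugate (s * p x)%:E)
    (fun x => f x * w x `^ (- s^-1)) = dual_wnorm mu q v f.
Proof.
move=> mf; apply: ae_eq_var_norm => //.
- by apply: measurable_dual_exponent => // x; exact: clipped_exponent_ge1.
- exact: emeasurable_funM.
- apply: measurable_weighted => //.
  by apply: measurable_dual_weight => //; exact: root_weight_gt0.
- exact: ae_dual_exponent.
- apply: filterS (ae_dual_weight 1) => x; rewrite mul1r => ->.
  by rewrite powRr1// invr_ge0 ltW// root_weight_gt0.
Qed.

End regular_representatives.

(* With [a <= s], the function [|f|^(s/a)] is integrable on [B] by Hoelder's
   inequality with exponent [a p], and [|f| <= 1 + |f|^(s/a)]. *)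
Lemma integral_le_wnorm d (T : measurableType d) (R : realType)
    (mu : {measure set T -> \bar R}) (p : T -> R) (w : T -> \bar R) (a s : R) (B : set T) :
  0 < mu setT ->
  measurable_fun setT p -> (forall x, (0 < p x)%R) ->
  measurable_fun setT w -> {ae mu, forall x, 0 < w x < +oo} ->
  (0 < a)%R -> (a <= s)%R ->
  {ae mu, forall x, (1 <= a * p x)%R} -> {ae mu, forall x, (1 <= s * p x)%R} ->
  measurable B -> mu B < +oo ->
  dual_wnorm mu (clipped_exponent p a) (root_weight w a) (fun x => (\1_B x)%:E) < +oo ->
  exists2 C : R, (0 < C)%R & forall f : T -> \bar R, measurable_fun setT f ->
    wnorm mu (clipped_exponent p s) (root_weight w s) f < +oo ->
    \int[mu]_(x in B) `|f x| <= C%:E * wnorm mu (clipped_exponent p s) (root_weight w s) f.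
Proof.
move=> mu0 mp p0 mw w0 a0 as1 ap1 sp1 mB Boo dB.
have s0 : (0 < s)%R by exact: lt_le_trans as1.
set N := wnorm mu (clipped_exponent p s) (root_weight w s).
set D := dual_wnorm mu _ _ _ in dB.
have D0 : 0 <= D by exact: var_norm_ge0.
have Df : D \is a fin_num by rewrite ge0_fin_numE.
have Bf : mu B \is a fin_num by rewrite ge0_fin_numE.
pose b := (fine D + 1)%R; have b0 : (0 < b)%R by rewrite ltr_wpDl// fine_ge0.
have Db : D < b%:E by rewrite EFinD fineK// lteDl// lte_fin.
have m1B : measurable_fun setT (fun x => (\1_B x)%:E : \bar R).
  by apply/measurable_EFinP; exact: measurable_indic.
(* The inequality [|f| <= 1 + |f|^(s/a)] is not homogeneous, so the bound is proved on the unit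
   sphere and rescaled at the end. *)
have unit f : measurable_fun setT f -> N f = 1 ->
    \int[mu]_(x in B) `|f x| <= (fine (mu B) + 2 * b)%:E.
  move=> mf Nf1; pose F x := `|f x| `^ (s / a).
  have mF : measurable_fun setT F by exact: measurable_abse_pow.
  have F0 x : 0 <= F x by exact: poweR_ge0.
  (* The [a]-th power of this norm and the [s]-th power of [N f] are both the norm of [|f|^s w] with
     exponent [p]. *)
  have NF : wnorm mu (clipped_exponent p a) (root_weight w a) F = 1.
    have := wnorm_power mu0 mp p0 mw w0 a0 ap1 mF.
    rewrite (_ : (fun x => `|F x| `^ a * w x) = (fun x => `|f x| `^ s * w x)); last first.
      by apply/funext => x; rewrite gee0_abs// /F -poweRrM divfK// gt_eqF.
    rewrite wnorm_power// -/N Nf1 poweR1r => /esym H.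
    have N0 := wnorm_ge0 mu (clipped_exponent p a) (root_weight w a) F.
    by rewrite -[LHS](poweRe1 N0) -[in LHS](divff (lt0r_neq0 a0)) poweRrM H poweR1r.
  apply: (@le_trans _ _ (\int[mu]_(x in B) (1 + F x))).
    apply: ge0_le_integral => //.
    - by apply: measurable_funTS; exact: measurableT_comp (@abse_measurable R setT) mf.
    - by apply: measurable_funTS; exact: emeasurable_funD.
    move=> x _; have sa : (0 <= (s / a)^-1 <= 1)%R.
      by rewrite invf_div ler_pdivrMr// mul1r as1 divr_ge0// ltW.
    have := poweR_le_1D sa (F0 x).
    by rewrite /F -poweRrM divff ?poweRe1// gt_eqF// divr_gt0.
  rewrite ge0_integralD//; last exact: measurable_funTS.
  rewrite integral_cst// mul1e EFinD fineK// leeD2l//.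
  have := wnorm_hoelder mu0 (measurable_clipped_exponent mp a) (measurable_root_weight mw a)
    (clipped_exponent_ge1 p a) (root_weight_gt0 w a) mF m1B b0 Db.
  rewrite NF mule1; apply: le_trans.
  rewrite integral_mkcond; apply: ge0_le_integral => //.
  - by move=> x _; rewrite patchE; case: ifP.
  - by apply/(measurable_restrictT _ mB); exact: measurable_funTS.
  - by apply: measurableT_comp (@abse_measurable R setT) _; exact: emeasurable_funM.
  move=> x _; rewrite patchE indicE; case: ifPn => xB; rewrite ?mule1 ?mule0 ?abse0//.
  by rewrite gee0_abs.
exists (fine (mu B) + 2 * b)%R.
  by rewrite ltr_wpDl ?fine_ge0// mulr_gt0.
move=> f mf Nfoo; have Nf0 : 0 <= N f by exact: wnorm_ge0.
have mabs : measurable_fun setT (fun x => `|f x|).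
  exact: measurableT_comp (@abse_measurable R setT) mf.
have mv := measurable_root_weight mw s; have mq := measurable_clipped_exponent mp s.
have q1 := clipped_exponent_ge1 p s; have v0 := root_weight_gt0 w s.
have [N0|NN0] := eqVneq (N f) 0.
  rewrite N0 mule0 le_eqVlt; apply/orP; left; apply/eqP.
  apply/(ae_eq_integral_abs mu mB); first exact: measurable_funTS.
  by apply: filterS (wnorm_eq0 mu0 mq mv q1 v0 mf N0) => x -> _.
have Nff : N f \is a fin_num by rewrite ge0_fin_numE.
pose c := fine (N f); have cE : N f = c%:E by rewrite fineK.
have c0 : (0 < c)%R by rewrite -lte_fin -cE lt0e NN0.
have Ncf : N (fun x => (c^-1)%:E * f x) = 1.
  rewrite /N wnorm_scale// -[wnorm _ _ _ f]/(N f) cE -EFinM ger0_norm ?invr_ge0 ?(ltW c0)//.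
  by rewrite mulVf ?gt_eqF.
have := unit _ (measurable_funeM _ mf) Ncf.
rewrite (eq_integral (fun x => (c^-1)%:E * `|f x|)); last first.
  by move=> x _; rewrite abseM gee0_abs// lee_fin invr_ge0 ltW.
rewrite ge0_integralZl_EFin//; last 2 first.
- exact: measurable_funTS.
- by rewrite invr_ge0 ltW.
by rewrite cE lee_pdivrMl// muleC.
Qed.

Section regular_weight.
Context {d : measure_display} {T : measurableType d} {R : realType}.
Variable mu : {measure set T -> \bar R}.
Hypothesis mu_gt0 : 0 < mu setT.
Variables (p : T -> R) (w : T -> \bar R).
Hypotheses (mp : measurable_fun setT p) (p0 : forall x, (0 < p x)%R).
Hypotheses (mw : measurable_fun setT w) (w0 : {ae mu, forall x, 0 < w x < +oo}).
Implicit Types f : T -> \bar R.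

Let abs_indic (B : set T) (r : R) x : (0 < r)%R -> `|(\1_B x)%:E : \bar R| `^ r = (\1_B x)%:E.
Proof.
move=> r0; rewrite indicE; case: (_ \in _); rewrite ?abse1 ?poweR1r// abse0 poweR0r//.
by rewrite gt_eqF.
Qed.

Let m_indic (B : set T) : measurable B -> measurable_fun setT (fun x => (\1_B x)%:E : \bar R).
Proof. by move=> mB; apply/measurable_EFinP; exact: measurable_indic. Qed.

Lemma dual_wnorm_indic_lty (B : set T) (r : R) : measurable B -> (0 < r)%R ->
  {ae mu, forall x, (1 <= r^-1 * p x)%R} ->
  var_norm_over mu (fun x => hoelder_conjugate (p x / r)%:E)
    (fun x => (\1_B x)%:E * w x `^ (- r)) < +oo ->
  dual_wnorm mu (clipped_exponent p r^-1) (root_weight w r^-1) (fun x => (\1_B x)%:E) < +oo.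
Proof.
move=> mB r0 rp1; have ri0 : (0 < r^-1)%R by rewrite invr_gt0.
rewrite -(dual_wnormP mu_gt0 mp p0 mw w0 ri0 rp1 (m_indic mB)) invrK.
rewrite (_ : (fun x => hoelder_conjugate (p x / r)%:E) =
    fun x => hoelder_conjugate (r^-1 * p x)%:E)//.
by apply/funext => x; rewrite mulrC.
Qed.

Variable s : R.
Hypotheses (s1 : (1 < s)%R) (sp1 : {ae mu, forall x, (1 <= s * p x)%R}).
Local Notation q := (clipped_exponent p s).
Local Notation v := (root_weight w s).

Let s0 : (0 < s)%R. Proof. exact: lt_trans s1. Qed.

(** An indicator equals its positive powers, so its norms for [(p / r, w^r)], [(p, w)] and
    [(s p, w^(1/s))] are powers of one another. *)
Lemma wnorm_indic_lty (B : set T) (r : R) : measurable B -> (0 < r)%R ->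
  var_norm_over mu (fun x => (p x / r)%:E) (fun x => (\1_B x)%:E * w x `^ r) < +oo ->
  wnorm mu q v (fun x => (\1_B x)%:E) < +oo.
Proof.
move=> mB r0 Hr; set N := wnorm _ _ _ _; have N0 : 0 <= N by exact: wnorm_ge0.
rewrite ltey; apply/eqP => Noo.
have := wnorm_power mu_gt0 mp p0 mw w0 s0 sp1 (m_indic mB); rewrite -/N Noo.
rewrite poweRyr ?gt_eqF// (_ : (fun _ => _) = fun x => (\1_B x)%:E * w x); last first.
  by apply/funext => x; rewrite abs_indic.
rewrite (_ : EFin \o p = fun x => (r * (p x / r))%:E); last first.
  by apply/funext => x /=; rewrite mulrC divfK// gt_eqF.
rewrite var_norm_power_fin//; last 2 first.
- by apply: measurable_funM mp _; exact: measurable_cst.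
- by move=> x; rewrite divr_gt0.
rewrite (_ : var_norm_over _ _ _ =
    var_norm_over mu (fun x => (p x / r)%:E) (fun x => (\1_B x)%:E * w x `^ r)).
  apply/eqP; rewrite lt_eqF// poweR_lty//.
have mwr : measurable_fun setT (fun x => w x `^ r).
  exact: (measurableT_comp (measurable_poweR r)).
apply: ae_eq_var_norm => //.
- by apply/measurable_EFinP; apply: measurable_funM mp _; exact: measurable_cst.
- by apply/measurable_EFinP; apply: measurable_funM mp _; exact: measurable_cst.
- by apply: measurable_abse_pow; apply: emeasurable_funM mw; exact: m_indic.
- by apply: emeasurable_funM mwr; exact: m_indic.
- exact: nearW.
apply: filterS w0 => x /andP[wx0 _]; rewrite abseM poweRM// abs_indic// abseM.
by rewrite (gee0_abs (ltW wx0)) !gee0_abs ?poweR_ge0// ?mule_ge0 ?poweR_ge0// lee_fin.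
Qed.

Variables (K : R) (B : T -> R -> set T).
Hypothesis DB : doubling_balls mu K B.
Local Notation maximal := (maximal_over mu B).
Variables (E : nat -> set T) (k : R).
Hypotheses (mE : forall N, measurable (E N)) (ndE : nondecreasing_seq E).
Hypotheses (Efin : forall N, mu (E N) < +oo) (Ecover : forall x, exists N, E N x).
Hypothesis k1 : (1 < k)%R.

Let Nk f := var_norm_over mu (fun x => hoelder_conjugate (s * p x)%:E * (k^-1)%:E)
  (fun x => f x * w x `^ (- (k / s))).

Hypothesis maximal_bounded : exists2 C : R, (0 < C)%R & forall f,
  measurable_fun setT f /\ Nk f < +oo -> Nk (maximal f) <= C%:E * Nk f.

Let power_maximal_bounded : exists2 C : R, (0 < C)%R & forall f, measurable_fun setT f ->
  power_dual_wnorm mu q v k f < +oo ->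
  power_dual_wnorm mu q v k (maximal f) <= C%:E * power_dual_wnorm mu q v k f.
Proof.
have NkE f : measurable_fun setT f -> Nk f = power_dual_wnorm mu q v k f.
  exact: power_dual_wnormP.
have [C C0 HC] := maximal_bounded; exists C => // f mf; rewrite -!NkE//; last first.
  exact: measurable_maximal DB _.
by move=> Nf; exact: HC.
Qed.

Let mq := measurable_clipped_exponent mp s.
Let mv := measurable_root_weight mw s.
Let q1 := clipped_exponent_ge1 p s.
Let v0 := root_weight_gt0 w s.

Lemma convexification_wnorm f : measurable_fun setT f ->
  var_norm_over mu (EFin \o p) (fun x => `|f x| `^ s * w x) `^ s^-1 = wnorm mu q v f.
Proof.
move=> mf; rewrite wnorm_power// -poweRrM divff ?poweRe1 ?wnorm_ge0//.
by rewrite gt_eqF.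
Qed.

Lemma associate_wnorm_maximal_pow (t : R) (c : T) (r : R) : (0 < t)%R -> (t <= k)%R ->
  (0 < r)%R -> wnorm mu q v (fun x => (\1_(B c r) x)%:E) < +oo ->
  exists2 C : R, (0 < C)%R & forall f, measurable_fun setT f ->
  associate_over mu (wnorm mu q v) f < +oo ->
  associate_over mu (wnorm mu q v) (fun x => maximal (fun y => `|f y| `^ t) x `^ t^-1) <=
  C%:E * associate_over mu (wnorm mu q v) f.
Proof.
move=> t0 tk r0 Boo; apply: (associate_maximal_pow mu_gt0 mq mv q1 v0 mE ndE Efin Ecover DB
  (ltW k1) power_maximal_bounded t0 tk).
have mB := ball_measurable DB c r.
(* The indicator of a ball is the function of positive finite norm; a zero norm would make the ball
   a null set. *)
exists (fun x => (\1_(B c r) x)%:E); split => //; first exact: m_indic.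
rewrite lt0e wnorm_ge0 andbT; apply/eqP => /(wnorm_eq0 mu_gt0 mq mv q1 v0 (m_indic mB)).
case=> N [mN N0 sub]; have := ball_gt0 DB c r0; rewrite ltNge => /negP; apply.
rewrite -N0; apply: le_measure; rewrite ?inE// => x Bx; apply: sub => /=.
by rewrite indicE mem_set// => /eqP; rewrite eqe oner_eq0.
Qed.

Lemma var_norm_maximal_vector (theta : R) : (0 < theta)%R -> (theta < s^-1)%R ->
  exists2 C : R, (0 < C)%R & forall f : nat -> T -> \bar R,
  (forall j, measurable_fun setT (f j)) ->
  var_norm_over mu (EFin \o p) (fun x =>
    (\sum_(0 <= j <oo) (maximal (fun y => `|f j y| `^ theta) x `^ theta^-1) `^ s^-1) `^ s * w x)
  <= C%:E * var_norm_over mu (EFin \o p) (fun x =>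
    (\sum_(0 <= j <oo) `|f j x| `^ s^-1) `^ s * w x).
Proof.
move=> th0 ths; pose r := (theta^-1 * s^-1)%R.
have r1 : (1 < r)%R by rewrite /r mulrC ltr_pdivlMr// mul1r.
have [C C0 HC] := wnorm_maximal_vector mu_gt0 mq mv q1 v0 mE ndE Efin Ecover DB (ltW k1)
  power_maximal_bounded r1.
(* The bound holds for the convexified norm; its [s]-th power is the one for the exponent [p]. *)
exists (C `^ s)%R; first exact: powR_gt0.
move=> f mf; pose u j x := `|f j x| `^ theta.
have mu_ j : measurable_fun setT (u j) by exact: measurable_abse_pow.
have u0 j x : 0 <= u j x by exact: poweR_ge0.
have msum (g : nat -> T -> \bar R) : (forall j, measurable_fun setT (g j)) ->
    (forall j x, 0 <= g j x) ->
    var_norm_over mu (EFin \o p) (fun x => (\sum_(0 <= j <oo) g j x) `^ s * w x) =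
    wnorm mu q v (fun x => \sum_(0 <= j <oo) g j x) `^ s.
  move=> mg g0; rewrite -wnorm_power//; last by apply: ge0_emeasurable_sum => *.
  by congr var_norm_over; apply/funext => x; rewrite gee0_abs// nneseries_ge0.
have := HC u mu_ u0.
rewrite (_ : (fun x => \sum_(0 <= j <oo) u j x `^ r) =
    fun x => \sum_(0 <= j <oo) `|f j x| `^ s^-1); last first.
  apply/funext => x; apply: eq_eseriesr => j _.
  by rewrite /u -poweRrM mulrA divff ?mul1r// gt_eqF.
rewrite (_ : (fun x => \sum_(0 <= j <oo) maximal (u j) x `^ r) = fun x =>
    \sum_(0 <= j <oo) (maximal (fun y => `|f j y| `^ theta) x `^ theta^-1) `^ s^-1); last first.
  by apply/funext => x; apply: eq_eseriesr => j _; rewrite -poweRrM.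
move=> /(lee_poweR (ltW s0)(wnorm_ge0 _ _ _ _)).
rewrite poweRM ?wnorm_ge0 ?lee_fin ?(ltW C0)// poweR_EFin.
rewrite -!msum//.
- by move=> j; exact: measurable_abse_pow.
- by move=> j x; exact: poweR_ge0.
- move=> j; do 2 (apply: (measurableT_comp (measurable_poweR _))).
  exact: measurable_maximal DB _.
- by move=> j x; exact: poweR_ge0.
Qed.

End regular_weight.

(** * Lebesgue measure and Euclidean balls *)

Section lebesgue_spaces.
Context {R : realType} {n : nat}.
Local Notation mu := (lebesgue R n).

Lemma doubling_eball : exists K, doubling_balls mu K (@eball R n).
Proof.
have [K K0 HK] := @lebesgue_doubling R n; exists K; split.
- exact: measurable_eball.
- exact: lebesgue_eball_gt0.
- exact: lebesgue_eball_lty.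
- by move=> c r r0; rewrite eballE euclidxx.
- by move=> c r r0 y; rewrite !eballE => /lt_trans; apply; lra.
- exact: eball_eball.
- exact: eball0.
- exact: lindelof_eball.
- exact: K0.
- exact: HK.
Qed.

Let c0 : Rn R n := [tuple 0%R | i < n].
Let E (N : nat) : set (Rn R n) := eball c0 N%:R.

Let mE N : measurable (E N). Proof. exact: measurable_eball. Qed.

Let Efin N : mu (E N) < +oo. Proof. exact: lebesgue_eball_lty. Qed.

Let ndE : nondecreasing_seq E.
Proof.
move=> N M NM; apply/subsetPset => y; rewrite /E !eballE => /lt_le_trans; apply.
by rewrite ler_nat.
Qed.

Let Ecover x : exists N, E N x.
Proof.
exists (Num.truncn (euclid c0 x)).+1; rewrite /E eballE.
exact: truncnS_gt.
Qed.

Variables (p : Rn R n -> R) (w : Rn R n -> \bar R).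
Hypotheses (p_exponent : exponent p) (w_weight : weight_class p w).

Lemma ess_inf_fin_num : ess_inf mu (EFin \o p) \is a fin_num.
Proof.
have [_ _ m0 _] := p_exponent; rewrite ge0_fin_numE ?(ltW m0)// ltey; apply/eqP.
move=> /ess_inf_eqyP[N [mN N0 sub]].
have := @lebesgue_setT_gt0 R n; rewrite ltNge => /negP; apply.
by rewrite -N0; apply: le_measure; rewrite ?inE// => x _; exact: sub.
Qed.

Lemma p_star_gt0 : (0 < p_star p)%R.
Proof.
have [_ _ m0 _] := p_exponent; rewrite lt_min ltr01 andbT fine_gt0// m0/=.
by have := ess_inf_fin_num; rewrite fin_numE ltey => /andP[].
Qed.

Lemma ae_inv_p_star_ge1 : {ae mu, forall x, (1 <= (p_star p)^-1 * p x)%R}.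
Proof.
apply: filterS (ess_inf_le mu (EFin \o p)) => x.
rewrite -(fineK ess_inf_fin_num) lee_fin => px.
rewrite ler_pdivlMl ?p_star_gt0// mulr1; apply: le_trans px.
by rewrite ge_min lexx.
Qed.

Variable s : R.
Hypotheses (s1 : (1 < s)%R) (sp1 : {ae mu, forall x, (1 <= s * p x)%R}).

Let s0 : (0 < s)%R. Proof. exact: lt_trans s1. Qed.

(** [s p >= 1] almost everywhere puts [1 / s] below the essential infimum of [p], and [s > 1] puts
    it below 1. *)
Lemma inv_p_star_le : ((p_star p)^-1 <= s)%R.
Proof.
rewrite -[leRHS]invrK lef_pV2 ?posrE ?invr_gt0 ?p_star_gt0//.
rewrite le_min [X in _ && X]invf_le1 ?(ltW s1)// andbT -lee_fin (fineK ess_inf_fin_num).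
apply/ess_infP; apply: filterS sp1 => x spx.
by rewrite lee_fin -[leLHS]mulr1 ler_pdivrMl.
Qed.

Let mp : measurable_fun setT p. Proof. by case: p_exponent. Qed.
Let p0 : forall x, (0 < p x)%R. Proof. by case: p_exponent. Qed.
Let mw := weight_measurable w_weight.
Let w0 := weight_pos_fin w_weight.
Let mu_gt0 := @lebesgue_setT_gt0 R n.
Let mq := measurable_clipped_exponent mp s.
Let mv := measurable_root_weight mw s.
Let q1 := clipped_exponent_ge1 p s.
Let v0 := root_weight_gt0 w s.
Local Notation N := (wnorm mu (clipped_exponent p s) (root_weight w s)).
Local Notation X := (convexification s (weighted_norm (EFin \o p) w)).

Lemma convexificationE f : measurable_fun setT f -> X f = N f.
Proof. by move=> mf; rewrite -(convexification_wnorm mu_gt0 mp p0 mw w0 s1 sp1 mf). Qed.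

Lemma wnorm_eball_lty c (r : R) : (0 < r)%R -> N (fun x => (\1_(eball c r) x)%:E) < +oo.
Proof.
move=> r0; exact: (wnorm_indic_lty mu_gt0 mp p0 mw w0 s1 sp1 (measurable_eball c r) p_star_gt0
  (weight_ball w_weight c r0)).
Qed.

Lemma ball_banach_convexification : ball_banach X.
Proof.
have XE := convexificationE.
have tri f g : in_space X f -> in_space X g -> X (f \+ g) <= X f + X g.
  move=> [mf Xf] [mg Xg]; move: Xf Xg; rewrite (XE _ mf) (XE _ mg) => Xf Xg.
  rewrite (XE _ (emeasurable_funD mf mg)).
  exact: (wnorm_triangle mu_gt0 mq mv q1 v0 mf mg Xf Xg).
have mB (c : Rn R n) (r : R) : measurable_fun setT (fun x => (\1_(eball c r) x)%:E : \bar R).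
  by apply/measurable_EFinP; apply: measurable_indic; exact: measurable_eball.
split; [split|exact: tri|].
- by move=> f mf; rewrite (XE _ mf); exact: wnorm_ge0.
- move=> f [mf Xf]; rewrite (XE _ mf) in Xf.
  exact: (wnorm_fin_num mu_gt0 mq mv q1 v0 mf Xf).
- move=> a f [mf _]; rewrite (XE _ mf) (XE _ (measurable_funeM _ mf)).
  exact: (wnorm_scale mu_gt0 mq mv q1 a mf).
- by exists 1%R => f g Xf Xg; rewrite mul1e; exact: tri.
- move=> f mf; rewrite (XE _ mf) => Xf; exact: (wnorm_eq0 mu_gt0 mq mv q1 v0 mf Xf).
- move=> f g mf mg gf; rewrite (XE _ mf) (XE _ mg).
  exact: (ae_le_wnorm mu_gt0 mq mv q1 mf mg gf).
- move=> u f mu_ mf uf; rewrite (XE _ mf).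
  rewrite (_ : (fun m => X (u m)) = fun m => N (u m)); last first.
    by apply/funext => m; exact: XE.
  exact: (wnorm_fatou mu_gt0 mq mv q1 v0 mu_ mf uf).
- move=> c r r0; split; first exact: mB.
  by rewrite (XE _ (mB c r)); exact: wnorm_eball_lty.
(* Local integrability: [weight_ball_dual] speaks of the exponent [1 / p_star], and
   [integral_le_wnorm] carries it over to [s]. *)
move=> c r r0; have ps0 := p_star_gt0.
have ips0 : (0 < (p_star p)^-1)%R by rewrite invr_gt0.
have dB := dual_wnorm_indic_lty mu_gt0 mp p0 mw w0 (measurable_eball c r) ps0 ae_inv_p_star_ge1
  (weight_ball_dual w_weight c r0).
have [C C0 HC] := integral_le_wnorm mu_gt0 mp p0 mw w0 ips0 inv_p_star_le ae_inv_p_star_ge1 sp1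
  (measurable_eball c r) (lebesgue_eball_lty c r) dB.
exists C => // f [mf Xf]; rewrite (XE _ mf) in Xf *; exact: HC.
Qed.

(** The supremum runs over measurable [g] only, on which the two norms agree. *)
Lemma associate_convexification : associate X = associate_over mu N.
Proof.
apply/funext => f; congr ereal_sup; apply/seteqP; split => _ [g [[mg Xg] X1] <-].
  by exists g => //; rewrite (convexificationE mg) in Xg X1.
exists g => //; split; last by rewrite convexificationE.
by split; rewrite ?convexificationE.
Qed.

Lemma convexification_maximal_vector (k theta : R) : (1 < k)%R -> maximal_cond p w s k ->
  (0 < theta)%R -> (theta < s^-1)%R ->
  exists2 C : R, (0 < C)%R & forall f : nat -> Rn R n -> \bar R,
  (forall j, measurable_fun [set: Rn R n] (f j)) ->
  weighted_norm (EFin \o p) w (fun x => (\sum_(0 <= j <oo) maximal_pow theta (f j) x `^ s^-1) `^ s)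
  <= C%:E * weighted_norm (EFin \o p) w (fun x => (\sum_(0 <= j <oo) `|f j x| `^ s^-1) `^ s).
Proof.
move=> k1 [_ bounded]; have [K DB] := doubling_eball.
exact: (var_norm_maximal_vector mu_gt0 mp p0 mw w0 s1 sp1 DB mE ndE Efin Ecover k1 bounded).
Qed.

Lemma associate_convexification_maximal_pow (k t : R) : (1 < k)%R -> maximal_cond p w s k ->
  (0 < t)%R -> (t <= k)%R ->
  exists2 C : R, (0 < C)%R & forall f, in_space (associate X) f ->
  associate X (maximal_pow t f) <= C%:E * associate X f.
Proof.
move=> k1 [_ bounded] t0 tk; have [K DB] := doubling_eball.
have [C C0 HC] := associate_wnorm_maximal_pow mu_gt0 mp p0 mw w0 s1 sp1 DB mE ndE Efin Ecover k1
  bounded t0 tk ltr01 (wnorm_eball_lty c0 ltr01).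
rewrite associate_convexification; exists C => // f [mf Xf]; exact: HC.
Qed.

(** Conjugation reverses the order: [kappa' < q0 s] means [(q0 s)' < kappa], and a supremum above
    [(q0 s)'] has a member above it. For [kappa = +oo] the finiteness of [(q0 s)'] is enough. *)
Lemma conjugate_lt_kappa (q0 : R) : (exists2 k : R, (1 < k)%R & maximal_cond p w s k) ->
  Order.max (hoelder_conjugate (kappa p w s) * (s^-1)%:E) 1 < q0%:E ->
  exists k : R, [/\ (1 < k)%R, maximal_cond p w s k & (q0 * s / (q0 * s - 1) < k)%R].
Proof.
move=> [k1 k11 Hk1] Hq0.
have kk : k1%:E <= kappa p w s by apply: ereal_sup_ubound; exists k1.
have q01 : (1 < q0)%R.
  by rewrite -lte_fin; apply: le_lt_trans Hq0; rewrite le_max lexx orbT.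
have qs1 : (1 < q0 * s)%R by rewrite -[ltLHS]mulr1 ltr_pM.
have : (q0 * s / (q0 * s - 1))%:E < kappa p w s.
  case: (kappa p w s) kk Hq0 => [K| |]; last by rewrite leNgt ltNyr.
    rewrite lee_fin => /(lt_le_trans k11) K1; rewrite hoelder_conjugate_fin//.
    rewrite gt_max -EFinM !lte_fin => /andP[+ _].
    have K10 : (0 < K - 1)%R by rewrite subr_gt0.
    have Q10 : (0 < q0 * s - 1)%R by rewrite subr_gt0.
    rewrite ltr_pdivrMr// ltr_pdivrMr// ltr_pdivrMr//; lra.
  by rewrite ltry.
by move=> /ereal_sup_gt[_ [k [k11' Hk] <-]]; rewrite lte_fin => tk; exists k.
Qed.

End lebesgue_spaces.

Unset Implicit Arguments.

Theorem theorem3p9 (R : realType) (n : nat) (n_gt0 : (0 < n)%N)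
    (p : Rn R n -> R) (p_exponent : exponent p)
    (w : Rn R n -> \bar R) (w_weight : weight_class p w)
    (s : R) (s_gt1 : (1 < s)%R)
    (s_maximal : exists2 k : R, (1 < k)%R & maximal_cond p w s k)
    (theta h q0 : R) (theta_gt0 : (0 < theta)%R) (theta_lt : (theta < 1 / s)%R)
    (hE : h = (1 / s)%R)
    (q0_gt : Order.max (hoelder_conjugate (kappa p w s) * (s^-1)%:E) 1 < q0%:E) :
  let Lpw : norm_space := weighted_norm (EFin \o p) w in
  let X : norm_space := convexification (1 / h)%R Lpw in
  (exists2 C : R, (0 < C)%R &
    forall f : nat -> Rn R n -> \bar R,
      (forall j, measurable_fun [set: Rn R n] (f j)) ->
      Lpw (fun x => (\sum_(0 <= j <oo) maximal_pow theta (f j) x `^ h)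
                      `^ (1 / h)%R)
      <= C%:E * Lpw (fun x => (\sum_(0 <= j <oo) `|f j x| `^ h) `^ (1 / h)%R))
  /\
  ball_banach X /\
  (exists2 C : R, (0 < C)%R &
    forall f : Rn R n -> \bar R, in_space (associate X) f ->
      associate X (maximal_pow (fine (hoelder_conjugate (q0 / h)%:E)) f)
      <= C%:E * associate X f).
Proof.
have [k0 k01 Hk0] := s_maximal; have sp1 := Hk0.1.
have s0 : (0 < s)%R := lt_trans ltr01 s_gt1.
have q01 : (1 < q0)%R.
  by rewrite -lte_fin; apply: le_lt_trans q0_gt; rewrite le_max lexx orbT.
rewrite {h}hE; rewrite !div1r invrK in theta_lt *.
move=> Lpw X; split; [|split].
- exact: (convexification_maximal_vector p_exponent w_weight s_gt1 sp1 k01 Hk0 theta_gt0 theta_lt).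
- exact: (ball_banach_convexification p_exponent w_weight s_gt1 sp1).
have [k [k1 Hk tk]] := conjugate_lt_kappa s_gt1 s_maximal q0_gt.
have qs1 : (1 < q0 * s)%R by rewrite -[ltLHS]mulr1 ltr_pM.
rewrite hoelder_conjugate_fin//=.
apply: (associate_convexification_maximal_pow p_exponent w_weight s_gt1 sp1 k1 Hk _ (ltW tk)).
by rewrite divr_gt0 ?subr_gt0// (lt_trans ltr01).
Qed.
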